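(* Let $\alpha(x)$ be a sub-polynomial such that $\lim_{x\to+\infty}\alpha(x)=+\infty$. Then the following are equivalent: (1) $\lfloor\alpha(n)\rfloor$ is even for infinitely many $n\in\mathbb{N}$. (2) For every finite coloring of $\mathbb{N}$, there are distinct $x,y\in\mathbb{N}$ of the same color and $n\in\mathbb{N}$ such that $x+y=\lfloor\alpha(n)\rfloor$.
   Context: $\mathbb{N}=\{1,2,\dots\}$. Let $\mathcal{G}$ be the ring (under pointwise addition and multiplication) of germs at $+\infty$ of continuous real-valued functions defined on half-lines $(a,+\infty)$; two functions have the same germ if they agree for all sufficiently large $x$. A Hardy field is a subfield of $\mathcal{G}$ closed under differentiation (each element is eventually differentiable and its derivative's germ lies in the field). A sub-polynomial is a function $\alpha$ whose germ belongs to some Hardy field and which satisfies $\lim_{x\to+\infty}\alpha(x)/x^l=0$ for some $l>0$. Functions and germs are not distinguished; when values $\alpha(n)$, $n\in\mathbb{N}$, appear, $\alpha$ denotes a fixed real-valued representative defined on $[1,+\infty)$. *)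

(* Defs.v *)
From HB Require Import structures.
From mathcomp Require Import all_boot all_order all_algebra.
From mathcomp Require Import all_classical all_reals all_analysis.

Set Implicit Arguments.
Unset Strict Implicit.
Unset Printing Implicit Defensive.

Import Order.TTheory GRing.Theory Num.Theory.
Import numFieldNormedType.Exports.

Local Open Scope classical_set_scope.
Local Open Scope ring_scope.

Definition germ_eq (R : realType) (f g : R -> R) : Prop :=
  \forall x \near +oo, f x = g x.

(* A germ at +oo is represented by any total function R -> R in its class, with
   arbitrary values away from +oo, and a set of germs by the set of all their
   representatives, i.e. by a set of functions closed under [germ_eq]. *)
Record hardy_field (R : realType) (H : set (R -> R)) : Prop := HardyField {
  hardy_germ : forall f g, germ_eq f g -> H f -> H g;
  hardy_continuous : forall f, H f -> \forall x \near +oo, {for x, continuous f};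
  hardy1 : H (fun=> 1);
  hardyB : forall f g, H f -> H g -> H (f \- g);
  hardyM : forall f g, H f -> H g -> H (f \* g);
  hardyV : forall f, H f -> ~ germ_eq f (fun=> 0) ->
    exists2 g, H g & germ_eq (f \* g) (fun=> 1);
  hardy_derivable : forall f, H f -> \forall x \near +oo, derivable f x 1;
  hardy_derive : forall f, H f -> H (derive1 f)
}.

Definition sub_polynomial (R : realType) (alpha : R -> R) : Prop :=
  (exists2 H : set (R -> R), hardy_field H & H alpha) /\
  (exists2 l : R, 0 < l & alpha x / x `^ l @[x --> +oo] --> 0).

(* Main.v *)
(* Half of the equivalence is a colouring of the large integers by parity. For the other half, let d
   be the last order for which the derivative of alpha does not tend to 0. If d = 0, the integer parts
   of alpha(n) omit only finitely many positive integers. If d > 0, compare x^(d+1) alpha^(d+1)(x)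
   with alpha^(d)(x).

   If the former is not eventually dominated by the latter, van der Corput differencing shows that at
   suitable scales T all frequencies between C/T and a constant have small exponential sums along
   alpha, and by Parseval any dense set of integers then has two distinct elements whose sum is an
   integer part of alpha(n).

   Otherwise alpha = P + e with P a real polynomial of degree d and e^(j) = O(x^-j). If some non-constant
   coefficient of P is not a rational multiple of the leading one, differencing that isolates it again
   gives small exponential sums. If not, P = kappa + gamma p with p in Z[x], and the frequencies near
   rationals of bounded denominator obstruct. They disappear along n = n0 + p'(n0) V h with V divisible
   by these denominators, where gamma p runs through the values of gamma' (h + O(V h^2)), provided that
   the summands are taken among the integers floor (xi + gamma' u), with xi adjusted to the slowly
   varying e. This is possible for every n0, except when gamma is rational and e bounded: there the
   parity of floor (kappa + gamma p(n0) + e) is eventually constant, and (1) provides an n0 for which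
   it is even. *)
Require Import Defs.
From HB Require Import structures.
From mathcomp Require Import all_boot all_order all_algebra.
From mathcomp Require Import all_classical all_reals all_analysis.
From mathcomp Require Import ring lra zify.

Set Implicit Arguments.
Unset Strict Implicit.
Unset Printing Implicit Defensive.

Import Order.TTheory GRing.Theory Num.Theory.
Import numFieldNormedType.Exports.

Local Open Scope classical_set_scope.
Local Open Scope ring_scope.

(** * Exponential sums and van der Corput differencing *)

Section CosineSums.
Variable R : realType.
Implicit Types (x y t theta : R) (n m s : nat).

(** Frequencies below C/T need no estimate. Smoothing the targets over K consecutive shifts, K a
    small multiple of T, does not change these frequencies noticeably, and it suppresses nothing
    that matters: the number of shifted targets equal to a given integer is found by counting terms
    of a slowly increasing sequence in an interval.

    Equal summands are excluded by size: pairs with equal summands represent each integer boundedly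
    often, while the average number of representations of a target grows like T.

    In the lattice case the constants look circular. The leading coefficient of the polynomial in h
    contains a power of V, so the reduced denominators q that occur depend on V and may exceed it.
    But V only has to contain their primes: if a prime l divides q and V, one difference with step
    q/l turns the frequency b/q into b/l modulo 1, because the polynomial is congruent to h modulo
    V. The part of q that does not come from the coefficients depends only on the degree and the
    number of colours, hence is known before V is chosen. *)

Definition cs x : R := cos (x * (pi *+ 2)).

Lemma csN x : cs (- x) = cs x.
Proof. by rewrite /cs mulNr cosN. Qed.

Lemma cs0 : cs 0 = 1.
Proof. by rewrite /cs mul0r cos0. Qed.

Lemma cs_le1 x : `|cs x| <= 1.
Proof. exact: cos_max. Qed.

Lemma csDn x n : cs (x + n%:R) = cs x.
Proof.
have -> : cs (x + n%:R) = cos (x * (pi *+ 2) + (pi *+ 2) *+ n).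
  by rewrite /cs mulrDl mulr_natl.
by rewrite (periodicn (@cosD2pi R)).
Qed.

Lemma csDz x (z : int) : cs (x + z%:~R) = cs x.
Proof.
case: z => n; first exact: csDn.
rewrite NegzE mulrNz; have := csDn (x - n.+1%:R) n.+1.
by rewrite subrK => ->.
Qed.

Lemma cs_lipschitz x y : `|cs x - cs y| <= 8 * `|x - y|.
Proof.
have pi4 : pi < 4 :> R by have := @pihalf_lt2 R; lra.
have cosL (a b : R) : a < b -> `|cos b - cos a| <= `|b - a|.
  move=> ab.
  have [c _ ->] := @MVT R cos (fun z => - sin z) a b ab
    (fun z _ => is_derive_cos z) (continuous_subspaceT (@continuous_cos R)).
  by rewrite normrM normrN ler_piMl// sin_max.
have cosl (a b : R) : `|cos b - cos a| <= `|b - a|.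
  case: (ltgtP a b) => [/cosL//|/cosL|->]; last by rewrite !subrr.
  by rewrite distrC [leRHS]distrC.
apply: (le_trans (cosl _ _)).
have pi0 := @pi_ge0 R.
rewrite -mulrBl normrM mulrC ler_wpM2r// -mulr_natl ger0_norm; lra.
Qed.

(** A weak Jordan inequality by halving the angle: with [v = pi * theta / 2 <= pi / 4],
    [sin (2 v) = 2 sin v cos v] and [sin v = v cos c] by the mean value theorem, and both cosines
    are at least 1/2. *)
Lemma sin_pi_ge theta : 0 <= theta <= 2^-1 -> theta / 2 <= sin (pi * theta).
Proof.
move=> /andP[t0 t2].
have pi0 := @pi_gt0 R; have pi2 := @pi_ge2 R.
have cos_ge (u : R) : 0 <= u <= pi / 4 -> 2^-1 <= cos u.
  move=> /andP[u0 u4].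
  have c0 : 0 <= cos u by apply: cos_ge0_pihalf; apply/andP; split; lra.
  have : 0 <= cos (u *+ 2).
    by apply: cos_ge0_pihalf; rewrite -mulr_natl; apply/andP; split; lra.
  by rewrite cos_mulr2n -mulr_natl => h; rewrite leNgt; apply/negP => h2; nra.
case: (ltgtP theta 0) => [|tp|->]; [lra| |by rewrite mulr0 sin0 mul0r].
pose v := pi * theta / 2.
have v0 : 0 < v by rewrite /v; nra.
have v4 : v <= pi / 4 by rewrite /v; nra.
have -> : pi * theta = v *+ 2 by rewrite /v; lra.
rewrite sin_mulr2n -mulr_natl.
have [c] := @MVT R sin cos 0 v v0
    (fun z _ => is_derive_sin z) (continuous_subspaceT (@continuous_sin R)).
rewrite in_itv/= => /andP[c0 cv]; rewrite sin0 !subr0 => ->.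
have h1 : 2^-1 <= cos c by apply: cos_ge; lra.
have h2 : 2^-1 <= cos v by apply: cos_ge; lra.
have h3 : 4^-1 <= cos v * cos c by nra.
have h4 : theta <= v by rewrite /v; nra.
nra.
Qed.

(** By the product formula each term becomes a difference of two sines, and these telescope. *)
Lemma geometric_cs_sin theta t n :
  2 * sin (pi * theta) * (\sum_(i < n) cs (i%:R * theta + t)) =
  sin (pi * ((2 * n%:R - 1) * theta + 2 * t)) - sin (pi * (2 * t - theta)).
Proof.
elim: n => [|n IH].
  by rewrite big_ord0 mulr0 (_ : (2 * 0%:R - 1) * theta + 2 * t = 2 * t - theta) ?subrr//; ring.
rewrite big_ord_recr/= mulrDr IH.
have -> : pi * ((2 * n.+1%:R - 1) * theta + 2 * t)
  = (n%:R * theta + t) * (pi *+ 2) + pi * theta.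
  by rewrite -mulr_natl -[n.+1]addn1 natrD; ring.
have -> : pi * ((2 * n%:R - 1) * theta + 2 * t)
  = (n%:R * theta + t) * (pi *+ 2) - pi * theta.
  by rewrite -mulr_natl; ring.
by rewrite !sinD sinN cosN /cs; ring.
Qed.

Lemma geometric_cs_le theta t n : `|theta| <= 2^-1 ->
  `|\sum_(i < n) cs (i%:R * theta + t)| * `|theta| <= 2.
Proof.
move=> th.
have h1 : `|theta| <= 2 * `|sin (pi * theta)|.
  have : `|theta| / 2 <= `|sin (pi * `|theta|)|.
    by apply: le_trans (ler_norm _); apply: sin_pi_ge; rewrite normr_ge0.
  by case: (ger0P theta) => _; rewrite ?mulrN ?sinN ?normrN; lra.
have h2 : 2 * `|sin (pi * theta)| * `|\sum_(i < n) cs (i%:R * theta + t)| <= 2.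
  rewrite -[X in X * _ * _]ger0_norm// -!normrM geometric_cs_sin.
  by apply: (le_trans (ler_normB _ _)); rewrite -[leRHS](_ : 1 + 1 = _)// lerD// sin_max.
have := normr_ge0 (\sum_(i < n) cs (i%:R * theta + t)); nra.
Qed.

Lemma orthogonality_cs (p : nat) (w : int) : (0 < p)%N -> (`|w| < p)%N ->
  \sum_(i < p) cs (i%:R * (w%:~R / p%:R)) = if w == 0 then p%:R else 0 :> R.
Proof.
move=> p0 wp; have p0' : p%:R != 0 :> R by rewrite pnatr_eq0 -lt0n.
case: eqP => [->|/eqP w0].
  under eq_bigr do rewrite mulr0z mul0r mulr0 cs0.
  by rewrite sumr_const card_ord.
have key := geometric_cs_sin (w%:~R / p%:R) 0 p.
have sn0 : sin (pi * (w%:~R / p%:R)) != 0 :> R.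
  have pos (u : nat) : (0 < u < p)%N -> 0 < sin (pi * (u%:R / p%:R)) :> R.
    move=> /andP[u0 up]; apply: sin_gt0_pi; have pi0 := @pi_gt0 R.
    have p1 : 0 < p%:R :> R by rewrite ltr0n.
    rewrite mulr_gt0 ?divr_gt0 ?ltr0n//= -[ltRHS]mulr1 ltr_pM2l//.
    by rewrite ltr_pdivrMr// mul1r ltr_nat.
  case: w w0 wp {key} => u u0 up.
    by rewrite gt_eqF// pos// lt0n u0.
  rewrite NegzE mulrNz mulNr mulrN sinN oppr_eq0 gt_eqF// pos//.
have {}key : 2 * sin (pi * (w%:~R / p%:R)) * (\sum_(i < p) cs (i%:R * (w%:~R / p%:R) + 0)) = 0.
  rewrite key; apply/eqP; rewrite subr_eq0; apply/eqP.
  have -> : pi * ((2 * p%:R - 1) * (w%:~R / p%:R) + 2 * 0)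
     = pi * (2 * 0 - w%:~R / p%:R) + w%:~R * (pi *+ 2) :> R.
    by rewrite -mulr_natl; field.
  have sinDz (y : R) (z : int) : sin (y + z%:~R * (pi *+ 2)) = sin y.
    have sinDn x' (u : nat) : sin (x' + u%:R * (pi *+ 2)) = sin x' :> R.
      by rewrite mulr_natl (periodicn (@sinD2pi R)).
    case: z => u; first exact: sinDn.
    rewrite NegzE mulrNz mulNr; have := sinDn (y - u.+1%:R * (pi *+ 2)) u.+1.
    by rewrite subrK => ->.
  by rewrite sinDz; congr (sin (_ * _)); ring.
move/eqP: key; rewrite !mulf_eq0 pnatr_eq0 (negbTE sn0)/= => /eqP key.
by rewrite -[RHS]key; apply: eq_bigr => i _; rewrite addr0.
Qed.

End CosineSums.

(** * Van der Corput's inequality and its iteration *)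

Section Weyl.
Variable R : realType.
Implicit Types (phi psi theta : nat -> R) (a m s : nat) (eps t : R).

Lemma cs_int (x y : R) : y \is a Num.int -> cs (x + y) = cs x.
Proof. by move=> /intrP[z ->]; exact: csDz. Qed.

(** Cosines stand in for complex exponentials: demanding the bound for every phase [t] controls the
    real and the imaginary part at once. *)
Definition avg_small phi a m eps :=
  forall t, `|\sum_(i < m) cs (phi (a + i)%N + t)| <= eps * m%:R.

Lemma avg_smallN phi a m eps :
  avg_small (fun n => - phi n) a m eps -> avg_small phi a m eps.
Proof.
move=> h t; have := h (- t); congr (`| _ | <= _).
by apply: eq_bigr => i _; rewrite -opprD csN.
Qed.

Lemma eq_avg_small phi psi a m eps : phi =1 psi ->
  avg_small phi a m eps -> avg_small psi a m eps.
Proof.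
move=> e h t; have := h t; congr (`| _ | <= _).
by apply: eq_bigr => i _; rewrite e.
Qed.

Lemma sum_shift (f : nat -> R) a m s : (forall n, `|f n| <= 1) ->
  `|\sum_(i < m) f (a + i)%N - \sum_(i < m) f (a + i + s)%N| <= 2 * s%:R.
Proof.
move=> f1.
have e : \sum_(i < m) f (a + i)%N + \sum_(i < s) f (a + (m + i))%N
       = \sum_(i < s) f (a + i)%N + \sum_(i < m) f (a + (s + i))%N.
  have h p q : \sum_(i < p + q) f (a + i)%N
      = \sum_(i < p) f (a + i)%N + \sum_(i < q) f (a + (p + i))%N.
    by rewrite big_split_ord.
  by rewrite -!h addnC.
have -> : \sum_(i < m) f (a + i + s)%N = \sum_(i < m) f (a + (s + i))%N.
  by apply: eq_bigr => i _; congr f; lia.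
have b c : `|\sum_(i < s) f (c i)| <= s%:R.
  apply: (le_trans (ler_norm_sum _ _ _)); rewrite -[X in _ <= X%:R]card_ord -sum1_card natr_sum.
  exact: ler_sum.
have -> : \sum_(i < m) f (a + i)%N - \sum_(i < m) f (a + (s + i))%N
   = \sum_(i < s) f (a + i)%N - \sum_(i < s) f (a + (m + i))%N.
  by move: e; lra.
by apply: (le_trans (ler_normB _ _)); rewrite mulr_natl mulr2n lerD.
Qed.

Lemma sum_average (f : nat -> R) a m s h : (forall n, `|f n| <= 1) ->
  `|h%:R * (\sum_(i < m) f (a + i)%N) - \sum_(i < m) \sum_(j < h) f (a + i + s * j)%N|
    <= 2 * s%:R * h%:R ^+ 2.
Proof.
move=> f1; rewrite exchange_big/=.
have -> : h%:R * (\sum_(i < m) f (a + i)%N) = \sum_(j < h) \sum_(i < m) f (a + i)%N.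
  by rewrite sumr_const card_ord mulr_natl.
rewrite -sumrB; apply: (le_trans (ler_norm_sum _ _ _)).
have -> : 2 * s%:R * h%:R ^+ 2 = \sum_(j < h) 2 * (s * h)%:R :> R.
  by rewrite sumr_const card_ord natrM -mulr_natl; ring.
apply: ler_sum => j _; apply: (le_trans (sum_shift _ _ _ f1)).
by rewrite ler_pM2l// ler_nat leq_mul// ltnW.
Qed.

(** The right-hand side is the squared modulus of the complex exponential sum, which does not depend
    on the phase [t]; the square of its sine part is dropped. *)
Lemma sqr_cs_sum (h : nat) (u : 'I_h -> R) t :
  (\sum_(i < h) cs (u i + t)) ^+ 2 <= \sum_(i < h) \sum_(j < h) cs (u i - u j).
Proof.
pose sn (x : R) := sin (x * (pi *+ 2)).
have -> : \sum_(i < h) \sum_(j < h) cs (u i - u j) =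
    (\sum_(i < h) cs (u i + t)) ^+ 2 + (\sum_(i < h) sn (u i + t)) ^+ 2.
  rewrite !expr2 !mulr_suml -big_split/=; apply: eq_bigr => i _.
  rewrite !mulr_sumr -big_split/=; apply: eq_bigr => j _.
  by rewrite /cs /sn -cosB; congr cos; ring.
by rewrite lerDl sqr_ge0.
Qed.

Lemma sqr_sum_le (n : nat) (u : 'I_n -> R) :
  (\sum_(i < n) u i) ^+ 2 <= n%:R * \sum_(i < n) u i ^+ 2.
Proof.
have : 0 <= \sum_(i < n) \sum_(j < n) (u i - u j) ^+ 2.
  by apply: sumr_ge0 => i _; apply: sumr_ge0 => j _; exact: sqr_ge0.
have -> : \sum_(i < n) \sum_(j < n) (u i - u j) ^+ 2 =
    2 * (n%:R * (\sum_(i < n) u i ^+ 2) - (\sum_(i < n) u i) ^+ 2).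
  have -> : \sum_(i < n) \sum_(j < n) (u i - u j) ^+ 2 =
     \sum_(i < n) (n%:R * u i ^+ 2 + \sum_(j < n) u j ^+ 2 - 2 * u i * \sum_(j < n) u j).
    apply: eq_bigr => i _; rewrite mulr_sumr mulr_natl -[X in _ *+ X]card_ord -sumr_const.
    by rewrite -big_split -sumrB; apply: eq_bigr => j _ /=; ring.
  rewrite sumrB big_split/= -mulr_sumr sumr_const card_ord -mulr_suml -mulr_sumr -mulr_natl; ring.
by rewrite pmulr_rge0// subr_ge0.
Qed.

(** Average over [h] shifts by multiples of [s], apply Cauchy-Schwarz and expand the square. The
    diagonal is controlled by [8 <= h * eps^2], the other terms by the hypothesis on the differences
    with steps [s * d], and the boundary terms by [32 * s * h <= eps^2 * m]. *)
Lemma van_der_corput phi a m s h eps : 0 < eps <= 1 -> 8 <= h%:R * eps ^+ 2 ->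
  32 * (s * h)%:R <= eps ^+ 2 * m%:R ->
  (forall d, (0 < d < h)%N ->
    avg_small (fun n => phi (n + s * d)%N - phi n) a m (eps ^+ 2 / 8)) ->
  avg_small phi a m eps.
Proof.
move=> /andP[eps0 eps1] h8 shm hd t.
set S := \sum_(i < m) _.
case: (posnP m) => [m0|m0].
  by rewrite /S; subst m; rewrite big_ord0 normr0 mulr0.
have h0 : 0 < h%:R :> R.
  by rewrite ltr0n lt0n; apply/eqP => h0; move: h8; rewrite h0 mul0r; lra.
have m0' : 0 < m%:R :> R by rewrite ltr0n.
have f1 (n : nat) : `|cs (phi n + t)| <= 1 by exact: cs_le1.
pose G (i : 'I_m) : R := \sum_(j < h) cs (phi (a + i + s * j)%N + t).
have hS : `|h%:R * S - \sum_(i < m) G i| <= 2 * s%:R * h%:R ^+ 2.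
  exact: (sum_average a m s h f1).
have off (j k : 'I_h) : (j < k)%N ->
    \sum_(i < m) cs (phi (a + i + s * k)%N - phi (a + i + s * j)%N)
      <= eps ^+ 2 / 8 * m%:R + 2 * (s * h)%:R.
  move=> jk.
  pose f n : R := cs (phi (n + s * (k - j))%N - phi n).
  have f1' n : `|f n| <= 1 by exact: cs_le1.
  have -> : \sum_(i < m) cs (phi (a + i + s * k)%N - phi (a + i + s * j)%N)
     = \sum_(i < m) f (a + i + s * j)%N.
    apply: eq_bigr => i _; rewrite /f; congr (cs (phi _ - _)).
    have : (s * j <= s * k)%N by rewrite leq_mul2l (ltnW jk) orbT.
    by rewrite mulnBr; lia.
  have kj : (0 < k - j < h)%N by have := ltn_ord k; lia.
  have := hd _ kj 0; under eq_bigr do rewrite addr0.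
  have := sum_shift a m (s * j) f1'; rewrite /f.
  move: (\sum_(i < m) _) (\sum_(i < m) _) => x y hxy hx.
  have : (s * j)%:R <= (s * h)%:R :> R by rewrite ler_nat leq_mul// ltnW.
  by move: hxy hx; rewrite !ler_norml; lra.
have hG : \sum_(i < m) G i ^+ 2 <=
    h%:R * m%:R + h%:R ^+ 2 * (eps ^+ 2 / 8 * m%:R + 2 * (s * h)%:R).
  apply: (@le_trans _ _ (\sum_(i < m) \sum_(k < h) \sum_(j < h)
      cs (phi (a + i + s * k)%N - phi (a + i + s * j)%N))).
    by apply: ler_sum => i _; exact: (sqr_cs_sum (fun j : 'I_h => phi (a + i + s * j)%N)).
  rewrite exchange_big/=.
  have -> : h%:R * m%:R + h%:R ^+ 2 * (eps ^+ 2 / 8 * m%:R + 2 * (s * h)%:R) =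
    \sum_(k < h) \sum_(j < h) ((if j == k then m%:R else 0)
        + (eps ^+ 2 / 8 * m%:R + 2 * (s * h)%:R)) :> R.
    under eq_bigr do rewrite big_split/= -big_mkcond/= big_pred1_eq sumr_const card_ord.
    by rewrite sumr_const card_ord -[RHS]mulr_natl -[in RHS]mulr_natl; ring.
  apply: ler_sum => k _; rewrite exchange_big/=; apply: ler_sum => j _.
  have w0 : 0 <= eps ^+ 2 / 8 * m%:R + 2 * (s * h)%:R.
    have := sqr_ge0 eps; have : 0 <= m%:R * eps ^+ 2 by rewrite mulr_ge0// sqr_ge0.
    have : 0 <= (s * h)%:R :> R by []; lra.
  case: (ltngtP j k) => jk.
  - by rewrite -val_eqE/= ltn_eqF// add0r; exact: off.
  - rewrite -val_eqE/= gtn_eqF// add0r.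
    under eq_bigr do rewrite -csN opprB.
    exact: off.
  - have /eqP -> : j == k by rewrite -val_eqE/= jk.
    rewrite eqxx; under eq_bigr do rewrite subrr cs0.
    by rewrite sumr_const card_ord lerDl.
have := sqr_sum_le G.
move: hG hS; move: (\sum_(i < m) G i) (\sum_(i < m) G i ^+ 2) => g g2 hG hS hg.
rewrite leNgt; apply/negP => ltS.
set X := `|S| in ltS.
have hY : h%:R * X - 2 * s%:R * h%:R ^+ 2 <= `|g|.
  have -> : h%:R * X = `|h%:R * S| by rewrite normrM ger0_norm// ltW.
  have := ler_normD (h%:R * S - g) g; rewrite subrK; lra.
have e2 : eps ^+ 2 <= eps by rewrite expr2 ler_piMl// ltW.
have hsh : (s * h)%:R = s%:R * h%:R :> R by rewrite natrM.
rewrite hsh in shm hG.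
have hZ : (15/16) * (eps * m%:R * h%:R) <= `|g|.
  have h1 : s%:R * h%:R ^+ 2 * 32 <= eps * m%:R * h%:R.
    rewrite (_ : s%:R * h%:R ^+ 2 * 32 = (32 * (s%:R * h%:R)) * h%:R); last by ring.
    rewrite ler_pM2r//; apply: le_trans shm _; rewrite ler_pM2r//.
  have h2 : eps * m%:R * h%:R <= h%:R * X by rewrite [leRHS]mulrC ler_pM2r// ltW.
  have h3 : 0 <= s%:R * h%:R ^+ 2 :> R by rewrite mulr_ge0// ?sqr_ge0.
  by move: hY; lra.
(* In units of [(eps * m * h)^2] the diagonal costs 1/8, the off-diagonal terms 1/8 and the boundary
   1/16. The total 5/16 is below [(15/16)^2]. *)
have hW : `|g| ^+ 2 <= (5/16) * (eps * m%:R * h%:R) ^+ 2.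
  rewrite real_normK ?num_real//; apply: (le_trans hg).
  apply: (le_trans (ler_wpM2l (ltW m0') hG)).
  have h1 : 8 * (h%:R * m%:R ^+ 2) <= (eps * m%:R * h%:R) ^+ 2.
    have -> : (eps * m%:R * h%:R) ^+ 2 = (h%:R * eps ^+ 2) * (h%:R * m%:R ^+ 2) by ring.
    by rewrite ler_wpM2r// mulr_ge0// ?sqr_ge0// ltW.
  have h2 : 32 * (s%:R * h%:R) * (m%:R * h%:R ^+ 2) <= (eps * m%:R * h%:R) ^+ 2.
    have -> : (eps * m%:R * h%:R) ^+ 2 = (eps ^+ 2 * m%:R) * (m%:R * h%:R ^+ 2) by ring.
    by rewrite ler_wpM2r// mulr_ge0// ?sqr_ge0// ltW.
  have -> : m%:R * (h%:R * m%:R + h%:R ^+ 2 * (eps ^+ 2 / 8 * m%:R + 2 * (s%:R * h%:R)))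
    = h%:R * m%:R ^+ 2 + (eps * m%:R * h%:R) ^+ 2 / 8 + 2 * (s%:R * h%:R) * (m%:R * h%:R ^+ 2).
    by ring.
  by lra.
have v0 : 0 < eps * m%:R * h%:R by rewrite !mulr_gt0.
nra.
Qed.

Fixpoint diffs (ss : seq nat) phi : nat -> R :=
  if ss is s :: ss' then diffs ss' (fun n => phi (n + s)%N - phi n) else phi.

Lemma eq_diffs ss phi psi : phi =1 psi -> diffs ss phi =1 diffs ss psi.
Proof.
by elim: ss phi psi => //= s ss IH phi psi e; apply: IH => n; rewrite !e.
Qed.

Lemma diffsD ss phi psi n :
  diffs ss (fun i => phi i + psi i) n = diffs ss phi n + diffs ss psi n.
Proof.
elim: ss phi psi n => //= s ss IH phi psi n.
by rewrite -IH; apply: eq_diffs => i; ring.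
Qed.

Lemma diffsZ ss (c : R) phi n : diffs ss (fun i => c * phi i) n = c * diffs ss phi n.
Proof.
elim: ss phi n => //= s ss IH phi n.
by rewrite -IH; apply: eq_diffs => i; rewrite mulrBr.
Qed.

Lemma diffsN ss phi n : diffs ss (fun i => - phi i) n = - diffs ss phi n.
Proof.
by rewrite -mulN1r -diffsZ; apply: eq_diffs => i; rewrite mulN1r.
Qed.

Lemma diffs_shift ss phi d n : diffs ss (fun i => phi (i + d)%N) n = diffs ss phi (n + d)%N.
Proof.
elim: ss phi n => //= s ss IH phi n.
by rewrite -IH; apply: eq_diffs => i; rewrite addnAC.
Qed.

Lemma diffs_sum ss phi s d n :
  diffs ss (fun i => \sum_(j < d) phi (i + s * j)%N) n
    = \sum_(j < d) diffs ss phi (n + s * j)%N.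
Proof.
elim: d n => [|d IH] n.
  rewrite big_ord0 -[RHS](mul0r (diffs ss (fun=> 0) n)) -diffsZ.
  by apply: eq_diffs => i; rewrite big_ord0 mul0r.
rewrite big_ord_recr/= -IH -diffs_shift -diffsD.
by apply: eq_diffs => i; rewrite big_ord_recr.
Qed.

Lemma telescope_step phi s d n :
  phi (n + s * d)%N - phi n = \sum_(j < d) (phi (n + s * j + s)%N - phi (n + s * j)%N).
Proof.
elim: d => [|d IH]; first by rewrite muln0 addn0 subrr big_ord0.
by rewrite big_ord_recr/= -IH mulnS -addnA [(s * d + s)%N]addnC; ring.
Qed.

Lemma nat_ge (x : R) : exists n : nat, x <= n%:R.
Proof.
by exists (Num.bound `|x|); rewrite (le_trans (ler_norm x))// ltW// archi_boundP.
Qed.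

(** Along [r] consecutive steps of length [s] the phase is almost an arithmetic progression whose
    difference stays away from the integers, so the sum over them is almost geometric, of size at
    most [2 / kap1]. Taking [r] large makes this small on average; taking [C] much larger than [r]
    makes the drift of [theta] and the boundary effects negligible. *)
Lemma weyl_base (kap1 eps : R) : 0 < kap1 -> 0 < eps -> exists2 C : nat, (0 < C)%N &
  forall s phi a m theta, (0 < s)%N -> (C * s <= m)%N ->
  (forall n, (a <= n <= a + m + C * s)%N ->
     phi (n + s)%N - phi n - theta n \is a Num.int /\ kap1 <= `|theta n| <= 2^-1) ->
  (forall n n', (a <= n)%N -> (n <= n' <= n + C * s)%N -> (n' <= a + m + C * s)%N ->
     `|theta n' - theta n| <= C%:R^-1) ->
  avg_small phi a m eps.
Proof.
move=> kap10 eps0.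
have [r hr] := nat_ge (8 / (kap1 * eps) + 1).
have [c hc] := nat_ge (32 * r%:R / eps).
have ke0 : 0 < kap1 * eps by rewrite mulr_gt0.
have r0 : 0 < r%:R :> R by apply: lt_le_trans hr; rewrite ltr_wpDl// divr_ge0// ltW.
exists (c + r)%N; first by rewrite addn_gt0; move: r0; rewrite ltr0n orbC => ->.
set C := (c + r)%N => s phi a m theta s0 Csm hth osc t.
have hC : 32 * r%:R <= eps * C%:R.
  have {}hc : 32 * r%:R <= c%:R * eps by rewrite -ler_pdivrMr.
  by rewrite /C natrD mulrDr; nra.
have C0 : 0 < C%:R :> R by rewrite /C natrD ltr_wpDl.
have rC : (r <= C)%N by rewrite leq_addl.
set S := \sum_(i < m) _.
have f1 (n : nat) : `|cs (phi n + t)| <= 1 by exact: cs_le1.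
have := sum_average a m s r f1; rewrite -/S => hS.
have inner (i : 'I_m) : `|\sum_(j < r) cs (phi (a + i + s * j)%N + t)|
    <= 2 / kap1 + 8 * r%:R ^+ 2 / C%:R.
  set n := (a + i)%N.
  have nr : (a <= n <= a + m + C * s)%N by rewrite /n; move: (ltn_ord i); clear; lia.
  have [_ /andP[k1 k2]] := hth n nr.
  have step (j : 'I_r) : `|cs (phi (n + s * j)%N + t) - cs (j%:R * theta n + (phi n + t))|
      <= 8 * (r%:R / C%:R).
    have inrange (k : 'I_j) : (s * k <= C * s)%N.
      rewrite mulnC leq_mul2r; apply/orP; right.
      by apply: ltnW; apply: leq_trans rC; apply: ltn_trans (ltn_ord j).
    set e := \sum_(k < j) (theta (n + s * k)%N - theta n).
    (* The integers by which the increments differ from [theta] telescope into one integer,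
       invisible to [cs]. *)
    have -> : cs (phi (n + s * j)%N + t) = cs (j%:R * theta n + (phi n + t) + e).
      set w := \sum_(k < j) (phi (n + s * k + s)%N - phi (n + s * k)%N - theta (n + s * k)%N).
      have wi : w \is a Num.int.
        apply: rpred_sum => k _; apply: (hth _ _).1.
        by move: (inrange k) (ltn_ord i); rewrite /n; clear; lia.
      rewrite -[RHS](cs_int _ wi); congr cs.
      have := telescope_step phi s j n; rewrite sumrB.
      have -> : e = \sum_(k < j) theta (n + s * k)%N - j%:R * theta n.
        by rewrite /e sumrB sumr_const card_ord mulr_natl.
      by rewrite /w !sumrB; lra.
    apply: (le_trans (cs_lipschitz _ _)); rewrite ler_pM2l//.
    rewrite [X in `|X|](_ : _ = e); last by ring.
    apply: (le_trans (ler_norm_sum _ _ _)).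
    apply: (@le_trans _ _ (\sum_(k < j) C%:R^-1)).
      apply: ler_sum => k _; apply: osc; first by case/andP: nr.
        by rewrite leq_addr leq_add2l inrange.
      by move: (inrange k) (ltn_ord i); rewrite /n; clear; lia.
    rewrite sumr_const card_ord -[_^-1 *+ _]mulr_natl ler_wpM2r ?invr_ge0 ?ler0n//.
    by rewrite ler_nat ltnW.
  have -> : \sum_(j < r) cs (phi (n + s * j)%N + t) =
     \sum_(j < r) cs (j%:R * theta n + (phi n + t)) +
     \sum_(j < r) (cs (phi (n + s * j)%N + t) - cs (j%:R * theta n + (phi n + t))).
    by rewrite -big_split/=; apply: eq_bigr => j _; ring.
  apply: (le_trans (ler_normD _ _)); apply: lerD.
    rewrite ler_pdivlMr//.
    apply: le_trans (geometric_cs_le (phi n + t) r k2).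
    by rewrite ler_wpM2l.
  apply: (le_trans (ler_norm_sum _ _ _)).
  apply: (@le_trans _ _ (\sum_(j < r) 8 * (r%:R / C%:R))); first exact: ler_sum.
  rewrite sumr_const card_ord -[_ *+ r]mulr_natl.
  by rewrite (_ : r%:R * _ = 8 * r%:R ^+ 2 / C%:R)//; ring.
have hsum : `|\sum_(i < m) \sum_(j < r) cs (phi (a + i + s * j)%N + t)|
    <= m%:R * (2 / kap1 + 8 * r%:R ^+ 2 / C%:R).
  apply: (le_trans (ler_norm_sum _ _ _)).
  apply: (@le_trans _ _ (\sum_(i < m) (2 / kap1 + 8 * r%:R ^+ 2 / C%:R))).
    exact: ler_sum.
  by rewrite sumr_const card_ord -[_ *+ m]mulr_natl.
have hrS : r%:R * `|S| <= r%:R * (eps * m%:R).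
  have -> : r%:R * `|S| = `|r%:R * S| by rewrite normrM ger0_norm// ltW.
  have h1 : 2 / kap1 <= r%:R * eps / 4.
    have : 8 / (kap1 * eps) <= r%:R by move: hr; lra.
    by rewrite !ler_pdivrMr// => h; nra.
  have h2 : 8 * r%:R ^+ 2 / C%:R <= r%:R * eps / 4.
    by rewrite ler_pdivrMr//; nra.
  have h3 : s%:R * C%:R <= m%:R :> R by rewrite -natrM ler_nat mulnC.
  have h4 : 2 * s%:R * r%:R ^+ 2 <= r%:R * (eps * m%:R) / 4.
    have : 32 * r%:R * s%:R <= eps * m%:R.
      apply: (@le_trans _ _ (eps * C%:R * s%:R)); first by rewrite ler_wpM2r.
      by rewrite -mulrA ler_pM2l// mulrC.
    by have : 0 <= r%:R * s%:R :> R by []; nra.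
  have m0 : 0 <= m%:R :> R by [].
  have h5 : m%:R * (2 / kap1 + 8 * r%:R ^+ 2 / C%:R) <= m%:R * (r%:R * eps / 2).
    by rewrite ler_wpM2l//; lra.
  have := ler_distD 0 (r%:R * S) 0; rewrite !subr0 => _.
  have tri := ler_normD (r%:R * S - \sum_(i < m) \sum_(j < r) cs (phi (a + i + s * j)%N + t))
    (\sum_(i < m) \sum_(j < r) cs (phi (a + i + s * j)%N + t)).
  rewrite subrK in tri.
  have h6 : 0 <= r%:R * (eps * m%:R) by rewrite !mulr_ge0// ltW.
  lra.
by rewrite ler_pM2l in hrS.
Qed.

(** Induction by van der Corput on the first step [s]. A difference with step [s * d] is a sum of
    [d] shifted differences with step [s], so after the remaining differences [theta] is replaced by
    a sum of [d < h] of its values. As [theta] is positive nothing cancels and the lower bound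
    [kap1] survives, while the upper bound grows at most by the factor [h]. [kap2] depends on [k]
    and [eps] only; [kap1] may then be taken as small as the application dictates. *)
Lemma weyl k eps : 0 < eps <= 1 -> exists2 kap2 : R, 0 < kap2 <= 2^-1 &
  forall kap1, 0 < kap1 <= kap2 -> exists2 C : nat, (0 < C)%N &
  forall ss S phi a m theta, size ss = k.+1 -> all (fun s => 0 < s <= S)%N ss ->
  (C * S <= m)%N ->
  (forall n, (a <= n <= a + m + C * S)%N ->
     diffs ss phi n - theta n \is a Num.int /\ kap1 <= theta n <= kap2) ->
  (forall n n', (a <= n)%N -> (n <= n' <= n + C * S)%N -> (n' <= a + m + C * S)%N ->
     `|theta n' - theta n| <= C%:R^-1) ->
  avg_small phi a m eps.
Proof.
elim: k eps => [|k IH] eps /andP[eps0 eps1].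
  exists 2^-1; first by rewrite invr_gt0 ltr0n lexx.
  move=> kap1 /andP[kap10 kap1h]; have [C C0 hC] := weyl_base kap10 eps0.
  exists C => // -[//|s [|//]] S phi a m theta _ /= /andP[/andP[s0 sS] _] CSm hth osc.
  have CsCS : (C * s <= C * S)%N by rewrite leq_mul2l sS orbT.
  apply: (hC s phi a m theta) => //; first exact: leq_trans CSm.
    move=> n hn; have hn' : (a <= n <= a + m + C * S)%N by move: hn CsCS; clear; lia.
    have [h1 /andP[h2 h3]] := hth n hn'.
    by split => //; rewrite ger0_norm ?h2// (le_trans _ h2)// ltW.
  by move=> n n' h1 h2 h3; apply: osc; move: h1 h2 h3 CsCS; clear; lia.
have e8 : 0 < eps ^+ 2 / 8 <= 1.
  by rewrite divr_gt0 ?exprn_gt0//= ler_pdivrMr// mul1r expr2; nra.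
have [kap2' /andP[kap20' kap2h'] {}IH] := IH _ e8.
have [h hh] := nat_ge (8 / eps ^+ 2).
have eps20 : 0 < eps ^+ 2 by rewrite exprn_gt0.
have h0 : 0 < h%:R :> R by apply: lt_le_trans hh; rewrite divr_gt0.
have h1 : 1 <= h%:R :> R by move: h0; rewrite ltr0n ler1n.
(* Fewer than [h] values of [theta] are added, so their sum stays below [kap2']. *)
exists (kap2' / h%:R).
  rewrite divr_gt0//= ler_pdivrMr//; apply: (le_trans kap2h').
  by rewrite ler_peMr.
move=> kap1 /andP[kap10 kap1h].
have kap1' : 0 < kap1 <= kap2'.
  by rewrite kap10 (le_trans kap1h)// ler_pdivrMr// ler_peMr// ltW.
have [C' C'0 {}IH] := IH _ kap1'.
have [c hc] := nat_ge (32 * h%:R / eps ^+ 2).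
set C := (C' * h + C' + h + c)%N.
have [CC' [Cc Cp]] : (C' + h <= C)%N /\ (c <= C)%N /\ (C' * h <= C)%N.
  by rewrite /C; move: (C' * h)%N; clear; lia.
have C0 : (0 < C)%N by move: CC' C'0; clear; lia.
exists C => //.
move=> [//|s ss] S phi a m theta /= [sss] /andP[/andP[s0 sS] hss] CSm hth osc.
have C'CS : ((C' + h) * S <= C * S)%N by rewrite leq_mul2r CC' orbT.
have C'C : (C' <= C)%N by move: CC'; clear; lia.
have jS d (j : 'I_d) : (d < h)%N -> (s * j <= h * S)%N.
  by move=> dh; rewrite mulnC leq_mul// ltnW// (ltn_trans _ dh).
apply: (@van_der_corput phi a m s h eps); first by rewrite eps0.
- by move: hh; rewrite ler_pdivrMr.
- rewrite natrM.
  have mC : c%:R * s%:R <= m%:R :> R.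
    by rewrite -natrM ler_nat; apply: leq_trans CSm; rewrite leq_mul.
  have : 32 * h%:R <= c%:R * eps ^+ 2 by move: hc; rewrite ler_pdivrMr.
  have : 0 <= s%:R :> R by [].
  by nra.
move=> d /andP[d0 dh].
apply: (IH ss S _ a m (fun n => \sum_(j < d) theta (n + s * j)%N)) => //.
- by apply: leq_trans CSm; rewrite leq_mul2r C'C orbT.
- move=> n hn.
  have inr (j : 'I_d) : (a <= n + s * j <= a + m + C * S)%N.
    by move: (jS _ j dh) C'CS hn; rewrite mulnDl; clear; lia.
  split.
    rewrite (eq_diffs _ (fun i => telescope_step phi s d i)).
    rewrite (diffs_sum ss (fun i => phi (i + s)%N - phi i)) -sumrB.
    by apply: rpred_sum => j _; apply: (hth _ (inr j)).1.
  apply/andP; split.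
    case: d d0 dh inr => // d _ dh inr; rewrite big_ord_recl.
    have /andP[+ _] := (hth _ (inr ord0)).2; move=> /le_trans; apply.
    rewrite lerDl; apply: sumr_ge0 => j _.
    by have /andP[+ _] := (hth _ (inr (lift ord0 j))).2; apply: le_trans; exact: ltW.
  apply: (@le_trans _ _ (\sum_(j < d) (kap2' / h%:R))).
    by apply: ler_sum => j _; have /andP[] := (hth _ (inr j)).2.
  rewrite sumr_const card_ord -[_ *+ d]mulr_natr mulrAC ler_pdivrMr//.
  by rewrite ler_pM2l// ler_nat ltnW.
- move=> n n' an nn' n'm; rewrite -sumrB.
  apply: (le_trans (ler_norm_sum _ _ _)).
  apply: (@le_trans _ _ (\sum_(j < d) C%:R^-1)).
    apply: ler_sum => j _; have := jS _ j dh => js.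
    by apply: osc; move: js C'CS an nn' n'm; rewrite mulnDl; clear; lia.
  rewrite sumr_const card_ord -[_ *+ d]mulr_natl ler_pdivrMr ?ltr0n//.
  rewrite mulrC ler_pdivlMr ?ltr0n// -natrM ler_nat.
  by apply: leq_trans Cp; rewrite mulnC leq_mul2l ltnW ?orbT.
Qed.

End Weyl.

(** * Counting sums of two elements of a dense set *)

Section Counting.
Variable R : realType.
Implicit Types (theta t eps c : R) (K N P : nat).

(** A shift by less than [K] is harmless at every frequency: if [8 * K * |theta| <= eps] the
    Lipschitz bound makes it negligible, and otherwise the shifted and the unshifted sums are both
    small. Frequencies above 1/2 are moved to [theta - 1], which changes no value at an integer. *)
Lemma cs_average_diff (I : finType) (b : I -> nat) K eps theta t :
  (forall theta t, `|theta| <= 2^-1 -> eps < 8 * K%:R * `|theta| ->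
     `|\sum_(i : I) cs (theta * (b i)%:R + t)| <= eps * #|I|%:R) ->
  0 <= eps -> 0 <= theta <= 1 ->
  `|\sum_(i : I) \sum_(j < K)
     (cs (theta * (b i)%:R + t) - cs (theta * (b i + j)%:R + t))|
  <= 2 * eps * (#|I|%:R * K%:R).
Proof.
move=> hU eps0 /andP[th0 th1].
wlog th2 : theta t {th0 th1} / `|theta| <= 2^-1.
  move=> H; case: (leP theta 2^-1) => [le|lt].
    by apply: H; rewrite ger0_norm.
  have := H (theta - 1) t; rewrite ler0_norm; last by lra.
  have -> : - (theta - 1) <= 2^-1 by lra.
  move=> /(_ isT); congr (`| _ | <= _).
  apply: eq_bigr => i _; apply: eq_bigr => j _.
  have e n : cs ((theta - 1) * n%:R + t) = cs (theta * n%:R + t).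
    by rewrite -[LHS](csDn _ n); congr cs; ring.
  by rewrite !e.
case: (leP (8 * K%:R * `|theta|) eps) => hth.
  apply: (le_trans (ler_norm_sum _ _ _)).
  apply: (@le_trans _ _ (\sum_(i : I) \sum_(j < K) eps)).
    apply: ler_sum => i _; apply: (le_trans (ler_norm_sum _ _ _)).
    apply: ler_sum => j _; apply: (le_trans (cs_lipschitz _ _)).
    have -> : theta * (b i)%:R + t - (theta * (b i + j)%:R + t) = - (theta * j%:R).
      by rewrite natrD; ring.
    rewrite normrN normrM [`|j%:R|]ger0_norm//.
    apply: le_trans hth; rewrite -mulrA ler_pM2l// mulrC ler_wpM2r//.
    by rewrite ler_nat ltnW.
  under eq_bigr do rewrite sumr_const card_ord.
  rewrite sumr_const -mulrnA -[_ *+ _]mulr_natr natrM [K%:R * _]mulrC.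
  by rewrite ler_wpM2r// ler_peMl//; lra.
rewrite exchange_big/=; apply: (le_trans (ler_norm_sum _ _ _)).
apply: (@le_trans _ _ (\sum_(j < K) 2 * eps * #|I|%:R)).
  apply: ler_sum => j _; rewrite sumrB; apply: (le_trans (ler_normB _ _)).
  have h1 := hU theta t th2 hth.
  have h2 := hU theta (theta * j%:R + t) th2 hth.
  have e : \sum_(i : I) cs (theta * (b i + j)%:R + t)
      = \sum_(i : I) cs (theta * (b i)%:R + (theta * j%:R + t)).
    by apply: eq_bigr => i _; congr cs; rewrite natrD; ring.
  by rewrite e; lra.
by rewrite sumr_const card_ord -[_ *+ _]mulr_natr mulrA.
Qed.

(* The Fourier transforms of a set and of a weight are multiplied; by Parseval, smoothing the
   weight over [K] consecutive shifts changes the count by little if its transform is small. *)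
Lemma count_sums (I : finType) N (A : {set 'I_N}) (b : I -> nat) K eps c :
  (0 < K)%N -> 0 <= eps ->
  (forall theta t, `|theta| <= 2^-1 -> eps < 8 * K%:R * `|theta| ->
     `|\sum_(i : I) cs (theta * (b i)%:R + t)| <= eps * #|I|%:R) ->
  (forall x y, x \in A -> y \in A ->
     c * (#|I|%:R * K%:R) <= \sum_(i : I) \sum_(j < K) (b i + j == x + y)%N%:R) ->
  #|I|%:R * (c * #|A|%:R ^+ 2 - 4 * eps * #|A|%:R) <=
  \sum_(x in A) \sum_(y in A) \sum_(i : I) (x + y == b i)%N%:R.
Proof.
move=> K0 eps0 hU hreg.
(* The modulus exceeds all integers that are compared, so congruence modulo [P] is equality. *)
pose P := ((\max_(i : I) b i) + K + N + N).+1.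
have bP i : (b i <= \max_(i : I) b i)%N by rewrite leq_bigmax.
have P0 : (0 < P)%N by [].
have P0' : 0 < P%:R :> R by rewrite ltr0n.
pose th (k : nat) : R := k%:R / P%:R.
pose sn (x : R) := sin (x * (pi *+ 2)).
(* A sine is a cosine with another phase, so the hypothesis for all phases covers the imaginary
   parts too. *)
have snE x : sn x = cs (x - 4^-1).
  rewrite /sn /cs mulrBl (_ : 4^-1 * (pi *+ 2) = pi / 2) ?cosBpihalf//.
  by rewrite -[_ *+ 2]mulr_natl; field.
have dir (u v : nat) : (u < P)%N -> (v < P)%N ->
    \sum_(k < P) cs (th k * (u%:R - v%:R)) = P%:R * (u == v)%:R.
  move=> uP vP.
  have := @orthogonality_cs R P (u%:Z - v%:Z) P0.
  have -> : (`|(u%:Z - v%:Z)%R| < P)%N by move: uP vP; clear; lia.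
  move=> /(_ isT); rewrite subr_eq0 eqz_nat.
  have -> : (if u == v then P%:R else 0) = P%:R * (u == v)%:R :> R.
    by case: eqP; rewrite ?mulr1 ?mulr0.
  move=> <-; apply: eq_bigr => k _; congr cs.
  by rewrite /th intrB mulrAC -mulrA.
pose CC k : R := \sum_(x in A) cs (th k * x%:R).
pose SS k : R := \sum_(x in A) sn (th k * x%:R).
pose U k := \sum_(i : I) \sum_(j < K) (cs (th k * (b i)%:R) - cs (th k * (b i + j)%:R)).
pose V k := \sum_(i : I) \sum_(j < K) (sn (th k * (b i)%:R) - sn (th k * (b i + j)%:R)).
have th01 k : (k < P)%N -> 0 <= th k <= 1.
  move=> kP; rewrite /th divr_ge0//= ler_pdivrMr// mul1r ler_nat; exact: ltnW.
have hUk k : (k < P)%N -> `|U k| <= 2 * eps * (#|I|%:R * K%:R).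
  move=> kP; have := cs_average_diff 0 hU eps0 (th01 k kP).
  congr (`| _ | <= _); apply: eq_bigr => i _; apply: eq_bigr => j _.
  by rewrite !addr0.
have hVk k : (k < P)%N -> `|V k| <= 2 * eps * (#|I|%:R * K%:R).
  move=> kP; have := cs_average_diff (- 4^-1) hU eps0 (th01 k kP).
  congr (`| _ | <= _); apply: eq_bigr => i _; apply: eq_bigr => j _.
  by rewrite !snE.
have parseval : \sum_(k < P) (CC k ^+ 2 + SS k ^+ 2) = P%:R * #|A|%:R.
  have -> : \sum_(k < P) (CC k ^+ 2 + SS k ^+ 2) =
      \sum_(k < P) \sum_(x in A) \sum_(y in A) cs (th k * (x%:R - y%:R)).
    apply: eq_bigr => k _; rewrite !expr2 !mulr_suml -big_split/=.
    apply: eq_bigr => x _; rewrite !mulr_sumr -big_split/=; apply: eq_bigr => y _.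
    by rewrite /cs /sn -cosB; congr cos; ring.
  rewrite exchange_big/=.
  have -> : P%:R * #|A|%:R = \sum_(x in A) P%:R :> R by rewrite sumr_const mulr_natr.
  have NP (x : 'I_N) : (x < P)%N by rewrite /P; move: (ltn_ord x); clear; lia.
  apply: eq_bigr => x xA; rewrite exchange_big/= (bigD1 x)//= [X in _ + X]big1 ?addr0.
    by rewrite dir// eqxx mulr1.
  by move=> y /andP[yA yx]; rewrite dir// eq_sym val_eqE (negbTE yx) mulr0.
have key : P%:R * \sum_(x in A) \sum_(y in A) \sum_(i : I) \sum_(j < K)
      ((x + y == b i)%N%:R - (x + y == b i + j)%N%:R)
    = \sum_(k < P) ((CC k ^+ 2 - SS k ^+ 2) * U k + 2 * (CC k * SS k) * V k).
  have -> : \sum_(k < P) ((CC k ^+ 2 - SS k ^+ 2) * U k + 2 * (CC k * SS k) * V k)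
    = \sum_(k < P) \sum_(x in A) \sum_(y in A) \sum_(i : I) \sum_(j < K)
       (cs (th k * ((x + y)%:R - (b i)%:R)) - cs (th k * ((x + y)%:R - (b i + j)%:R))).
    apply: eq_bigr => k _.
    have -> : (CC k ^+ 2 - SS k ^+ 2) * U k + 2 * (CC k * SS k) * V k =
       \sum_(x in A) \sum_(y in A)
       ((cs (th k * x%:R) * cs (th k * y%:R) - sn (th k * x%:R) * sn (th k * y%:R)) * U k
       + (sn (th k * x%:R) * cs (th k * y%:R) + cs (th k * x%:R) * sn (th k * y%:R)) * V k).
      have -> : CC k ^+ 2 - SS k ^+ 2 = \sum_(x in A) \sum_(y in A)
        (cs (th k * x%:R) * cs (th k * y%:R) - sn (th k * x%:R) * sn (th k * y%:R)).
        rewrite !expr2 /CC /SS !mulr_suml -sumrB; apply: eq_bigr => x _.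
        by rewrite !mulr_sumr -sumrB.
      have -> : 2 * (CC k * SS k) = \sum_(x in A) \sum_(y in A)
        (sn (th k * x%:R) * cs (th k * y%:R) + cs (th k * x%:R) * sn (th k * y%:R)).
        rewrite mulr_natl mulr2n {1}[CC k * _]mulrC /CC /SS !mulr_suml -big_split/=.
        by apply: eq_bigr => x _; rewrite !mulr_sumr -big_split.
      rewrite !mulr_suml -big_split/=; apply: eq_bigr => x _.
      by rewrite !mulr_suml -big_split.
    apply: eq_bigr => x _; apply: eq_bigr => y _.
    rewrite /U /V !mulr_sumr -big_split/=; apply: eq_bigr => i _.
    rewrite !mulr_sumr -big_split/=; apply: eq_bigr => j _.
    have e n : cs (th k * ((x + y)%:R - n%:R)) =
      (cs (th k * x%:R) * cs (th k * y%:R) - sn (th k * x%:R) * sn (th k * y%:R))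
        * cs (th k * n%:R) +
      (sn (th k * x%:R) * cs (th k * y%:R) + cs (th k * x%:R) * sn (th k * y%:R))
        * sn (th k * n%:R).
      by rewrite /cs /sn -cosD -sinD -cosB; congr cos; rewrite natrD; ring.
    by rewrite !e; ring.
  rewrite [RHS]exchange_big/= mulr_sumr; apply: eq_bigr => x _.
  rewrite [RHS]exchange_big/= mulr_sumr; apply: eq_bigr => y _.
  rewrite [RHS]exchange_big/= mulr_sumr; apply: eq_bigr => i _.
  rewrite [RHS]exchange_big/= mulr_sumr; apply: eq_bigr => j _.
  rewrite sumrB mulrBr.
  have xyP : (x + y < P)%N.
    by rewrite /P; move: (ltn_ord x) (ltn_ord y); clear; lia.
  have bjP : (b i + j < P)%N.
    by rewrite /P; move: (ltn_ord j) (bP i); clear; lia.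
  by rewrite !dir// (leq_ltn_trans _ bjP)// leq_addr.
have lower : - (4 * eps * (#|I|%:R * K%:R) * (P%:R * #|A|%:R)) <=
   P%:R * \sum_(x in A) \sum_(y in A) \sum_(i : I) \sum_(j < K)
      ((x + y == b i)%N%:R - (x + y == b i + j)%N%:R).
  rewrite key -parseval mulr_sumr -sumrN; apply: ler_sum => k _.
  have := hUk k (ltn_ord k); have := hVk k (ltn_ord k).
  set E := 2 * eps * _; rewrite !ler_norml => /andP[v1 v2] /andP[u1 u2].
  have -> : 4 * eps * (#|I|%:R * K%:R) = 2 * E by rewrite /E; ring.
  move: (CC k) (SS k) (U k) (V k) u1 u2 v1 v2 => x y u v u1 u2 v1 v2.
  have E0 : 0 <= E by lra.
  (* These four inequalities add up to [(x^2 - y^2) u + 2 x y v >= - 2 E (x^2 + y^2)], so that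
     Parseval can be applied to the sum of [x^2 + y^2] over all frequencies. *)
  have h1 : 0 <= x ^+ 2 * (E + u) by rewrite mulr_ge0 ?sqr_ge0//; lra.
  have h2 : 0 <= y ^+ 2 * (E - u) by rewrite mulr_ge0 ?sqr_ge0//; lra.
  have h3 : 0 <= (x + y) ^+ 2 * (E + v) by rewrite mulr_ge0 ?sqr_ge0//; lra.
  have h4 : 0 <= (x - y) ^+ 2 * (E - v) by rewrite mulr_ge0 ?sqr_ge0//; lra.
  lra.
have split_sum : \sum_(x in A) \sum_(y in A) \sum_(i : I) \sum_(j < K)
      ((x + y == b i)%N%:R - (x + y == b i + j)%N%:R) =
   K%:R * (\sum_(x in A) \sum_(y in A) \sum_(i : I) (x + y == b i)%N%:R)
   - \sum_(x in A) \sum_(y in A) \sum_(i : I) \sum_(j < K) (b i + j == x + y)%N%:R :> R.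
  rewrite mulr_sumr -sumrB; apply: eq_bigr => x _.
  rewrite mulr_sumr -sumrB; apply: eq_bigr => y _.
  rewrite mulr_sumr -sumrB; apply: eq_bigr => i _.
  rewrite sumrB sumr_const card_ord mulr_natl; congr (_ - _).
  by apply: eq_bigr => j _; rewrite eq_sym.
have regA : c * (#|I|%:R * K%:R) * #|A|%:R ^+ 2 <=
   \sum_(x in A) \sum_(y in A) \sum_(i : I) \sum_(j < K) (b i + j == x + y)%N%:R.
  have -> : c * (#|I|%:R * K%:R) * #|A|%:R ^+ 2 =
      \sum_(x in A) \sum_(y in A) c * (#|I|%:R * K%:R) :> R.
    by rewrite !sumr_const -mulrnA -[RHS]mulr_natr natrM expr2.
  by apply: ler_sum => x xA; apply: ler_sum => y yA; exact: hreg.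
move: lower; rewrite split_sum.
have -> : - (4 * eps * (#|I|%:R * K%:R) * (P%:R * #|A|%:R))
   = P%:R * - (4 * eps * (#|I|%:R * K%:R) * #|A|%:R) by ring.
rewrite ler_pM2l// => lower.
have K0' : 0 < K%:R :> R by rewrite ltr0n.
rewrite -(ler_pM2l K0'); move: regA lower.
move: (\sum_(x in A) \sum_(y in A) \sum_(i : I) \sum_(j < K) _) => w.
by lra.
Qed.

End Counting.

(** * Sums of two elements of a dense set meeting a slowly increasing sequence *)

Section DenseSums.
Variable R : realType.
Implicit Types (f : nat -> R) (u v rho : R).

Lemma count_itv f m u v rho : 0 <= rho -> f 0%N <= u -> v <= f m ->
  (forall n, (n < m)%N -> 0 <= f n.+1 - f n <= rho) ->
  v - u - rho <= rho * \sum_(n < m) (u <= f n < v)%R%:R.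
Proof.
move=> rho0 fu fv step.
have s0 : 0 <= rho * \sum_(n < m) (u <= f n < v)%R%:R.
  by rewrite mulr_ge0// sumr_ge0.
case: (leP v (u + rho)) => uv; first by apply: le_trans s0; lra.
(* Telescoping the clamp of [f] to [u + rho, v]. *)
pose g n := Num.min (Num.max (f n) (u + rho)) v.
have gm : g m = v.
  by rewrite /g min_r// le_max fv.
have g0 : g 0%N = u + rho.
  by rewrite /g max_r ?min_l//; lra.
have -> : v - u - rho = \sum_(n < m) (g n.+1 - g n).
  by rewrite -(big_mkord xpredT (fun n => g n.+1 - g n)) telescope_sumr// gm g0; ring.
rewrite mulr_sumr; apply: ler_sum => n _.
have /andP[st0 st1] := step _ (ltn_ord n).
(* If [f n < u] then [f n.+1 < u + rho], so the clamp has not moved yet; clamping at [u + rho]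
   instead of [u] is what makes such terms vanish. *)
rewrite /g; case: (ltP (f n) u) => h1 /=.
  by rewrite mulr0 !max_r ?subrr//; lra.
case: (ltP (f n) v) => h2; rewrite ?mulr1 ?mulr0; last first.
  by rewrite !min_r ?subrr// le_max ?h2//; apply/orP; left; lra.
apply: le_trans st1; rewrite lerBlDr /Num.min /Num.max.
by case: (ltP (f n) (u + rho)); case: (ltP (f n.+1) (u + rho)) => ? ?; do 2?case: ltP => ?; lra.
Qed.

(** With smoothing length [K] about [kap * T], every sum [x + y] lies in the middle of the range of
    [B], where it is met by about [m * J * K / (2 C1 T)] smoothed targets. The resulting main term
    is quadratic in the size of [A], the Fourier error only linear, and the size of [A] is of order
    [T]; hence more than [D] representations per target, of which at most [D] come from a common
    block. [J] consecutive integers serve as targets at each [n], and [blk] expresses which pairs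
    are to be avoided. *)
Lemma dense_sums (C1 delta : R) : 1 <= C1 -> 0 < delta <= 1 ->
  forall (J : nat) (C3 D : R), (0 < J)%N -> 0 < C3 -> 0 <= D -> exists2 T0 : R, 0 < T0 &
  forall (B : nat -> nat) (a m N : nat) (A : {set 'I_N}) (blk : nat -> nat) (T : R),
  T = (B (a + m)%N)%:R - (B a)%:R -> T0 <= T -> T0 <= m%:R ->
  (forall n, (a <= n < a + m)%N ->
     (0 : R) <= (B n.+1)%:R - (B n)%:R <= C1 * T / m%:R) ->
  (forall x, x \in A ->
     (B a)%:R + T / 4 <= 2 * x%:R <= (B a)%:R + 3 * T / 4) ->
  delta * T / 16 <= #|A|%:R ->
  (forall w : nat, \sum_(x in A) \sum_(y in A) ((x + y == w)%N && (blk x == blk y))%:R <= D) ->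
  (forall theta t, `|theta| <= 2^-1 -> C3 / T <= `|theta| ->
     `|\sum_(n < m) \sum_(j < J) cs (theta * (B (a + n) + j)%:R + t)|
        <= delta / (16 * (16 * C1)) * (m * J)%:R) ->
  exists x y n j, [/\ x \in A /\ y \in A, blk x <> blk y, (a <= n < a + m)%N, (j < J)%N
    & (x + y = B n + j)%N].
Proof.
move=> C11 /andP[d0 d1] J C3 D J0 C30 D0.
have C10 : 0 < C1 by lra.
set eps := delta / (16 * (16 * C1)).
have C256 : 0 < 16 * (16 * C1) by lra.
have eps0 : 0 < eps by exact: divr_gt0.
have eps1 : eps <= 1 by rewrite ler_pdivrMr; lra.
(* [8 * kap * C3 <= eps]: each frequency at which smoothing over [kap * T] shifts is not negligible
   is then at least [C3 / T]. *)
pose kap := eps / (8 * (C3 + 1)).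
have kap0 : 0 < kap by rewrite divr_gt0//; lra.
have kap8 : 8 * kap <= 1.
  rewrite /kap mulrA ler_pdivrMr; last by lra.
  by lra.
have kapC3 : 8 * kap * C3 <= eps.
  have -> : 8 * kap * C3 = eps * (C3 / (C3 + 1)) by rewrite /kap; field; lra.
  by rewrite ler_piMr ?(ltW eps0)// ler_pdivrMr; lra.
have J1 : 1 <= J%:R :> R by rewrite ler1n.
have q1 : 0 < 16 * (C1 + J%:R) by lra.
have q2 : 0 < 32 * (32 * (C1 * (D + 1))).
  have q3 : 0 < C1 * (D + 1) by apply: mulr_gt0; lra.
  by lra.
have d2 : 0 < delta ^+ 2 by rewrite exprn_gt0.
have w1 : 0 < 16 * (C1 + J%:R) / kap by exact: divr_gt0.
have w2 : 0 < 32 * (32 * (C1 * (D + 1))) / delta ^+ 2 by exact: divr_gt0.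
exists (16 * (C1 + J%:R) / kap + 32 * (32 * (C1 * (D + 1))) / delta ^+ 2).
  by rewrite addr_gt0.
move=> B a m N A blk T TE hT hm step hA Abig hblk hsmall.
have kT : 16 * (C1 + J%:R) <= T * kap.
  by rewrite -ler_pdivrMr//; move: hT w2; clear; lra.
have km : 16 * (C1 + J%:R) <= m%:R * kap.
  by rewrite -ler_pdivrMr//; move: hm w2; clear; lra.
have dT : 32 * (32 * (C1 * (D + 1))) <= T * delta ^+ 2.
  by rewrite -ler_pdivrMr//; move: hT w1; clear; lra.
have T0 : 0 < T by move: hT w1 w2; clear; lra.
have m0 : 0 < m%:R :> R by move: hm w1 w2; clear; lra.
have m0' : (0 < m)%N by rewrite -(ltr0n R).
pose K := Num.truncn (kap * T).
have /andP[K1 K2] : K%:R <= kap * T < K.+1%:R.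
  by apply: truncn_itv; rewrite mulr_ge0// ltW.
have K2' : kap * T < K%:R + 1 by rewrite natr1.
have K0 : (0 < K)%N by rewrite -(ltr0n R); move: kT C11 J1 K2'; clear; lra.
have K0' : 0 < K%:R :> R by rewrite ltr0n.
have K1' : 1 <= K%:R :> R by rewrite ler1n.
have KT : 8 * K%:R <= T by move: K1 kap8 T0; clear; nra.
pose b (i : 'I_m * 'I_J) := (B (a + i.1) + i.2)%N.
have cardI : #|{: 'I_m * 'I_J}| = (m * J)%N by rewrite card_prod !card_ord.
have A0 : 0 < #|A|%:R :> R by apply: lt_le_trans Abig; rewrite divr_gt0// mulr_gt0.
have main := @count_sums R _ N A b K eps (2 * C1 * T)^-1 K0 (ltW eps0).
have {main} main : (m * J)%:R * ((2 * C1 * T)^-1 * #|A|%:R ^+ 2 - 4 * eps * #|A|%:R) <=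
    \sum_(x in A) \sum_(y in A) \sum_(i : 'I_m * 'I_J) (x + y == b i)%N%:R.
  rewrite -cardI; apply: main.
    move=> theta t th2 thK; rewrite cardI.
    have -> : \sum_(i : 'I_m * 'I_J) cs (theta * (b i)%:R + t)
       = \sum_(n < m) \sum_(j < J) cs (theta * (B (a + n) + j)%:R + t).
      by rewrite pair_big.
    apply: hsmall => //; rewrite ler_pdivrMr// leNgt; apply/negP => ltC.
    have : eps < 8 * kap * C3.
      apply: (lt_trans thK); apply: (@le_lt_trans _ _ (8 * kap * (`|theta| * T))).
        have -> : 8 * kap * (`|theta| * T) = 8 * (kap * T) * `|theta| by ring.
        by rewrite ler_wpM2r// ler_pM2l.
      by rewrite ltr_pM2l//; move: kap0; clear; lra.
    by rewrite ltNge kapC3.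
  move=> x y xA yA; rewrite cardI.
  have /andP[x1 x2] := hA _ xA; have /andP[y1 y2] := hA _ yA.
  set w := (x + y)%N.
  have w_lo : (B a)%:R + T / 4 <= w%:R :> R by rewrite natrD; move: x1 y1; clear; lra.
  have w_hi : w%:R <= (B a)%:R + 3 * T / 4 :> R by rewrite natrD; move: x2 y2; clear; lra.
  clearbody w.
  (* For [B (a + n)] in this interval every [j < J] admits exactly one shift [k < K] with
     [B (a + n) + j + k = w]; the ends are adjusted for these two ranges. *)
  have := @count_itv (fun n => (B (a + n)%N)%:R) m (w%:R - K%:R + 1) (w%:R + 2 - J%:R)
     (C1 * T / m%:R).
  rewrite addn0 => /(_ _ _ _ _).
  have rho0 : 0 <= C1 * T / m%:R by rewrite divr_ge0 ?mulr_ge0// ltW.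
  have s1 : (B a)%:R <= w%:R - K%:R + 1 :> R.
    by move: w_lo KT K0'; clear; lra.
  have s2 : w%:R + 2 - J%:R <= (B (a + m)%N)%:R :> R.
    have -> : (B (a + m)%N)%:R = (B a)%:R + T by rewrite TE addrC subrK.
    by move: w_hi J1 K1' KT; clear; lra.
  have s3 n : (n < m)%N -> (0 : R) <= (B (a + n.+1)%N)%:R - (B (a + n)%N)%:R <= C1 * T / m%:R.
    by move=> nm; rewrite addnS; apply: step; rewrite leq_addr ltn_add2l.
  move=> /(_ rho0 s1 s2 s3).
  set Z := \sum_(n < m) _ => hZ.
  have hZ2 : Z * J%:R <= \sum_(i : 'I_m * 'I_J) \sum_(j < K) (b i + j == w)%N%:R.
    rewrite -(pair_big predT predT (fun n j => \sum_(k < K) (b (n, j) + k == w)%N%:R))/=.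
    rewrite mulr_suml; apply: ler_sum => n _.
    case hn: ((_ <= _) && (_ < _)); rewrite ?mul0r ?mul1r; last first.
      by apply: sumr_ge0 => ? _; apply: sumr_ge0.
    have -> : J%:R = \sum_(j < J) 1 :> R by rewrite sumr_const card_ord.
    apply: ler_sum => j _.
    have [n1 n2] : (w + 1 <= B (a + n) + K)%N /\ (B (a + n) + J < w + 2)%N.
      move/andP: hn => [n1 n2]; rewrite -(ler_nat R) -(ltr_nat R) !natrD.
      by move: n1 n2; clear; split; lra.
    have [jK jw] : (w - b (n, j) < K)%N /\ (b (n, j) + (w - b (n, j)) = w)%N.
      by rewrite /b/=; move: n1 n2 (ltn_ord j); clear; lia.
    by rewrite (bigD1 (Ordinal jK))//= jw eqxx lerDl sumr_ge0.
  apply: le_trans hZ2.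
  clear hblk hsmall hA x1 x2 y1 y2 step Abig s1 s2 s3 w_lo w_hi.
  have hZ' : (K%:R + 1 - J%:R) * m%:R - C1 * T <= C1 * T * Z.
    have := hZ; rewrite (_ : _ - _ - _ = ((K%:R + 1 - J%:R) * m%:R - C1 * T) / m%:R); last by field; lra.
    rewrite (_ : _ * Z = C1 * T * Z / m%:R); last by ring.
    by rewrite ler_pM2r// invr_gt0.
  rewrite natrM mulrC ler_pdivrMr; last by rewrite !mulr_gt0.
  have hKm : C1 * T <= (K%:R / 2 + 1 - J%:R) * m%:R.
    have h1 : kap * T / 4 <= K%:R / 2 + 1 - J%:R.
      by move: kT K2' C10 J1; clear; lra.
    have h2 : 16 * (C1 + J%:R) * T <= m%:R * kap * T by rewrite ler_pM2r.
    have h3 := mulr_gt0 C10 T0; have h4 : 0 <= J%:R * T by rewrite mulr_ge0// ltW.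
    by have := ler_wpM2r (ltW m0) h1; move: h2 h3 h4; clear; lra.
  have hmK : m%:R * K%:R / 2 <= C1 * T * Z by move: hZ' hKm; clear; lra.
  have := ler_wpM2l (ler0n R J) hmK; clear; lra.
pose cnt := \sum_(x in A) \sum_(y in A) \sum_(i : 'I_m * 'I_J) (x + y == b i)%N%:R : R.
have hcnt : D * (m * J)%:R < cnt.
  apply: lt_le_trans main.
  rewrite mulrC ltr_pM2l ?ltr0n ?muln_gt0 ?m0'//.
  (* The lower bound on the size of [A] makes the main term at least twice the Fourier error; the
     surplus, of order [T], exceeds [D] because of the second summand in the threshold. *)
  have e1 : delta / (8 * (4 * C1)) <= (2 * C1 * T)^-1 * #|A|%:R.
    rewrite [leRHS]mulrC ler_pdivlMr ?mulr_gt0//.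
    by rewrite [leLHS](_ : _ = delta * T / 16)//; field; rewrite !gt_eqF.
  have e2 : D < delta / (8 * (8 * C1)) * #|A|%:R.
    apply: (@lt_le_trans _ _ (delta / (8 * (8 * C1)) * (delta * T / 16))); last first.
      by rewrite ler_pM2l//; apply: divr_gt0 => //; move: C10; clear; lra.
    rewrite [ltRHS](_ : _ = T * delta ^+ 2 / (32 * (32 * C1))); last by field; rewrite gt_eqF.
    rewrite ltr_pdivlMr; last by move: C10; clear; lra.
    by apply: lt_le_trans dT; have := mulr_ge0 (ltW C10) D0; move: C10; clear; nra.
  have e3 : 4 * eps = delta / (8 * (8 * C1)) by rewrite /eps; field; rewrite gt_eqF.
  rewrite e3 expr2 mulrA -mulrBl; apply: (lt_le_trans e2); rewrite ler_pM2r//.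
  have e4 : delta / (8 * (4 * C1)) = 2 * (delta / (8 * (8 * C1))).
    by field; rewrite gt_eqF.
  by move: e1; rewrite e4; clear; lra.
(* Without a solution in distinct blocks all representations of a target lie in a common block, at
   most [D] for each pair [(n, j)]. *)
apply: contrapT => noex; move: hcnt; apply/negP; rewrite -leNgt.
rewrite /cnt; under eq_bigr do rewrite exchange_big/=.
rewrite exchange_big/= mulrC.
apply: (@le_trans _ _ (\sum_(i : 'I_m * 'I_J) D)); last first.
  by rewrite sumr_const cardI mulr_natl.
apply: ler_sum => i _; apply: le_trans (hblk (b i)).
apply: ler_sum => x xA; apply: ler_sum => y yA.
rewrite ler_nat; case: eqP => //= xyb.
rewrite (_ : blk x == blk y)//; apply/eqP; apply: contrapT => nblk.
by apply: noex; exists x, y, (a + i.1)%N, i.2; split; rewrite // leq_addr ltn_add2l ltn_ord.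
Qed.

End DenseSums.

(** * Discretization: from equidistribution to monochromatic sums *)

Section Grid.
Variable R : realType.

Lemma pigeonhole_card (T : finType) (X : {set T}) k (c : T -> 'I_k) : (0 < k)%N ->
  exists i : 'I_k, (#|X| <= k * #|[set x in X | c x == i]%SET|)%N.
Proof.
move=> k0; apply: contrapT => h.
have lt i : (k * #|[set x in X | c x == i]%SET| < #|X|)%N.
  by rewrite ltnNge; apply/negP => le; apply: h; exists i.
have e : #|X| = (\sum_(i < k) #|[set x in X | c x == i]%SET|)%N.
  rewrite -sum1_card (partition_big c predT)//=; apply: eq_bigr => i _.
  by rewrite -sum1_card; apply: eq_bigl => x; rewrite inE.
have : (k * #|X| < k * #|X|)%N; last by rewrite ltnn.
rewrite {1}e big_distrr/= -[X in (_ < X * _)%N]card_ord -sum_nat_const.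
apply: (@leq_trans (\sum_(i < k) (k * #|[set x in X | c x == i]%SET|).+1)%N).
  by rewrite -[X in (X < _)%N]addn0 -(ltn_add2l 0) !add0n; under [X in (_ < X)%N]eq_bigr do rewrite -addn1;
     rewrite big_split/= sum_nat_const card_ord muln1 ltn_add2l.
by apply: leq_sum => i _; exact: lt.
Qed.

Lemma card_block N d q : (0 < d)%N -> (#|[set x : 'I_N | x %/ d == q]%SET| <= d)%N.
Proof.
move=> d0; pose f (x : 'I_N) : 'I_d := Ordinal (ltn_pmod x d0).
rewrite -[leqRHS]card_ord; apply: (@leq_card_in _ _ f) => x y.
rewrite !inE => /eqP xq /eqP yq [xy]; apply/val_inj => /=.
by rewrite (divn_eq x d) (divn_eq y d) xq yq xy.
Qed.

Lemma sum_eq_le1 N (A : {set 'I_N}) (w : nat) : \sum_(y in A) (y == w :> nat)%:R <= 1 :> R.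
Proof.
rewrite -natr_sum (_ : 1 = 1%:R)// ler_nat.
apply: (@leq_trans #|[set y : 'I_N | y == w :> nat]%SET|).
  rewrite -sum1_card [leqLHS]big_mkcond [leqRHS]big_mkcond/=; apply: leq_sum => y _.
  by rewrite inE; case: ifP => // _; case: eqP.
apply/card_le1_eqP => x y; rewrite !inE => /eqP xw /eqP yw.
by apply/val_inj; rewrite /= xw yw.
Qed.

(** Residues below [d / 2] add without a carry, so a common block is the block of [w] at length
    [2 * d]. It leaves at most [d] choices of [x], and [x] determines [y]. *)
Lemma sum_same_block_le N (A : {set 'I_N}) d (w : nat) : (0 < d)%N ->
  (forall x, x \in A -> 2 * (x %% d) < d)%N ->
  \sum_(x in A) \sum_(y in A) ((x + y == w)%N && (x %/ d == y %/ d)%N)%:R <= d%:R :> R.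
Proof.
move=> d0 hA.
apply: (@le_trans _ _ (\sum_(x in A) (x %/ d == w %/ (2 * d))%N%:R)); last first.
  rewrite -natr_sum ler_nat. apply: leq_trans (card_block N (w %/ (2 * d))%N d0).
  rewrite -sum1_card [leqLHS]big_mkcond [leqRHS]big_mkcond/=; apply: leq_sum => y _.
  by rewrite inE; case: ifP => // _; case: eqP.
apply: ler_sum => x xA; case: eqP => [e|ne].
  apply: le_trans (sum_eq_le1 A (w - x)); apply: ler_sum => y _.
  rewrite ler_nat; case: eqP => //= <-.
  by rewrite addKn eqxx; case: eqP.
rewrite big1// => y yA; case: eqP => //= xyw; case: eqP => //= xy.
exfalso; apply: ne; rewrite -xyw.
have hx := hA x xA; have hy := hA y yA.
have -> : (x + y = (x %/ d) * (2 * d) + (x %% d + y %% d))%N.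
  by rewrite {1}(divn_eq x d) {1}(divn_eq y d) -xy; ring.
have uv : (x %% d + y %% d < 2 * d)%N by move: hx hy; clear; lia.
by rewrite divnMDl ?muln_gt0 ?d0// (divn_small uv) addn0.
Qed.

Definition monochromatic_floor_sum (alpha : R -> R) k (c : nat -> 'I_k) := exists x y n : nat,
  [/\ [/\ (0 < x)%N, (0 < y)%N & (0 < n)%N], x <> y, c x = c y
    & (x + y)%N%:Z = Num.floor (alpha n%:R)].

(* Real sums are discretized at scale [1 / (10 * J)]; restricting both summands to fractional
   parts in [1/10, 4/10) makes the integer parts add up without a carry, and averaging over
   [J] neighbouring targets suppresses the high frequencies. *)
Lemma monochromatic_sums_of_equidistributed (alpha : R -> R) (C1 C2 : R) :
  0 < C1 -> 0 < C2 ->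
  (forall eps R0 : R, 0 < eps <= 1 -> 0 < R0 -> exists2 C3 : R, 0 < C3 &
   forall A0 : R, exists a m : nat,
   let T := alpha (a + m)%:R - alpha a%:R in
   [/\ [/\ (0 < a)%N, 0 <= alpha a%:R, A0 <= m%:R, A0 <= T & m%:R <= C2 * T],
       forall n, (a <= n < a + m)%N ->
         0 <= alpha n.+1%:R - alpha n%:R <= C1 * T / m%:R &
       forall b, C3 / T <= `|b| <= R0 -> avg_small (fun n => b * alpha n%:R) a m eps]) ->
  forall k (c : nat -> 'I_k), monochromatic_floor_sum alpha c.
Proof.
move=> C10 C20 hyp k c.
have k0 : (0 < k)%N by case: k c => // c; case: (c 0%N).
have k0' : 0 < k%:R :> R by rewrite ltr0n.
have k1' : 1 <= k%:R :> R by rewrite ler1n.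
pose delta : R := (2 * k%:R)^-1.
have delta1 : 0 < delta <= 1.
  by rewrite /delta invr_gt0 mulr_gt0//= invf_le1 ?mulr_gt0//; move: k1'; clear; lra.
(* The increments of the discretized sequence are those of [alpha] scaled by [D], plus a rounding
   error 1; [m <= C2 * T] makes that error comparable to the average increment. *)
pose C1' := 2 * C1 + C2 + 1.
have C1'1 : 1 <= C1' by rewrite /C1'; lra.
pose eps := delta / (16 * (16 * C1')).
have c0 : 0 < 16 * (16 * C1') by move: C1'1; clear; lra.
have eps0 : 0 < eps by apply: divr_gt0 => //; case/andP: delta1.
have eps1 : eps <= 1.
  rewrite ler_pdivrMr// mul1r; case/andP: delta1 => _; move: C1'1; clear; lra.
(* Large enough that every frequency below [2 / (eps * J)] satisfies [8 * |theta| <= eps / 2], so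
   that rounding costs at most half of the allowed error. *)
have [J hJ] := nat_ge (32 / eps ^+ 2 + 1).
have e20 : 0 < eps ^+ 2 by rewrite exprn_gt0.
have q32 : 0 < 32 / eps ^+ 2 by rewrite divr_gt0.
have J0' : 0 < J%:R :> R by move: hJ q32; clear; lra.
have J0 : (0 < J)%N by rewrite -(ltr0n R).
have J1 : 1 <= J%:R :> R by rewrite ler1n.
have hJ2 : 32 <= J%:R * eps ^+ 2 by rewrite -ler_pdivrMr//; move: hJ; clear; lra.
(* With [D = 10 * J], frequencies below [2 / (eps * J)] in the discretized problem are frequencies
   below [20 / eps] of [alpha]. *)
have R00 : 0 < 20 / eps by rewrite divr_gt0.
have eps2 : 0 < eps / 2 <= 1 by move: eps0 eps1; clear; lra.
have [C3 C30 {}hyp] := hyp _ _ eps2 R00.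
have C30' : 0 < 2 * C3 by rewrite mulr_gt0.
pose D := (10 * J)%N.
have D0 : (0 < D)%N by rewrite muln_gt0.
have DE : D%:R = 10 * J%:R :> R by rewrite natrM.
have [T0 T00 hdense] := dense_sums C1'1 delta1 J0 C30' (ler0n R D).
have [a [m [[a0 alp0 hm hT mT] step hb]]] := hyp (T0 + 32).
set T := alpha _ - alpha _ in hT mT step hb.
have T1 : 32 <= T by move: hT T00; clear; lra.
have m32 : 32 <= m%:R :> R by move: hm T00; clear; lra.
have m0 : 0 < m%:R :> R by move: m32; clear; lra.
have alp n : (n <= m)%N -> 0 <= alpha (a + n)%:R.
  elim: n => [|n IH] nm; first by rewrite addn0.
  have hn : (a <= a + n < a + m)%N by rewrite leq_addr ltn_add2l.
  have /andP[s1 _] := step _ hn; have := IH (ltnW nm).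
  by rewrite addnS; move: s1; clear; lra.
pose B n := Num.truncn (D%:R * alpha n%:R).
have hB n : (a <= n <= a + m)%N ->
    (B n)%:R <= D%:R * alpha n%:R < (B n)%:R + 1.
  move=> /andP[n1 n2]; rewrite natr1; apply: truncn_itv.
  by rewrite mulr_ge0// -(subnKC n1) alp// leq_subLR.
pose TB : R := (B (a + m)%N)%:R - (B a)%:R.
have [TBl TBu] : 5 * (J%:R * T) <= TB /\ TB <= 20 * (J%:R * T).
  have /andP[b1 b2] : (B a)%:R <= D%:R * alpha a%:R < (B a)%:R + 1.
    by apply: hB; rewrite leqnn leq_addr.
  have /andP[b3 b4] : (B (a + m)%N)%:R <= D%:R * alpha (a + m)%:R < (B (a + m)%N)%:R + 1.
    by apply: hB; rewrite leqnn leq_addr.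
  have JT : T <= J%:R * T by rewrite ler_peMl//; move: T1; clear; lra.
  have : D%:R * alpha (a + m)%:R - D%:R * alpha a%:R = 10 * (J%:R * T).
    by rewrite DE /T; ring.
  rewrite /TB; move: T1 b1 b2 b3 b4 JT; clear; split; lra.
have JT0 : 0 < J%:R * T by rewrite mulr_gt0//; move: T1; clear; lra.
have TB0 : 0 < TB by move: TBl JT0; clear; lra.
have JT32 : 32 * J%:R <= J%:R * T by rewrite mulrC ler_pM2l.
have TJ : T <= J%:R * T by rewrite ler_peMl//; move: T1; clear; lra.
pose q0 := (Num.truncn (((B a)%:R + TB / 4) / (2 * D%:R))).+1.
pose q1 := Num.truncn (((B a)%:R + 3 * TB / 4) / (2 * D%:R)).
have D20 : 0 < 2 * D%:R :> R by rewrite mulr_gt0// ltr0n.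
have [q0a q0b] : (B a)%:R + TB / 4 <= 2 * (D%:R * q0%:R)
     /\ 2 * (D%:R * q0%:R) <= (B a)%:R + TB / 4 + 2 * D%:R.
  have y0 : 0 <= (B a)%:R + TB / 4 by have := ler0n R (B a); move: TB0; clear; lra.
  have /truncn_itv/andP[t1 t2] : 0 <= ((B a)%:R + TB / 4) / (2 * D%:R).
    by rewrite divr_ge0// ltW.
  move: t1; rewrite ler_pdivlMr// => t1; move: t2; rewrite ltr_pdivrMr// => t2.
  rewrite /q0; split; first by move: t2; clear; lra.
  by rewrite -(natr1 (Num.truncn _)); move: t1; clear; lra.
have [q1a q1b] : 2 * (D%:R * q1%:R) <= (B a)%:R + 3 * TB / 4
     /\ (B a)%:R + 3 * TB / 4 <= 2 * (D%:R * q1%:R) + 2 * D%:R.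
  have y0 : 0 <= (B a)%:R + 3 * TB / 4 by have := ler0n R (B a); move: TB0; clear; lra.
  have /truncn_itv/andP[t1 t2] : 0 <= ((B a)%:R + 3 * TB / 4) / (2 * D%:R).
    by rewrite divr_ge0// ltW.
  move: t1; rewrite ler_pdivlMr// => t1; move: t2; rewrite ltr_pdivrMr// => t2.
  rewrite /q1; split; first by move: t1; clear; lra.
  by move: t2; rewrite -(natr1 (Num.truncn _)); clear; lra.
have q01 : TB / 32 <= 3 * J%:R * (q1%:R - q0%:R).
  have := JT32; move: q0b q1b TBl; rewrite DE => h1 h2 h3 h4.
  have h5 : TB / 2 <= 20 * (J%:R * q1%:R) - 20 * (J%:R * q0%:R) + 40 * J%:R.
    by move: h1 h2; clear; lra.
  by move: h3 h4 h5 J0'; clear; lra.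
have q01' : (q0 <= q1)%N.
  rewrite leqNgt; apply/negP => lt.
  have : q1%:R <= q0%:R :> R by rewrite ler_nat ltnW.
  have : 0 < q1%:R - q0%:R :> R.
    have : 0 < 3 * J%:R * (q1%:R - q0%:R) :> R by apply: lt_le_trans q01; rewrite divr_gt0.
    by rewrite pmulr_rgt0// mulr_gt0.
  by clear; lra.
pose N := (D * q1)%N.
(* [x %/ D] is the integer to be coloured and [x %% D] an auxiliary fractional part in
   [[1/10, 4/10)]; it keeps the density of [X] positive at scale [1 / D]. *)
pose X : {set 'I_N} := [set x : 'I_N | (q0 <= x %/ D)%N && (J <= x %% D < 4 * J)%N]%SET.
have cardX : (3 * J * (q1 - q0) <= #|X|)%N.
  have lt (q : 'I_(q1 - q0)) (w : 'I_(3 * J)) : ((q0 + q) * D + (J + w) < N)%N.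
    move: (nat_of_ord q) (nat_of_ord w) (ltn_ord q) (ltn_ord w) => {q w} q w h1 h2.
    apply: (@leq_trans ((q0 + q).+1 * D)%N); first by rewrite [X in (_ < X)%N]mulSn [(D + _)%N]addnC ltn_add2l /D; move: h2; clear; lia.
    by rewrite /N mulnC leq_mul2l -subn_gt0; apply/orP; right; move: h1 q01'; clear; lia.
  pose f (p : 'I_(q1 - q0) * 'I_(3 * J)) : 'I_N := Ordinal (lt p.1 p.2).
  have dm (p : 'I_(q1 - q0) * 'I_(3 * J)) :
      (f p %/ D = q0 + p.1)%N /\ (f p %% D = J + p.2)%N.
    have w : (J + p.2 < D)%N by rewrite /D; move: (ltn_ord p.2); clear; lia.
    by rewrite /f/= divnMDl// modnMDl divn_small// modn_small// addn0.
  have injf : injective f.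
    move=> p p' e; have [e1 e2] := dm p; have [e3 e4] := dm p'.
    have h1 : p.1 = p'.1 by apply/val_inj/(@addnI q0); rewrite -e1 -e3 e.
    have h2 : p.2 = p'.2 by apply/val_inj/(@addnI J); rewrite -e2 -e4 e.
    by rewrite (surjective_pairing p) (surjective_pairing p') h1 h2.
  have -> : (3 * J * (q1 - q0))%N = #|(f @: [set: 'I_(q1 - q0) * 'I_(3 * J)])%SET|.
    by rewrite card_imset// cardsT card_prod !card_ord mulnC.
  apply: subset_leq_card; apply/fintype.subsetP => _ /imsetP[p _ ->].
  have [e1 e2] := dm p; rewrite inE e1 e2 !leq_addr/=.
  rewrite (_ : 4 * J = J + 3 * J)%N ?ltn_add2l//; by clear; lia.
have [col hcol] := pigeonhole_card X (fun x : 'I_N => c (x %/ D)%N) k0.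
set A := [set x in X | _] in hcol.
have AE (x : 'I_N) : x \in A ->
    [/\ (q0 <= x %/ D)%N, (J <= x %% D < 4 * J)%N & c (x %/ D)%N = col].
  by rewrite !inE => /andP[/andP[h1 h2] /eqP h3].
have cardA : delta * TB / 16 <= #|A|%:R.
  have h1 : TB / 32 <= k%:R * #|A|%:R.
    apply: (le_trans q01); rewrite -natrB// -!natrM ler_nat.
    exact: leq_trans cardX hcol.
  have -> : delta * TB / 16 = TB / 32 / k%:R by rewrite /delta; field; rewrite gt_eqF.
  by rewrite ler_pdivrMr// [leRHS]mulrC.
have rangeA (x : 'I_N) : x \in A ->
    (B a)%:R + TB / 4 <= 2 * x%:R <= (B a)%:R + 3 * TB / 4.
  move=> /AE[h1 _ _]; apply/andP; split.
    apply: (le_trans q0a); rewrite ler_pM2l// -natrM ler_nat.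
    by rewrite (divn_eq x D) mulnC (leq_trans _ (leq_addr _ _))// leq_mul2r h1 orbT.
  apply: le_trans q1a; rewrite ler_pM2l// -natrM ler_nat; exact: ltnW.
have sameA w : \sum_(x in A) \sum_(y in A)
    ((x + y == w)%N && (x %/ D == y %/ D)%N)%:R <= D%:R :> R.
  apply: sum_same_block_le => // x /AE[_ /andP[_ h] _].
  by rewrite /D in h *; move: h; clear; lia.
have stepB n : (a <= n < a + m)%N ->
    (0 : R) <= (B n.+1)%:R - (B n)%:R <= C1' * TB / m%:R.
  move=> hn; have /andP[s1 s2] := step n hn.
  have /andP[b1 b2] : (B n)%:R <= D%:R * alpha n%:R < (B n)%:R + 1.
    by apply: hB; move: hn; clear; lia.
  have /andP[b3 b4] : (B n.+1)%:R <= D%:R * alpha n.+1%:R < (B n.+1)%:R + 1.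
    by apply: hB; move: hn; clear; lia.
  have Dle : D%:R * alpha n%:R <= D%:R * alpha n.+1%:R.
    by rewrite ler_wpM2l//; move: s1; clear; lra.
  apply/andP; split.
    rewrite subr_ge0 ler_nat; apply: le_truncn.
    exact: Dle.
  have h1 : (B n.+1)%:R - (B n)%:R <= D%:R * (alpha n.+1%:R - alpha n%:R) + 1.
    by rewrite mulrBr; move: b2 b3; clear; lra.
  have h2 : D%:R * (alpha n.+1%:R - alpha n%:R) <= D%:R * (C1 * T / m%:R).
    by rewrite ler_wpM2l.
  apply: (le_trans h1); apply: (le_trans (lerD h2 (lexx _))).
  rewrite ler_pdivlMr// mulrDl mul1r.
  have -> : D%:R * (C1 * T / m%:R) * m%:R = 10 * (C1 * (J%:R * T)).
    by rewrite DE; field; rewrite gt_eqF.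
  have h3 : C1' * (5 * (J%:R * T)) <= C1' * TB by rewrite ler_pM2l//; move: C1'1; clear; lra.
  have h4 : C2 * T <= C2 * (J%:R * T) by rewrite ler_pM2l.
  have h5 : 0 <= C2 * (J%:R * T) by rewrite mulr_ge0// ltW.
  by move: mT h3 h4 h5 JT0; rewrite /C1'; clear; lra.
have eJ0 : 0 < eps * J%:R by exact: mulr_gt0.
have small theta t : `|theta| <= 2^-1 -> 2 * C3 / TB <= `|theta| ->
     `|\sum_(n < m) \sum_(j < J) cs (theta * (B (a + n) + j)%:R + t)|
        <= delta / (16 * (16 * C1')) * (m * J)%:R.
  move=> th2 thC; rewrite -/eps.
  (* Above this threshold the sum over [j] is geometric and already small for each [n]; below it the
     sum over [n] is small for each [j]. *)
  case: (leP (2 / (eps * J%:R)) `|theta|) => hth.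
    apply: (le_trans (ler_norm_sum _ _ _)).
    apply: (@le_trans _ _ (\sum_(n < m) eps * J%:R)); last first.
      by rewrite sumr_const card_ord -[_ *+ m]mulr_natr natrM -mulrA [J%:R * _]mulrC.
    apply: ler_sum => n _.
    have := geometric_cs_le (theta * (B (a + n)%N)%:R + t) J th2.
    have -> : \sum_(i < J) cs (i%:R * theta + (theta * (B (a + n)%N)%:R + t))
       = \sum_(j < J) cs (theta * (B (a + n) + j)%:R + t).
      by apply: eq_bigr => j _; congr cs; rewrite natrD; ring.
    move: hth; rewrite ler_pdivrMr// => hth h.
    have th0 : 0 < `|theta|.
      by rewrite normr_gt0; apply/eqP => e; move: hth; rewrite e normr0 mul0r; clear; lra.
    by rewrite -(ler_pM2r th0); apply: (le_trans h); rewrite [leRHS]mulrC.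
  rewrite exchange_big/=; apply: (le_trans (ler_norm_sum _ _ _)).
  apply: (@le_trans _ _ (\sum_(j < J) eps * m%:R)); last first.
    by rewrite sumr_const card_ord -[_ *+ J]mulr_natr natrM -mulrA.
  apply: ler_sum => j _.
  pose b := D%:R * theta.
  have h1 : `|\sum_(n < m) cs (b * alpha (a + n)%:R + (theta * j%:R + t))| <= eps / 2 * m%:R.
    apply: hb; rewrite /b normrM [`|D%:R|]ger0_norm// DE; apply/andP; split.
      rewrite ler_pdivrMr; last by move: T1; clear; lra.
      move: thC; rewrite ler_pdivrMr// => thC.
      have := ler_wpM2l (normr_ge0 theta) TBu; move: thC; clear; lra.
    rewrite ler_pdivlMr//; move: hth; rewrite ltr_pdivlMr//; clear; lra.
  have h2 : `|\sum_(n < m) (cs (theta * (B (a + n) + j)%:R + t)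
       - cs (b * alpha (a + n)%:R + (theta * j%:R + t)))| <= eps / 2 * m%:R.
    apply: (le_trans (ler_norm_sum _ _ _)).
    apply: (@le_trans _ _ (\sum_(n < m) eps / 2)); last first.
      by rewrite sumr_const card_ord -[_ *+ m]mulr_natr.
    apply: ler_sum => n _; apply: (le_trans (cs_lipschitz _ _)).
    have -> : theta * (B (a + n) + j)%:R + t - (b * alpha (a + n)%:R + (theta * j%:R + t))
       = theta * ((B (a + n)%N)%:R - D%:R * alpha (a + n)%:R) by rewrite /b natrD; ring.
    have /andP[b1 b2] : (B (a + n)%N)%:R <= D%:R * alpha (a + n)%:R < (B (a + n)%N)%:R + 1.
      by apply: hB; rewrite leq_addr leq_add2l ltnW.
    have h3 : `|(B (a + n)%N)%:R - D%:R * alpha (a + n)%:R| <= 1.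
      by rewrite ler_norml; move: b1 b2; clear; lra.
    rewrite normrM; apply: (@le_trans _ _ (8 * `|theta|)).
      by rewrite ler_pM2l// ler_piMr.
    have h4 : 8 * (2 / (eps * J%:R)) <= eps / 2.
      rewrite mulrA ler_pdivrMr//; move: hJ2; rewrite expr2; clear; lra.
    by move: hth h4; clear; lra.
  have := ler_normD (\sum_(n < m) (cs (theta * (B (a + n) + j)%:R + t)
       - cs (b * alpha (a + n)%:R + (theta * j%:R + t))))
    (\sum_(n < m) cs (b * alpha (a + n)%:R + (theta * j%:R + t))).
  rewrite sumrB subrK; move: h1 h2; rewrite sumrB; clear; lra.
have T0TB : T0 <= TB by move: TBl TJ hT T1; clear; lra.
have T0m : T0 <= m%:R by move: hm; clear; lra.
have [x [y [n [j [[xA yA] xy hn jJ xyB]]]]] :=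
  hdense B a m N A (fun x => x %/ D)%N TB erefl T0TB T0m stepB rangeA cardA sameA small.
have [hx1 hx2 hx3] := AE _ xA; have [hy1 hy2 hy3] := AE _ yA.
exists (x %/ D)%N, (y %/ D)%N, n; split.
- split; [exact: leq_trans hx1|exact: leq_trans hy1|].
  by move: a0 hn; clear; lia.
- exact: xy.
- by rewrite hx3 hy3.
have /andP[b1 b2] : (B n)%:R <= D%:R * alpha n%:R < (B n)%:R + 1.
  by apply: hB; move: hn; clear; lia.
have D0' : 0 < D%:R :> R by rewrite ltr0n.
apply/esym/eqP; rewrite floor_eq.
(* The two residues add up to at least [2 * J] and less than [8 * J], and [j < J], so subtracting
   [j] neither borrows nor reaches the next block. *)
have Bn : (D * (x %/ D + y %/ D) <= B n < D * (x %/ D + y %/ D) + D - 1)%N.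
  move: xyB hx2 hy2 jJ; rewrite {1}(divn_eq x D) {1}(divn_eq y D) mulnDr.
  rewrite [(x %/ D * D)%N]mulnC [(y %/ D * D)%N]mulnC.
  have : D = (10 * J)%N by []; clear.
  move: (D * (x %/ D))%N (D * (y %/ D))%N (x %% D)%N (y %% D)%N (B n) => u v w z t; lia.
have [Bn1 Bn2] : (D%:R * (x %/ D + y %/ D)%:R : R) <= (B n)%:R /\
    (B n)%:R + 1 <= D%:R * (x %/ D + y %/ D)%:R + D%:R :> R.
  rewrite -natrM -natrD natr1 !ler_nat; move: Bn D0; clear; split; lia.
apply/andP; split.
  rewrite -(ler_pM2l D0'); apply: le_trans b1; exact: Bn1.
rewrite -(ltr_pM2l D0') intrD mulrDr mulr1.
by apply: (lt_le_trans b2); exact: Bn2.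
Qed.

End Grid.

(** * Functions with monotone derivatives *)

Section Towers.
Variable R : realType.
Implicit Types (F G : nat -> R -> R) (A x y : R).

Lemma mean_value (f df : R -> R) A x y :
  (forall z, A <= z -> is_derive z 1 f (df z)) -> A <= x -> x <= y ->
  exists2 z, x <= z <= y & f y - f x = df z * (y - x).
Proof.
move=> fd Ax xy.
have [||z] := @MVT_segment R f df x y xy.
- by move=> z; rewrite in_itv/= => /andP[xz _]; apply/fd/(le_trans Ax)/ltW.
- apply: derivable_within_continuous => z; rewrite in_itv/= => /andP[xz _].
  by have [] := fd z (le_trans Ax xz).
by rewrite in_itv/= => hz e; exists z.
Qed.

Definition tower F n A :=
  forall i x, (i < n)%N -> A <= x -> is_derive x 1 (F i) (F i.+1 x).

Lemma towerN F n A : tower F n A -> tower (fun i x => - F i x) n A.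
Proof. by move=> tF i x ni Ax; apply: is_deriveN; exact: tF. Qed.

Lemma towerB F G n A : tower F n A -> tower G n A ->
  tower (fun i x => F i x - G i x) n A.
Proof.
by move=> tF tG i x ni Ax; apply: is_deriveB; [exact: tF|exact: tG].
Qed.

Lemma tower_shift F n A (s : R) : 0 <= s -> tower F n A ->
  tower (fun i x => F i (x + s)) n A.
Proof.
move=> s0 tF i x ni Ax; rewrite -[F i.+1 _]mulr1.
apply: (@is_derive1_comp R (F i) (shift s)); last exact: is_derive_shift.
by apply: tF => //; rewrite /= (le_trans Ax)// lerDl.
Qed.

Lemma tower_le F n m A B : (m <= n)%N -> A <= B -> tower F n A -> tower F m B.
Proof. by move=> mn AB tF i x im Bx; apply: tF; [exact: leq_trans mn|exact: le_trans Bx]. Qed.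

(** Differencing commutes with differentiation, so each step of the list costs one application of
    the mean value theorem to the next derivative. *)
Lemma diffs_tower ss F A (n : nat) : tower F (size ss) A -> A <= n%:R ->
  exists2 z : R, n%:R <= z <= (n + sumn ss)%:R &
    diffs ss (fun i => F 0%N i%:R) n = (\prod_(s <- ss) s%:R) * F (size ss) z.
Proof.
elim: ss F => [|s ss IH] F tF An /=.
  by exists n%:R; rewrite ?addn0 ?lexx// big_nil mul1r.
pose G i x := F i (x + s%:R) - F i x.
have tG : tower G (size ss) A.
  by apply: towerB; [apply: tower_shift => //|]; apply: tower_le tF.
have [z /andP[nz zn] e] := IH G tG An.
have Az : A <= z by exact: le_trans nz.
have [w /andP[zw wz] ew] := @mean_value (F (size ss)) (F (size ss).+1) A z (z + s%:R)
  (fun x Ax => tF (size ss) x (ltnSn _) Ax) Az (ltac:(by rewrite lerDl)).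
exists w.
  rewrite (le_trans nz zw)/= (le_trans wz)// addnCA addnC natrD lerD2r.
  exact: zn.
rewrite big_cons; transitivity (diffs ss (fun i => G 0%N i%:R) n).
  by apply: eq_diffs => i; rewrite /G natrD.
by rewrite e /G ew addrAC subrr add0r; ring.
Qed.

Lemma max_power (K : nat) (rho : R) : (0 < K)%N -> 1 <= rho ->
  exists2 s : nat, (0 < s)%N & s%:R ^+ K <= rho < s.+1%:R ^+ K.
Proof.
move=> K0 rho1.
have [b hb] := nat_ge rho.
pose P (s : nat) := s%:R ^+ K <= rho.
have exP : exists s, P s by exists 1%N; rewrite /P expr1n.
have ubP s : P s -> (s <= b)%N.
  rewrite /P => h; rewrite -(ler_nat R); apply: le_trans hb; apply: le_trans h.
  by case: s => [|s]; [rewrite exprn_ge0|rewrite ler_eXnr// ler1n].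
case: (ex_maxnP exP ubP) => s Ps smax; exists s.
  by apply: (smax 1%N); rewrite /P expr1n.
rewrite [_ <= _]Ps/= ltNge; apply/negP => h.
by have := smax s.+1 h; rewrite ltnn.
Qed.

(** Ensures that the step [s] provided by [max_power] is shorter than the window [X] by the
    prescribed factor [Cb]. *)
Lemma scale_le (K : nat) (u kap Cb X : R) (s : nat) : (0 < K)%N -> 0 < u -> 0 < Cb -> 0 < X ->
  u * s%:R ^+ K <= kap -> kap * Cb ^+ K < u * X ^+ K -> s%:R * Cb <= X.
Proof.
move=> K0 u0 Cb0 X0 h1 h2; rewrite leNgt; apply/negP => lt.
have : X ^+ K < (s%:R * Cb) ^+ K by rewrite ltrXn2r// ?ltW// -lt0n.
rewrite exprMn -(ltr_pM2l u0) mulrA => h3.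
have : u * s%:R ^+ K * Cb ^+ K <= kap * Cb ^+ K by rewrite ler_wpM2r// exprn_ge0// ltW.
by move: h2 h3; clear; lra.
Qed.

Lemma prod_nseq (k s : nat) : \prod_(i <- nseq k s) i%:R = s%:R ^+ k :> R.
Proof. by elim: k => [|k IH]; rewrite ?big_nil// big_cons IH exprS. Qed.

(* The step [s] of the differencing is chosen so that [s ^ k] times the [k]-th derivative
   is of the order of a small constant. *)
Lemma weyl_derivative k eps Bq : 0 < eps <= 1 -> 1 <= Bq ->
  exists2 kap : R, 0 < kap & exists2 C0 : R, 0 < C0 &
  forall F (X a b : R) (a0 m : nat), 0 < a -> C0 <= X ->
  tower F k.+2 (3 * X / 4) ->
  (forall x, 3 * X / 4 <= x <= X -> a / Bq <= F k.+1 x <= Bq * a) ->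
  (forall x, 3 * X / 4 <= x <= X -> `|F k.+2 x| <= Bq * a / X) ->
  3 * X / 4 <= a0%:R -> (a0 + 2 * m)%:R <= 15 * X / 16 -> X <= 32 * m%:R ->
  0 < b -> b * a <= kap -> C0 <= b * a * X ^+ k.+1 ->
  avg_small (fun n => b * F 0%N n%:R) a0 m eps.
Proof.
move=> eps01 Bq1; have [kap2 /andP[kap20 kap2h] hW] := weyl k eps01.
have Bq0 : 0 < Bq by move: Bq1; clear; lra.
pose kap := kap2 / Bq.
have kap0 : 0 < kap by rewrite divr_gt0.
(* The factor [Bq] accounts for the variation of the derivative, and [2 ^ k.+1] for the step being
   an integer, as [s + 1 <= 2 * s]. *)
pose kap1 := kap / (Bq * 2 ^+ k.+1).
have p2 : 1 <= 2 ^+ k.+1 :> R by rewrite exprn_ege1//; clear; lra.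
have p20 : 0 < 2 ^+ k.+1 :> R by rewrite exprn_gt0.
have kap12 : 0 < kap1 <= kap2.
  have B2 : 0 < Bq * 2 ^+ k.+1 by rewrite mulr_gt0.
  apply/andP; split; first by rewrite divr_gt0.
  rewrite /kap1 ler_pdivrMr//.
  have h1 : kap <= kap2 by rewrite ler_pdivrMr// ler_peMr// ltW.
  apply: (le_trans h1); rewrite ler_peMr// ?(ltW kap20)//.
  by move: Bq1 p2; clear; nra.
have [C C0 {}hW] := hW kap1 kap12.
(* The three summands guarantee that the blocks of length [C * s] fit into the sum, that the
   intermediate points stay below [X], and that the derivative varies by at most [1 / C] over such a
   block. *)
pose Cb : nat := (32 * C + 16 * k.+1 + C * (C + k.+1))%N.
have Cb0 : (0 < Cb)%N by rewrite /Cb; move: C0; clear; lia.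
have Cb0' : 0 < Cb%:R :> R by rewrite ltr0n.
exists kap => //; exists (kap * Cb%:R ^+ k.+1 + 1).
  by rewrite addr_gt0// mulr_gt0// exprn_gt0.
move=> F X a b a0 m apos hX tF F1 F2 ha0 hm hmX b0 hba hbX.
have X0 : 0 < X.
  by apply: lt_le_trans hX; rewrite addr_gt0// mulr_gt0// exprn_gt0.
have ba0 : 0 < b * a by rewrite mulr_gt0.
have [s s0 /andP[s1 s2]] := @max_power k.+1 (kap / (b * a)) isT (ltac:(by rewrite ler_pdivlMr// mul1r)).
have s1' : b * a * s%:R ^+ k.+1 <= kap by rewrite mulrC -ler_pdivlMr.
have s2' : kap <= b * a * s%:R ^+ k.+1 * 2 ^+ k.+1.
  rewrite -mulrA -exprMn [leRHS]mulrC -ler_pdivrMr//; apply: (le_trans (ltW s2)).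
  apply: lerXn2r; rewrite ?nnegrE//.
  by rewrite -natrM ler_nat; move: s0; clear; lia.
have sCb : s%:R * Cb%:R <= X.
  apply: (@scale_le k.+1 (b * a) kap) => //.
  by move: hbX; clear; lra.
have sX1 : 32 * (C%:R * s%:R) <= X.
  apply: le_trans sCb; rewrite -!natrM ler_nat /Cb; clear; nia.
have sX2 : 16 * (k.+1%:R * s%:R) <= X.
  apply: le_trans sCb; rewrite -!natrM ler_nat /Cb; clear; nia.
have sX3 : (C * (C + k.+1))%:R * s%:R <= X.
  apply: le_trans sCb; rewrite -!natrM ler_nat /Cb; clear; nia.
have Csm : (C * s <= m)%N.
  by rewrite -(ler_nat R) natrM; move: sX1 hmX; clear; lra.
pose phi n := b * F 0%N n%:R.
pose ss := nseq k.+1 s.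
have key n : (a0 <= n <= a0 + m + C * s)%N -> exists2 z : R,
    n%:R <= z <= n%:R + k.+1%:R * s%:R & 3 * X / 4 <= z <= X /\
    diffs ss phi n = b * s%:R ^+ k.+1 * F k.+1 z.
  move=> /andP[n1 n2].
  have tF' : tower F (size ss) (3 * X / 4).
    by rewrite size_nseq; apply: tower_le tF.
  have n1' : 3 * X / 4 <= n%:R by apply: (le_trans ha0); rewrite ler_nat.
  have [z hz e] := diffs_tower tF' n1'.
  rewrite sumn_nseq natrD natrM [s%:R * _]mulrC in hz.
  exists z => //; split; last first.
    by rewrite /phi diffsZ e size_nseq prod_nseq mulrA.
  case/andP: hz => z1 z2; rewrite (le_trans n1' z1)/=; apply: (le_trans z2).
  have : n%:R <= (a0 + 2 * m)%:R :> R.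
    by rewrite ler_nat; move: n2 Csm; clear; lia.
  by move: hm sX2; clear; lra.
have bs0 : 0 < b * s%:R ^+ k.+1 by rewrite mulr_gt0// exprn_gt0// ltr0n.
apply: (hW ss s phi a0 m (diffs ss phi)) => //.
- by rewrite size_nseq.
- by apply/allP => t /nseqP[-> _]; rewrite s0 leqnn.
- move=> n /key[z _ [hz ->]]; rewrite subrr; split; first exact: rpred0.
  have /andP[f1 f2] := F1 z hz; apply/andP; split.
    apply: (@le_trans _ _ (b * s%:R ^+ k.+1 * (a / Bq))); last by rewrite ler_pM2l.
    have -> : kap1 = kap / 2 ^+ k.+1 / Bq by rewrite /kap1 invfM; ring.
    have -> : b * s%:R ^+ k.+1 * (a / Bq) = b * a * s%:R ^+ k.+1 / Bq by ring.
    by rewrite ler_pM2r ?invr_gt0// ler_pdivrMr.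
  apply: (@le_trans _ _ (b * s%:R ^+ k.+1 * (Bq * a))); first by rewrite ler_pM2l.
  have -> : b * s%:R ^+ k.+1 * (Bq * a) = b * a * s%:R ^+ k.+1 * Bq by ring.
  by rewrite -ler_pdivlMr.
- move=> n n' n1 /andP[n2 n3] n4.
  have hn : (a0 <= n <= a0 + m + C * s)%N by move: n1 n2 n4; clear; lia.
  have hn' : (a0 <= n' <= a0 + m + C * s)%N by move: n1 n2 n4; clear; lia.
  have [z /andP[z1 z2] [/andP[z3 z4] ->]] := key n hn.
  have [z' /andP[z1' z2'] [/andP[z3' z4'] ->]] := key n' hn'.
  have dist : `|z' - z| <= (C + k.+1)%:R * s%:R.
    have h1 : n%:R <= n'%:R :> R by rewrite ler_nat.
    have h2 : n'%:R <= n%:R + C%:R * s%:R :> R by rewrite -natrM -natrD ler_nat.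
    have h3 : 0 <= C%:R * s%:R :> R by [].
    rewrite natrD ler_norml; move: h1 h2 h3 z1 z2 z1' z2'; clear; lra.
  have lip : `|F k.+1 z' - F k.+1 z| <= Bq * a / X * `|z' - z|.
    wlog zz' : z z' {z1 z2 z1' z2' dist} z3 z4 z3' z4' / z <= z'.
      move=> H; case: (leP z z') => [|/ltW] h; first exact: H.
      by rewrite distrC [`|z' - z|]distrC; exact: H.
    have [w /andP[w1 w2] ->] := @mean_value (F k.+1) (F k.+2) (3 * X / 4) z z'
      (fun x Ax => tF k.+1 x (ltnSn _) Ax) z3 zz'.
    rewrite normrM ler_wpM2r//; apply: F2.
    by rewrite (le_trans z3 w1) (le_trans w2 z4').
  rewrite -mulrBr normrM gtr0_norm//.
  apply: (@le_trans _ _ (b * s%:R ^+ k.+1 * (Bq * a / X * ((C + k.+1)%:R * s%:R)))).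
    rewrite ler_pM2l//; apply: (le_trans lip); rewrite ler_wpM2l//.
    by rewrite divr_ge0 ?mulr_ge0// ltW.
  have -> : b * s%:R ^+ k.+1 * (Bq * a / X * ((C + k.+1)%:R * s%:R))
     = (b * a * s%:R ^+ k.+1 * Bq) * (((C + k.+1)%:R * s%:R) / X) by ring.
  have h1 : b * a * s%:R ^+ k.+1 * Bq <= 1.
    apply: (@le_trans _ _ kap2); first by rewrite -ler_pdivlMr.
    by move: kap2h; clear; lra.
  apply: (@le_trans _ _ (1 * (((C + k.+1)%:R * s%:R) / X))).
    by rewrite ler_wpM2r// divr_ge0 ?mulr_ge0// ltW.
  rewrite mul1r ler_pdivrMr// [leRHS]mulrC ler_pdivlMr ?ltr0n//.
  by apply: le_trans sX3; rewrite natrM; move: C%:R (C + k.+1)%:R s%:R; clear; move=> u v w; lra.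
Qed.

End Towers.

(** * Size of the derivatives on dyadic ranges *)

Section GrowthRates.
Variable R : realType.
Implicit Types (F : nat -> R -> R) (A x y X : R).

Lemma weyl_derivative_norm k eps Bq : 0 < eps <= 1 -> 1 <= Bq ->
  exists2 kap : R, 0 < kap & exists2 C0 : R, 0 < C0 &
  forall F X (a b : R) (a0 m : nat), 0 < a -> C0 <= X ->
  tower F k.+2 (3 * X / 4) ->
  (forall x, 3 * X / 4 <= x <= X -> 0 <= F k.+1 x) \/
  (forall x, 3 * X / 4 <= x <= X -> F k.+1 x <= 0) ->
  (forall x, 3 * X / 4 <= x <= X -> a / Bq <= `|F k.+1 x| <= Bq * a) ->
  (forall x, 3 * X / 4 <= x <= X -> `|F k.+2 x| <= Bq * a / X) ->
  3 * X / 4 <= a0%:R -> (a0 + 2 * m)%:R <= 15 * X / 16 -> X <= 32 * m%:R ->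
  `|b| * a <= kap -> C0 <= `|b| * a * X ^+ k.+1 ->
  avg_small (fun n => b * F 0%N n%:R) a0 m eps.
Proof.
move=> eps01 Bq1; have [kap kap0 [C0 C00 H]] := weyl_derivative k eps01 Bq1.
exists kap => //; exists C0 => // F X a b a0 m a_gt0 CX tF sF F1 F2 h1 h2 h3 hb hbX.
have b0 : 0 < `|b|.
  rewrite normr_gt0; apply/eqP => b0.
  by move: hbX; rewrite b0 normr0 !mul0r; move: C00; clear; lra.
have [G [tG G1 G2 GF]] : exists G, [/\ tower G k.+2 (3 * X / 4),
    forall x, 3 * X / 4 <= x <= X -> a / Bq <= G k.+1 x <= Bq * a,
    forall x, 3 * X / 4 <= x <= X -> `|G k.+2 x| <= Bq * a / X &
    G 0%N = F 0%N \/ G 0%N = (fun x => - F 0%N x)].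
  case: sF => sF.
    exists F; split=> // [x hx|]; last by left.
    by have := F1 x hx; rewrite ger0_norm// sF.
  exists (fun i x => - F i x); split=> [|x hx|x hx|]; last by right.
  - exact: towerN.
  - by have := F1 x hx; rewrite ler0_norm// sF.
  - by rewrite normrN F2.
have small := H G X a `|b| a0 m a_gt0 CX tG G1 G2 h1 h2 h3 b0 hb hbX.
case: GF => e; rewrite e in small; case: (ger0P b) small => _ small //;
  first [by apply: eq_avg_small small => n /=; ring
        | by apply: avg_smallN; apply: eq_avg_small small => n /=; ring].
Qed.

(* [d] is the last order for which the derivative [F d] does not tend to [0]. *)
Record growth F d A : Prop := Growth {
  growth_tower : tower F d.+2 A;
  growth_gt0 : 0 < A;
  growth_pos : forall i x, (i <= d)%N -> A <= x -> 0 < F i x;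
  growth_low : exists2 c : R, 0 < c & forall x, A <= x -> c <= F d x;
  growth_sign : (forall x, A <= x -> 0 <= F d.+1 x) \/ (forall x, A <= x -> F d.+1 x <= 0);
  growth_noninc1 : forall x y, A <= x -> x <= y -> `|F d.+1 y| <= `|F d.+1 x|;
  growth_noninc2 : forall x y, A <= x -> x <= y -> `|F d.+2 y| <= `|F d.+2 x|;
  growth_cvg0 : forall e : R, 0 < e -> exists B, forall x, B <= x -> `|F d.+1 x| <= e
}.

Lemma growth_mv F d A i x y : growth F d A -> (i < d.+2)%N -> A <= x -> x <= y ->
  exists2 z, x <= z <= y & F i y - F i x = F i.+1 z * (y - x).
Proof.
by move=> gF id Ax xy; apply: (@mean_value _ _ _ A) => // z Az; exact: (growth_tower gF).
Qed.

(** The next derivative has constant sign and nonincreasing modulus. If [F d] increases it is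
    concave, hence grows at most linearly, and [X - y <= 7 * (y - A)] for [y >= X / 4]. If it
    decreases it stays between a positive constant and [F d A]. *)
Lemma growth_comparable F d A : growth F d A -> exists2 B0 : R, 1 <= B0 & forall X, 8 * A <= X ->
  (forall y, A <= y <= X -> F d y <= B0 * F d X) /\
  (forall y, X / 4 <= y <= X -> F d X <= B0 * F d y).
Proof.
move=> gF; have A0 := growth_gt0 gF; have mv i x y := @growth_mv F d A i x y gF.
have [c c0 hc] := growth_low gF.
have pos x : A <= x -> 0 < F d x by apply: (growth_pos gF).
have FA0 : 0 < F d A / c by rewrite divr_gt0// pos.
exists (8 + F d A / c); first by move: FA0; clear; lra.
move=> X AX; have AX' : A <= X by move: A0 AX; clear; lra.
have big u v : 0 < v -> u <= 8 * v -> u <= (8 + F d A / c) * v.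
  by move=> v0 uv; have := mulr_gt0 FA0 v0; move: uv; clear; lra.
have FdX := pos X AX'.
case: (growth_sign gF) => sg.
- have mono x y : A <= x -> x <= y -> F d x <= F d y.
    move=> Ax xy; have [//|z /andP[xz _] e] := @mv d x y _ Ax xy.
    by rewrite -subr_ge0 e mulr_ge0 ?subr_ge0// sg// (le_trans Ax).
  split=> y /andP[y1 y2].
    apply: big => //; apply: (le_trans (mono y X y1 y2)).
    by move: FdX; clear; lra.
  have Ay : A <= y by move: A0 AX y1; clear; lra.
  apply: big; first exact: pos.
  have [//|z /andP[yz _] e] := @mv d y X _ Ay y2.
  have [//|w /andP[Aw wy] e'] := @mv d A y _ (lexx _) Ay.
  have h1 : F d.+1 z <= F d.+1 y.
    have := growth_noninc1 gF Ay yz; rewrite !ger0_norm//; apply: sg => //.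
    exact: le_trans yz.
  have h2 : F d.+1 y <= F d.+1 w.
    by have := growth_noninc1 gF Aw wy; rewrite !ger0_norm//; apply: sg.
  have h3 := sg _ Ay; have h4 := pos A (lexx _).
  have h5 : F d.+1 z * (X - y) <= F d.+1 y * (X - y) by rewrite ler_wpM2r// subr_ge0.
  have h6 : F d.+1 y * (y - A) <= F d.+1 w * (y - A) by rewrite ler_wpM2r// subr_ge0.
  have h7 : F d.+1 y * (X - y) <= F d.+1 y * (7 * (y - A)).
    by rewrite ler_wpM2l//; move: A0 AX y1; clear; lra.
  by move: h4 h5 h6 h7 e e' (pos y Ay); clear; lra.
- have mono x y : A <= x -> x <= y -> F d y <= F d x.
    move=> Ax xy; have [//|z /andP[xz _] e] := @mv d x y _ Ax xy.
    by rewrite -subr_le0 e mulr_le0_ge0 ?subr_ge0// sg// (le_trans Ax).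
  split=> y /andP[y1 y2].
    apply: (le_trans (mono A y (lexx _) y1)).
    have : F d A <= F d A / c * F d X.
      by rewrite mulrAC ler_pdivlMr// ler_pM2l ?pos// hc.
    by move: FdX; clear; lra.
  have Ay : A <= y by move: A0 AX y1; clear; lra.
  apply: big; first exact: pos.
  by have := mono y X Ay y2; have := pos y Ay; clear; lra.
Qed.

(** Integrate [i] times from [A]; the constants of integration are absorbed since [F d X] is bounded
    below and [X >= 1]. *)
Lemma growth_upper F d A i : growth F d A -> (i <= d)%N -> exists2 Ci : R, 0 < Ci & forall X x, 8 * A <= X -> 1 <= X ->
  A <= x <= X -> F (d - i)%N x <= Ci * (F d X * X ^+ i).
Proof.
move=> gF; have A0 := growth_gt0 gF; have mv i' x y := @growth_mv F d A i' x y gF.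
have [c c0 hc] := growth_low gF.
elim: i => [_|i IH id].
  have [B0 B01 hB] := growth_comparable gF; exists B0; first by move: B01; clear; lra.
  by move=> X x AX _ hx; rewrite subn0 expr0 mulr1; exact: (hB X AX).1.
have [Ci Ci0 {}IH] := IH (ltnW id).
set j := (d - i.+1)%N; have ji : (d - i = j.+1)%N by rewrite /j; move: id; clear; lia.
have FA0 : 0 < F j A by apply: (growth_pos gF) => //; rewrite /j leq_subr.
exists (Ci + F j A / c); first by rewrite addr_gt0// divr_gt0.
move=> X x AX X1 /andP[Ax xX].
have [|z /andP[Az zx] e] := @mv j A x _ (lexx _) Ax; first by rewrite /j; clear; lia.
have hz : F j.+1 z <= Ci * (F d X * X ^+ i).
  by rewrite -ji; apply: IH => //; rewrite Az (le_trans zx).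
have cX : c <= F d X by apply: hc; exact: le_trans xX.
have Xi : 1 <= X ^+ i.+1 by rewrite exprn_ege1.
have h1 : F j.+1 z * (x - A) <= Ci * (F d X * X ^+ i) * X.
  apply: (@le_trans _ _ (Ci * (F d X * X ^+ i) * (x - A))).
    by rewrite ler_wpM2r// subr_ge0.
  rewrite ler_wpM2l//; last by move: A0 xX; clear; lra.
  by rewrite !mulr_ge0 ?exprn_ge0//; move: Ci0 cX c0 X1; clear; lra.
have h2 : F j A <= F j A / c * (F d X * X ^+ i.+1).
  rewrite mulrAC ler_pdivlMr// ler_pM2l//.
  by apply: (le_trans cX); rewrite ler_peMr//; move: c0 cX; clear; lra.
have -> : F j x = F j A + F j.+1 z * (x - A) by rewrite -e addrC subrK.
by rewrite exprS; move: h1 h2; rewrite exprS; clear; lra.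
Qed.

(** Each integration runs over an interval of length [h * X] with [h = 1 / (4 (d + 1))] and gains a
    factor [X]. The admissible range shrinks by [h * X] each time and still contains [[3 X / 4, X]]
    after [d] of them. *)
Lemma growth_lower F d A i : growth F d A -> (i <= d)%N -> exists2 ci : R, 0 < ci & forall X x, 8 * A <= X ->
  (2^-1 + i%:R * (4 * d.+1%:R)^-1) * X <= x <= X -> ci * (F d X * X ^+ i) <= F (d - i)%N x.
Proof.
move=> gF; have A0 := growth_gt0 gF; have mv i' x y := @growth_mv F d A i' x y gF.
elim: i => [_|i IH id].
  have [B0 B01 hB] := growth_comparable gF.
  have B00 : 0 < B0 by move: B01; clear; lra.
  exists B0^-1; first by rewrite invr_gt0.
  move=> X x AX; rewrite mul0r addr0 subn0 expr0 mulr1 => /andP[x1 x2].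
  rewrite mulrC ler_pdivrMr// mulrC; apply: (hB X AX).2.
  by rewrite x2 andbT; move: x1 A0 AX; clear; lra.
have [ci ci0 {}IH] := IH (ltnW id).
set j := (d - i.+1)%N; have ji : (d - i = j.+1)%N by rewrite /j; move: id; clear; lia.
pose h : R := (4 * d.+1%:R)^-1.
have h0 : 0 < h by rewrite invr_gt0 mulr_gt0.
exists (ci * h); first by rewrite mulr_gt0.
move=> X x AX; rewrite -/h => /andP[x1 x2].
have X0 : 0 < X by move: A0 AX; clear; lra.
pose y := x - h * X.
have hX0 : 0 < h * X by rewrite mulr_gt0.
have y1 : (2^-1 + i%:R * h) * X <= y.
  by rewrite /y; move: x1; rewrite -natr1; clear; lra.
have yx : y <= x by rewrite /y; move: hX0; clear; lra.
have Ay : A <= y.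
  apply: le_trans y1; have : 0 <= i%:R * h * X by rewrite !mulr_ge0// ltW.
  by move: A0 AX; clear; lra.
have [|z /andP[yz zx] e] := @mv j y x _ Ay yx; first by rewrite /j; clear; lia.
have hz : ci * (F d X * X ^+ i) <= F j.+1 z.
  by rewrite -ji; apply: IH => //; rewrite (le_trans y1 yz) (le_trans zx).
have -> : F j x = F j y + F j.+1 z * (h * X).
  have <- : x - y = h * X by rewrite /y; ring.
  by rewrite -e addrC subrK.
have Fy : 0 < F j y by apply: (growth_pos gF) => //; rewrite /j leq_subr.
have := ler_wpM2r (ltW hX0) hz; rewrite exprS; move: Fy; clear; lra.
Qed.

Lemma growth_increments F d A : growth F d.+1 A -> exists c1 C1 : R, [/\ 0 < c1, 0 < C1 &
  forall X x, 8 * A <= X -> 1 <= X -> 3 * X / 4 <= x <= X ->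
  c1 * (F d.+1 X * X ^+ d) <= F 1%N x <= C1 * (F d.+1 X * X ^+ d)].
Proof.
move=> gF.
have [C1 C10 hC] := growth_upper gF (leqnSn d).
have [c1 c10 hc] := growth_lower gF (leqnSn d).
exists c1, C1; split => // X x AX X1 /andP[x1 x2].
have A0 := growth_gt0 gF.
have e : (d.+1 - d = 1)%N by rewrite subSnn.
rewrite e in hC hc; apply/andP; split.
  apply: hc => //; rewrite x2 andbT; apply: le_trans x1.
  have : d%:R * (4 * d.+2%:R)^-1 <= 4^-1 :> R.
    rewrite invfM mulrCA ler_piMr// ler_pdivrMr// mul1r ler_nat; clear; lia.
  move=> h; have X0 : 0 <= X by move: X1; clear; lra.
  by have := ler_wpM2r X0 h; move: (d%:R * _) => u; clear; lra.
by apply: hC => //; rewrite x2 andbT; move: A0 AX x1; clear; lra.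
Qed.

End GrowthRates.

(** * Equidistribution when the derivative of order d+1 is not dominated *)

Section FastGrowth.
Variable R : realType.
Implicit Types (F : nat -> R -> R) (A x y X : R).

(** The order of quantifiers matters: the [eps] required for the counting depends on [C1] and [C2],
    whereas [C3] may depend on [eps] and [R0]. *)
Definition equidistributed (alpha : R -> R) := exists C1 C2 : R, [/\ 0 < C1, 0 < C2 &
  forall eps R0 : R, 0 < eps <= 1 -> 0 < R0 -> exists2 C3 : R, 0 < C3 &
   forall A0 : R, exists a m : nat,
   let T := alpha (a + m)%:R - alpha a%:R in
   [/\ [/\ (0 < a)%N, 0 <= alpha a%:R, A0 <= m%:R, A0 <= T & m%:R <= C2 * T],
       forall n, (a <= n < a + m)%N ->
         0 <= alpha n.+1%:R - alpha n%:R <= C1 * T / m%:R &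
       forall b, C3 / T <= `|b| <= R0 -> avg_small (fun n => b * alpha n%:R) a m eps]].

(** The summation runs over about [X / 16] integers beginning near [3 X / 4]. Ending well before
    [X], it leaves room for the shifts made by differencing, and all derivatives are comparable to
    their values at [X]. *)
Lemma growth_window F d A : growth F d.+1 A -> exists C1 C2 K : R,
  [/\ 0 < C1, 0 < C2, 0 < K & forall A0 : R, exists X0 : R, forall X, X0 <= X ->
   exists a m : nat, let T := F 0%N (a + m)%:R - F 0%N a%:R in
   [/\ [/\ 3 * X / 4 <= a%:R, (a + 2 * m)%:R <= 15 * X / 16 & X <= 32 * m%:R],
       [/\ (0 < a)%N, 0 <= F 0%N a%:R, A0 <= m%:R, A0 <= T & m%:R <= C2 * T],
       forall n, (a <= n < a + m)%N ->
         0 <= F 0%N n.+1%:R - F 0%N n%:R <= C1 * T / m%:R &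
       0 < T <= K * (F d.+1 X * X ^+ d.+1)]].
Proof.
move=> gF; have A0 := growth_gt0 gF.
have [c1 [C1 [c10 C10 hF1]]] := growth_increments gF.
have [c c0 hc] := growth_low gF.
exists (C1 / c1), ((c1 * c)^-1), C1; split; rewrite ?divr_gt0 ?invr_gt0 ?mulr_gt0//.
move=> B; exists (64 + 8 * A + 32 * `|B| + 32 * (`|B| / (c1 * c))) => X hX.
have cc0 : 0 < c1 * c by rewrite mulr_gt0.
have B0 : 0 <= `|B| / (c1 * c) by rewrite divr_ge0// ltW.
have nB := normr_ge0 B.
have X64 : 64 <= X by move: hX A0 B0 nB; clear; lra.
have XA : 8 * A <= X by move: hX A0 B0 nB; clear; lra.
pose a := (Num.truncn (3 * X / 4)).+1.
pose m := Num.truncn (X / 16).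
have /truncn_itv/andP[a1 a2] : 0 <= 3 * X / 4 by move: X64; clear; lra.
have /truncn_itv/andP[m1 m2] : 0 <= X / 16 by move: X64; clear; lra.
have a3 : 3 * X / 4 <= a%:R by apply: ltW.
have a4 : a%:R <= 3 * X / 4 + 1 by rewrite /a -natr1; move: a1; clear; lra.
have m3 : m%:R <= X / 16 by [].
have m4 : X / 16 <= m%:R + 1 by rewrite natr1 ltW.
clearbody a m; clear a1 a2 m1 m2.
have m32 : X <= 32 * m%:R by move: m4 X64; clear; lra.
have m0 : 0 < m%:R :> R by move: m32 X64; clear; lra.
have aA : A <= a%:R by move: a3 XA A0; clear; lra.
have am : (a + m)%:R <= X by rewrite natrD; move: a4 m3 X64; clear; lra.
have X1 : 1 <= X by move: X64; clear; lra.
have mvF x y : A <= x -> x <= y -> exists2 z, x <= z <= y & F 0%N y - F 0%N x = F 1%N z * (y - x).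
  by move=> Ax xy; exact: (growth_mv gF).
set V := F d.+1 X * X ^+ d.
have V0 : c <= V.
  have Fc : c <= F d.+1 X by apply: hc; move: XA A0; clear; lra.
  by apply: (le_trans Fc); rewrite /V ler_peMr ?exprn_ege1// (le_trans (ltW c0)).
exists a, m => T.
have [z hz Tz] : exists2 z, a%:R <= z <= (a + m)%:R & T = F 1%N z * m%:R.
  have [|z hz e] := mvF a%:R (a + m)%:R aA; first by rewrite ler_nat leq_addr.
  by exists z => //; rewrite /T e natrD addrAC subrr add0r.
have /andP[z1 z2] := hz.
have /andP[T1 T2] : c1 * V <= F 1%N z <= C1 * V.
  by apply: hF1 => //; rewrite (le_trans a3 z1) (le_trans z2 am).
have Tl : c1 * V * m%:R <= T by rewrite Tz ler_pM2r.
have Tu : T <= C1 * V * m%:R by rewrite Tz ler_pM2r.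
have Tcm : c1 * c * m%:R <= T.
  by apply: le_trans Tl; rewrite ler_pM2r// ler_pM2l.
split.
- split=> //; rewrite natrD natrM; move: a4 m3 X64; clear; lra.
- have mB : 64 + 8 * A + 32 * `|B| + 32 * (`|B| / (c1 * c)) <= 32 * m%:R by exact: le_trans m32.
  split.
  + by rewrite -(ltr0n R); move: aA A0; clear; lra.
  + by apply/ltW/(growth_pos gF).
  + by have := ler_norm B; move: mB A0 B0 nB; clear; lra.
  + apply: le_trans Tcm; apply: (le_trans (ler_norm B)).
    rewrite mulrC -ler_pdivrMr//; move: mB A0 B0 nB; clear; lra.
  + by rewrite mulrC ler_pdivlMr// mulrC.
- move=> n /andP[n1 n2].
  have An : A <= n%:R by apply: (le_trans aA); rewrite ler_nat.
  have nn : n%:R <= n.+1%:R :> R by rewrite ler_nat.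
  have [w /andP[w1 w2] ->] := mvF n%:R n.+1%:R An nn.
  rewrite -[n.+1%:R]natr1 addrAC subrr add0r mulr1.
  have /andP[f1 f2] : c1 * V <= F 1%N w <= C1 * V.
    apply: hF1 => //; rewrite (le_trans a3)/=; last by apply: le_trans w1; rewrite ler_nat.
    by apply: (le_trans w2); apply: le_trans am; rewrite ler_nat.
  have cV : 0 <= c1 * V by rewrite mulr_ge0 ?(ltW c10)// (le_trans (ltW c0)).
  rewrite (le_trans cV f1)/= (le_trans f2)// ler_pdivlMr//.
  have -> : C1 * V * m%:R = C1 / c1 * (c1 * V * m%:R) by field; rewrite gt_eqF.
  by rewrite ler_pM2l// divr_gt0.
- rewrite (lt_le_trans _ Tcm) ?mulr_gt0//=; apply: (le_trans Tu).
  have -> : C1 * (F d.+1 X * X ^+ d.+1) = C1 * V * X by rewrite /V exprS; ring.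
  have CV : 0 < C1 * V by rewrite mulr_gt0// (lt_le_trans c0).
  rewrite ler_pM2l//.
  by move: m3 X64; clear; lra.
Qed.

(** While [|b| * F d.+1 X] is at most a small constant, [d + 1] differences work, and
    [C3 / T <= |b|] ensures that the window is long enough. Above it one more difference is taken:
    [|b| * |F d.+2 X|] is small because [F d.+2] tends to 0 and [|b| <= R0], while the hypothesis
    bounds [|b| * |F d.+2 X| * X ^ d.+2] from below. The comparison between [X / 4] and [X] makes
    [F d.+2] of constant size on the window. The two ranges overlap, so one such [X] serves all
    frequencies. *)
Lemma equidistributed_fast F d A : growth F d.+1 A ->
  (forall C B : R, exists X, [/\ B <= X, C * F d.+1 X < X ^+ d.+2 * `|F d.+2 X| &
     `|F d.+2 (X / 4)| <= 4 ^+ d.+2 * `|F d.+2 X|]) ->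
  equidistributed (F 0%N).
Proof.
move=> gF fast; have A0 := growth_gt0 gF.
have [C1 [C2 [K [C10 C20 K0 win]]]] := growth_window gF.
exists C1, C2; split => // eps R0 eps01 R00.
have [B0 B01 hB] := growth_comparable gF.
have Bq1 : 1 <= 4 * B0 by move: B01; clear; lra.
have p41 : 1 <= 4 ^+ d.+3 :> R by rewrite exprn_ege1//; clear; lra.
have [kap kap0 [C0 C00 kill1]] := weyl_derivative_norm d eps01 Bq1.
have [kap' kap'0 [C0' C0'0 kill2]] := weyl_derivative_norm d.+1 eps01 p41.
exists (C0 * K); first by rewrite mulr_gt0.
move=> B; have [X0 hX0] := win B.
have kR : 0 < kap' / R0 by rewrite divr_gt0.
have [B1 hB1] := growth_cvg0 gF kR.
have CC : 0 < C0' / kap by rewrite divr_gt0.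
have [X [XB gX dX]] := fast (C0' / kap) (16 * A + `|X0| + `|B1| + C0 + C0' + 1).
have XX0 : X0 <= X by have := ler_norm X0; have := normr_ge0 B1; move: XB A0 C00 C0'0; clear; lra.
have XB1 : B1 <= X by have := ler_norm B1; have := normr_ge0 X0; move: XB A0 C00 C0'0; clear; lra.
have [nX0 nB1] := (normr_ge0 X0, normr_ge0 B1).
have XC0 : C0 <= X by move: XB A0 C00 C0'0 nX0 nB1; clear; lra.
have XC0' : C0' <= X by move: XB A0 C00 C0'0 nX0 nB1; clear; lra.
have XA : 16 * A <= X by move: XB A0 C00 C0'0 nX0 nB1; clear; lra.
have X1 : 1 <= X by move: XB A0 C00 C0'0 nX0 nB1; clear; lra.
have X00 : 0 < X by move: X1; clear; lra.
have [a [m [[w1 w2 w3] basics steps /andP[T0 TK]]]] := hX0 X XX0.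
exists a, m => T; split => // b /andP[b1 b2].
have XA8 : 8 * A <= X by move: XA A0; clear; lra.
have [hBu hBl] := hB X XA8.
have AX : A <= X by move: XA A0; clear; lra.
set ax := F d.+1 X.
have ax0 : 0 < ax by apply: (growth_pos gF).
have bT : C0 <= `|b| * ax * X ^+ d.+1.
  have : C0 * K <= `|b| * T by rewrite -ler_pdivrMr.
  move=> h; have : C0 * K <= `|b| * (K * (ax * X ^+ d.+1)).
    by apply: (le_trans h); rewrite ler_wpM2l.
  rewrite (_ : `|b| * (K * (ax * X ^+ d.+1)) = (`|b| * ax * X ^+ d.+1) * K); last by ring.
  by rewrite ler_pM2r.
have A34 : A <= 3 * X / 4 by move: XA A0; clear; lra.
case: (leP (`|b| * ax) kap) => hb.
  apply: (kill1 F X ax) => //.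
  - by apply: tower_le (growth_tower gF).
  - by left=> x /andP[x1 _]; apply/ltW/(growth_pos gF) => //; exact: le_trans x1.
  - move=> x /andP[x1 x2].
    have x0 : 0 < F d.+1 x by apply: (growth_pos gF) => //; exact: le_trans x1.
    rewrite ger0_norm; last exact: ltW.
    have l1 : F d.+1 x <= B0 * ax by apply: hBu; rewrite x2 (le_trans A34).
    have l2 : ax <= B0 * F d.+1 x by apply: hBl; rewrite x2 andbT; move: x1 X00; clear; lra.
    apply/andP; split; last by have := mulr_gt0 (lt_le_trans ltr01 B01) ax0; move: l1; clear; lra.
    rewrite ler_pdivrMr; last by move: B01; clear; lra.
    have := mulr_gt0 (lt_le_trans ltr01 B01) x0; move: l2; clear; lra.
  - move=> x /andP[x1 x2].
    (* The mean value theorem on [[x - X / 4, x]] bounds [F d.+2] at an earlier point, and its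
       modulus does not increase. *)
    have y1 : A <= x - X / 4 by move: x1 XA A0; clear; lra.
    have y2 : x - X / 4 <= x by move: X00; clear; lra.
    have [//|z /andP[z1 z2] e] := @growth_mv _ F d.+1 A d.+1 _ _ gF _ y1 y2.
    have n1 := growth_noninc1 gF (le_trans y1 z1) z2.
    have l1 : F d.+1 x <= B0 * ax by apply: hBu; rewrite x2 (le_trans A34).
    have l2 : F d.+1 (x - X / 4) <= B0 * ax by apply: hBu; rewrite y1 (le_trans y2).
    have p1 : 0 < F d.+1 x by apply: (growth_pos gF) => //; exact: le_trans x1.
    have p2 : 0 < F d.+1 (x - X / 4) by apply: (growth_pos gF).
    have : `|F d.+2 z| * (X / 4) <= B0 * ax.
      have -> : `|F d.+2 z| * (X / 4) = `|F d.+1 x - F d.+1 (x - X / 4)|.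
        rewrite e normrM [X in _ * `|X|](_ : _ = X / 4); last by ring.
        by rewrite [`|X / 4|]ger0_norm// divr_ge0// ltW.
      by rewrite ler_norml; move: l1 l2 p1 p2; clear; lra.
    have X40 : 0 <= X / 4 by move: X00; clear; lra.
    have := ler_wpM2r X40 n1.
    by rewrite ler_pdivlMr//; clear; lra.
set ay := `|F d.+2 X| in gX dX.
have ay0 : 0 < ay.
  have : 0 < X ^+ d.+2 * ay by apply: lt_trans gX; rewrite mulr_gt0.
  by rewrite pmulr_rgt0// exprn_gt0.
have bay : `|b| * ay <= kap'.
  have h1 : ay <= kap' / R0 by apply: hB1.
  apply: (@le_trans _ _ (R0 * (kap' / R0))); first by rewrite ler_pM// ltW.
  by rewrite mulrCA divff ?mulr1// gt_eqF.
have bayX : C0' <= `|b| * ay * X ^+ d.+2.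
  have h1 : C0' / kap * (ax * `|b|) <= X ^+ d.+2 * ay * `|b|.
    by rewrite mulrA ler_wpM2r// ltW.
  have h2 : C0' <= C0' / kap * (ax * `|b|).
    by rewrite -mulrA ler_peMr ?(ltW C0'0)// mulrC ler_pdivlMr// mul1r mulrC ltW.
  by apply: (le_trans h2); apply: (le_trans h1); move: (X ^+ d.+2) => v; clear; lra.
have A4 : A <= X / 4 by move: XA A0; clear; lra.
have up x : X / 4 <= x -> `|F d.+2 x| <= 4 ^+ d.+2 * ay.
  by move=> hx; apply: le_trans dX; apply: (growth_noninc1 gF).
apply: (kill2 F X ay) => //.
- by apply: tower_le (growth_tower gF).
- case: (growth_sign gF) => sg; [left|right] => x /andP[x1 _]; apply: sg; exact: le_trans x1.
- move=> x /andP[x1 x2].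
  have Ax : A <= x by exact: le_trans x1.
  have l1 : ay <= `|F d.+2 x| by apply: (growth_noninc1 gF).
  have l2 : `|F d.+2 x| <= 4 ^+ d.+2 * ay by apply: up; move: x1 X00; clear; lra.
  apply/andP; split.
    have p40 : 0 < 4 ^+ d.+3 :> R by apply: lt_le_trans p41.
    by apply: le_trans l1; rewrite ler_pdivrMr// ler_peMr// ltW.
  apply: (le_trans l2); rewrite ler_pM2r// [leRHS]exprS ler_peMl ?exprn_ge0//.
  by clear; lra.
- move=> x /andP[x1 x2].
  have y1 : A <= x - X / 4 by move: x1 XA A0; clear; lra.
  have y2 : x - X / 4 <= x by move: X00; clear; lra.
  have [//|z /andP[z1 z2] e] := @growth_mv _ F d.+1 A d.+2 _ _ gF _ y1 y2.
  have n1 := growth_noninc2 gF (le_trans y1 z1) z2.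
  have u1 : `|F d.+2 (x - X / 4)| <= 4 ^+ d.+2 * ay by apply: up; move: x1 X00; clear; lra.
  have u2 : `|F d.+2 x| <= `|F d.+2 (x - X / 4)| by apply: (growth_noninc1 gF).
  have : `|F d.+3 z| * (X / 4) <= 4 ^+ d.+2 * ay.
    have -> : `|F d.+3 z| * (X / 4) = `|F d.+2 x - F d.+2 (x - X / 4)|.
      rewrite e normrM [X in _ * `|X|](_ : _ = X / 4); last by ring.
      by rewrite [`|X / 4|]ger0_norm// divr_ge0// ltW.
    apply: le_trans u1; move: u2.
    case: (growth_sign gF) => sg.
      have s1 := sg x (le_trans y1 y2); have s2 := sg _ y1.
      by rewrite (ger0_norm s1) (ger0_norm s2) ler_norml; move: s1 s2; clear; lra.
    have s1 := sg x (le_trans y1 y2); have s2 := sg _ y1.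
    by rewrite (ler0_norm s1) (ler0_norm s2) ler_norml; move: s1 s2; clear; lra.
  have X40 : 0 <= X / 4 by move: X00; clear; lra.
  have := ler_wpM2r X40 n1.
  by rewrite ler_pdivlMr// (exprS 4 d.+2); move: (4 ^+ d.+2) => v; clear; lra.
Qed.

End FastGrowth.

(** * Polynomials up to a slowly varying error *)

Section LeadingCoefficient.
Variable R : realType.
Implicit Types (x y L E eta beta : R).

Lemma dirichlet (Q : nat) x : (0 < Q)%N ->
  exists (D : nat) (b : int), (0 < D <= Q)%N /\ `|D%:R * x - b%:~R| <= Q%:R^-1.
Proof.
move=> Q0; have Q0' : 0 < Q%:R :> R by rewrite ltr0n.
pose fr (i : nat) : R := i%:R * x - (Num.floor (i%:R * x))%:~R.
have fr01 i : 0 <= fr i < 1.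
  have := floor_itv (i%:R * x); rewrite /fr intrD => /andP[h1 h2].
  by apply/andP; split; move: h1 h2; clear; lra.
have lt i : (Num.truncn (Q%:R * fr i) < Q)%N.
  have /andP[h1 h2] := fr01 i.
  have /truncn_itv/andP[h3 _] : 0 <= Q%:R * fr i by rewrite mulr_ge0.
  by rewrite -(ltr_nat R); apply: (le_lt_trans h3); rewrite -[ltRHS]mulr1 ltr_pM2l.
pose f (i : 'I_Q.+1) : 'I_Q := Ordinal (lt i).
have ninj : ~ injective f by move=> /leq_card; rewrite !card_ord ltnn.
have [i [j [ij e]]] : exists i j : 'I_Q.+1, (i < j)%N /\ f i = f j.
  apply: contrapT => h; apply: ninj => i j e; apply/val_inj => /=.
  by case: (ltngtP i j) => // lij; exfalso; apply: h; [exists i, j|exists j, i].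
exists (j - i)%N, (Num.floor (j%:R * x) - Num.floor (i%:R * x)); split.
  by rewrite subn_gt0 ij/= (leq_trans (leq_subr _ _))// -ltnS.
have {}e : Num.truncn (Q%:R * fr i) = Num.truncn (Q%:R * fr j) by case: e.
have [/andP[i0 i1] /andP[j0 j1]] := (fr01 i, fr01 j).
have /truncn_itv/andP[h1 h2] : 0 <= Q%:R * fr i by rewrite mulr_ge0.
have /truncn_itv/andP[h3 h4] : 0 <= Q%:R * fr j by rewrite mulr_ge0.
have -> : (j - i)%N%:R * x - (Num.floor (j%:R * x) - Num.floor (i%:R * x))%:~R = fr j - fr i.
  by rewrite natrB ?(ltnW ij)// intrB /fr; ring.
have : `|Q%:R * (fr j - fr i)| <= 1.
  by rewrite mulrBr ler_norml; move: h1 h2 h3 h4; rewrite -e -natr1; clear; lra.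
by rewrite normrM [`|Q%:R|]ger0_norm// -[_^-1]mul1r ler_pdivlMr// mulrC.
Qed.

(** Approximate [beta * L] by [b / D]. If the error [del] of [D * beta * L] is not tiny, differences
    with steps [D, 1, ..., 1] have a phase near [del] modulo 1. Otherwise equal steps [D * s] give
    the phase [del * D^d * s^(d+1)] modulo 1, and a suitable [s] brings it to a constant size,
    unless this needs an [s] comparable to [a]; then [beta * L] is within [O(a^-(d+1))] of [b / D].
    The bound [Q] on the denominators depends only on [d] and [eps], not on [L]. *)
Lemma leading_coefficient d eps : 0 < eps <= 1 -> exists2 Q : nat, (0 < Q)%N &
  forall L E eta R0 : R, 0 <= E -> 0 < eta -> 0 < R0 -> exists C X0 : R, 0 < C /\
  forall (f : nat -> R) (a m : nat) beta, X0 <= a%:R -> eta * a%:R <= m%:R -> `|beta| <= R0 ->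
  (forall ss n, size ss = d.+1 -> (a <= n)%N ->
    `|diffs ss f n - L * \prod_(s <- ss) s%:R| <= E * (\prod_(s <- ss) s%:R) / a%:R ^+ d.+1) ->
  avg_small (fun n => beta * f n) a m eps \/
  exists (D : nat) (b : int), (0 < D <= Q)%N /\ `|beta * L - b%:~R / D%:R| <= C / a%:R ^+ d.+1.
Proof.
move=> eps01; have [kap /andP[kap0 kap2] hW] := weyl d eps01.
have [Q hQ] := nat_ge (4 / kap).
have Q0' : 0 < Q%:R :> R by apply: lt_le_trans hQ; rewrite divr_gt0.
have Q0 : (0 < Q)%N by rewrite -(ltr0n R).
have Q1 : 1 <= Q%:R :> R by rewrite ler1n.
have Qkap : Q%:R^-1 <= kap / 4.
  have : 4 <= Q%:R * kap by rewrite -ler_pdivrMr.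
  rewrite -[Q%:R^-1]mul1r ler_pdivrMr//; clear; lra.
exists Q => // L E eta R0 E0 eta0 R00.
have Qd0 : 0 < Q%:R ^+ d :> R by rewrite exprn_gt0.
have Qd1 : 1 <= Q%:R ^+ d :> R by rewrite exprn_ege1.
pose kapa := kap / 4 / Q%:R ^+ d.
have kapa0 : 0 < kapa by rewrite !divr_gt0.
have kapa4 : kapa <= kap / 4 by rewrite ler_pdivrMr// ler_peMr// divr_ge0// ltW.
have kapa2 : 0 < kapa / 2 <= kap by move: kapa0 kapa4; clear; lra.
have [Ca Ca0 hWa] := hW _ kapa2.
have p2 : 0 < 2 ^+ d.+1 :> R by rewrite exprn_gt0.
have p21 : 1 <= 2 ^+ d.+1 :> R by rewrite exprn_ege1//; clear; lra.
pose kapb := kap / 8 / 2 ^+ d.+1.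
have kapb0 : 0 < kapb by rewrite !divr_gt0.
have kapb8 : kapb <= kap / 8 by rewrite ler_pdivrMr// ler_peMr// divr_ge0// ltW.
have kapbK : kapb <= kap by move: kapb8 kap0; clear; lra.
have kapb2 : 0 < kapb <= kap by rewrite kapb0.
have [Cb Cb0 hWb] := hW _ kapb2.
have Ca0' : 0 < Ca%:R :> R by rewrite ltr0n.
have Cb0' : 0 < Cb%:R :> R by rewrite ltr0n.
have Cb1' : 1 <= Cb%:R :> R by rewrite ler1n.
have Ca1' : 1 <= Ca%:R :> R by rewrite ler1n.
pose ta := kapa / (2 * Ca%:R).
pose tb := kapb / (2 * Cb%:R).
have t_le (u v : R) : 0 < u -> u <= 1 -> 1 <= v ->
    [/\ 0 < u / (2 * v), u / (2 * v) <= u / 2 & u / (2 * v) <= v^-1 / 2].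
  move=> u0 u1 v1; have v0 : 0 < v by move: v1; clear; lra.
  have vi : v^-1 <= 1 by rewrite invf_le1.
  have vi0 : 0 < v^-1 by rewrite invr_gt0.
  rewrite invfM; have -> : u * (2^-1 / v) = u * v^-1 / 2 by ring.
  have h1 : u * v^-1 <= u by rewrite ler_piMr// ltW.
  have h2 : u * v^-1 <= v^-1 by rewrite ler_piMl// ltW.
  have h3 : 0 < u * v^-1 by rewrite mulr_gt0.
  by move: h1 h2 h3; clear; split; lra.
have [|ta0 ta1 ta2] := t_le kapa Ca%:R kapa0 _ Ca1'.
  by move: kapa4 kap0 kap2; clear; lra.
have [|tb0 tb1 tb2] := t_le kapb Cb%:R kapb0 _ Cb1'.
  by move: kapbK kap0 kap2; clear; lra.
rewrite -/ta in ta0 ta1 ta2; rewrite -/tb in tb0 tb1 tb2.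
have [Cc hCc] := nat_ge (R0 * E * Q%:R ^+ d.+1 / tb + Cb%:R * Q%:R / eta + 1).
have RE0 : 0 <= R0 * E by rewrite mulr_ge0// ltW.
have w1 : 0 <= R0 * E * Q%:R ^+ d.+1 / tb.
  by rewrite divr_ge0 ?(ltW tb0)// mulr_ge0// exprn_ge0.
have w2 : 0 <= Cb%:R * Q%:R / eta by rewrite divr_ge0 ?mulr_ge0// ltW.
have Cc1 : 1 <= Cc%:R :> R by move: hCc w1 w2; clear; lra.
have Cc0 : 0 < Cc%:R :> R by move: Cc1; clear; lra.
have Cctb : R0 * E * Q%:R ^+ d.+1 <= Cc%:R * tb.
  by rewrite -ler_pdivrMr//; move: hCc w2; clear; lra.
have Cceta : Cb%:R * Q%:R <= Cc%:R * eta.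
  by rewrite -ler_pdivrMr//; move: hCc w1; clear; lra.
pose C := kap / 2 * Cc%:R ^+ d.+1 + 1.
have C0 : 0 < C by rewrite addr_gt0// mulr_gt0 ?exprn_gt0// divr_gt0.
exists C, (R0 * E * Q%:R / ta + Ca%:R * Q%:R / eta + 1); split => // f a m beta ha hm.
have w3 : 0 <= R0 * E * Q%:R / ta by rewrite divr_ge0 ?(ltW ta0)// mulr_ge0.
have w4 : 0 <= Ca%:R * Q%:R / eta by rewrite divr_ge0 ?mulr_ge0// ltW.
have a1 : 1 <= a%:R :> R by move: ha w3 w4; clear; lra.
have a0 : 0 < a%:R :> R by move: a1; clear; lra.
have ata : R0 * E * Q%:R <= a%:R * ta by rewrite -ler_pdivrMr//; move: ha w4; clear; lra.
have aeta : Ca%:R * Q%:R <= a%:R * eta by rewrite -ler_pdivrMr//; move: ha w3; clear; lra.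
move=> hb hf.
have [D [b [/andP[D0 DQ] hDb]]] := dirichlet (beta * L) Q0.
wlog del0 : beta b hb hDb / 0 <= D%:R * (beta * L) - b%:~R.
  move=> H; case: (leP 0 (D%:R * (beta * L) - b%:~R)) => [|/ltW] s; first exact: (H beta b).
  have [|||small|[D' [b' [hD' hb']]]] := H (- beta) (- b).
  - by rewrite normrN.
  - by rewrite mulNr mulrN intrN -opprB opprK normrN addrC.
  - by rewrite mulNr mulrN intrN; move: s; clear; lra.
  - by left; apply: avg_smallN; apply: eq_avg_small small => n; rewrite mulNr.
  - right; exists D', (- b'); split => //; move: hb'; congr (_ <= _).
    by rewrite -normrN; congr (`|_|); rewrite intrN; ring.
set del := D%:R * (beta * L) - b%:~R in hDb del0.
have D0' : 0 < D%:R :> R by rewrite ltr0n.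
have D1' : 1 <= D%:R :> R by rewrite ler1n.
have DQ' : D%:R <= Q%:R :> R by rewrite ler_nat.
have del1 : del <= kap / 4 by apply: le_trans Qkap; rewrite -[X in X <= _]ger0_norm.
have ad1 : a%:R <= a%:R ^+ d.+1 :> R by rewrite exprS ler_peMr ?exprn_ege1// ltW.
have ad0 : 0 < a%:R ^+ d.+1 :> R by rewrite exprn_gt0.
have bf ss n : size ss = d.+1 -> (a <= n)%N ->
    `|diffs ss (fun i => beta * f i) n - beta * L * \prod_(s <- ss) s%:R|
       <= R0 * E * (\prod_(s <- ss) s%:R) / a%:R ^+ d.+1.
  move=> hs hn; rewrite diffsZ -mulrA -mulrBr normrM.
  have -> : R0 * E * (\prod_(s <- ss) s%:R) / a%:R ^+ d.+1
    = R0 * (E * (\prod_(s <- ss) s%:R) / a%:R ^+ d.+1) by ring.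
  by apply: ler_pM => //; exact: hf.
have int1 (u v w : R) : u \is a Num.int -> v - (w - u) - u = v - w by move=> _; ring.
case: (leP kapa del) => hdel.
  left; pose ss := D :: nseq d 1%N.
  have ssE : \prod_(s <- ss) s%:R = D%:R :> R by rewrite big_cons prod_nseq expr1n mulr1.
  have err n : (a <= n)%N -> `|diffs ss (fun i => beta * f i) n - b%:~R - del| <= ta.
    move=> an; have := bf ss n; rewrite /= size_nseq => /(_ erefl an).
    have -> : diffs (nseq d 1%N) (fun i => beta * f (i + D)%N - beta * f i) n
      = diffs ss (fun i => beta * f i) n by [].
    rewrite ssE => h.
    have -> : diffs ss (fun i => beta * f i) n - b%:~R - del =
       diffs ss (fun i => beta * f i) n - beta * L * D%:R by rewrite /del; ring.
    apply: (le_trans h); rewrite ler_pdivrMr//.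
    apply: (@le_trans _ _ (a%:R * ta)); last by rewrite mulrC ler_pM2l.
    by apply: le_trans ata; rewrite ler_wpM2l.
  apply: (hWa ss Q _ a m (fun n => diffs ss (fun i => beta * f i) n - b%:~R)).
  - by rewrite /= size_nseq.
  - by rewrite /= D0 DQ; apply/allP => s /nseqP[-> _].
  - by rewrite -(ler_nat R) natrM (le_trans aeta)// mulrC.
  - move=> n /andP[an _]; split; first by rewrite opprB addrC subrK intr_int.
    have := err n an; rewrite ler_norml; move: ta1 hdel del1 kapa4 kap0; clear; lra.
  - move=> n n' an /andP[nn' _] _.
    have := err n an; have := err n' (leq_trans an nn').
    rewrite !ler_norml; move: ta2; clear; lra.
pose u := del * D%:R ^+ d.
have Dd0 : 0 < D%:R ^+ d :> R by rewrite exprn_gt0.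
have u4 : u <= kap / 4.
  apply: (@le_trans _ _ (kapa * Q%:R ^+ d)); last by rewrite divfK ?gt_eqF.
  have DQd : D%:R ^+ d <= Q%:R ^+ d :> R by apply: lerXn2r; rewrite ?nnegrE.
  by rewrite /u ler_pM// ltW.
(* The borderline case: here no step that is short compared with [a] would make the phase large
   enough. *)
case: (leP (u * a%:R ^+ d.+1) (kap / 2 * Cc%:R ^+ d.+1)) => hu.
  right; exists D, b; split; first by rewrite D0.
  have -> : beta * L - b%:~R / D%:R = del / D%:R by rewrite /del; field; rewrite gt_eqF.
  rewrite ger0_norm; last by rewrite divr_ge0// ltW.
  rewrite ler_pdivlMr//; apply: (@le_trans _ _ (u * a%:R ^+ d.+1)).
    rewrite ler_wpM2r// ?(ltW ad0)// /u; apply: ler_wpM2l => //.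
    apply: (@le_trans _ _ 1); first by rewrite invf_le1.
    by rewrite exprn_ege1.
  by rewrite /C; move: hu; clear; lra.
left; have u0 : 0 < u.
  have : 0 < u * a%:R ^+ d.+1.
    by apply: le_lt_trans hu; rewrite mulr_ge0 ?exprn_ge0// divr_ge0// ltW.
  by rewrite pmulr_lgt0.
have [|s s0 /andP[s1 s2]] := @max_power R d.+1 (kap / 2 / u) isT.
  by rewrite ler_pdivlMr// mul1r; move: u4 kap0; clear; lra.
have {}s1 : u * s%:R ^+ d.+1 <= kap / 2 by rewrite mulrC -ler_pdivlMr.
have {}s2 : kap / 2 / 2 ^+ d.+1 <= u * s%:R ^+ d.+1.
  rewrite ler_pdivrMr// -mulrA -exprMn [leRHS]mulrC -ler_pdivrMr//; apply: (le_trans (ltW s2)).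
  apply: lerXn2r; rewrite ?nnegrE//.
  by rewrite -natrM ler_nat; move: s0; clear; lia.
have sCc : s%:R * Cc%:R <= a%:R :> R by exact: (@scale_le R d.+1 u (kap / 2) Cc%:R a%:R s isT u0 Cc0 a0 s1 hu).
pose ss := nseq d.+1 (D * s)%N.
have ssE : \prod_(s <- ss) s%:R = D%:R ^+ d.+1 * s%:R ^+ d.+1 :> R.
  by rewrite prod_nseq natrM exprMn.
pose zb := b%:~R * D%:R ^+ d * s%:R ^+ d.+1 : R.
have zbi : zb \is a Num.int by rewrite !rpredM ?rpredX ?intr_int ?natr_int.
have err n : (a <= n)%N -> `|diffs ss (fun i => beta * f i) n - zb - u * s%:R ^+ d.+1| <= tb.
  move=> an; have := bf ss n; rewrite size_nseq => /(_ erefl an).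
  rewrite ssE => h.
  have -> : diffs ss (fun i => beta * f i) n - zb - u * s%:R ^+ d.+1 =
     diffs ss (fun i => beta * f i) n - beta * L * (D%:R ^+ d.+1 * s%:R ^+ d.+1).
    by rewrite /zb /u /del (exprS D%:R d); ring.
  apply: (le_trans h); rewrite ler_pdivrMr//.
  have sc : s%:R ^+ d.+1 * Cc%:R <= a%:R ^+ d.+1 :> R.
    apply: (@le_trans _ _ ((s%:R * Cc%:R) ^+ d.+1)).
      rewrite exprMn ler_wpM2l ?exprn_ge0//.
      by rewrite exprS ler_peMr ?exprn_ege1// ltW.
    by apply: lerXn2r; rewrite ?nnegrE// ?mulr_ge0// ltW.
  have dq : D%:R ^+ d.+1 <= Q%:R ^+ d.+1 :> R by apply: lerXn2r; rewrite ?nnegrE.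
  apply: (@le_trans _ _ (tb * (s%:R ^+ d.+1 * Cc%:R))); last by rewrite ler_pM2l.
  apply: (@le_trans _ _ (R0 * E * Q%:R ^+ d.+1 * s%:R ^+ d.+1)).
    by rewrite mulrA ler_wpM2r ?exprn_ge0// ler_wpM2l.
  have -> : tb * (s%:R ^+ d.+1 * Cc%:R) = Cc%:R * tb * s%:R ^+ d.+1 by ring.
  by rewrite ler_wpM2r ?exprn_ge0.
have kb : kapb = kap / 2 / 2 ^+ d.+1 / 4 by rewrite /kapb; field; rewrite gt_eqF.
apply: (hWb ss (D * s)%N _ a m (fun n => diffs ss (fun i => beta * f i) n - zb)).
- by rewrite size_nseq.
- by apply/allP => t /nseqP[-> _]; rewrite muln_gt0 D0 s0 leqnn.
- rewrite -(ler_nat R) !natrM; apply: le_trans hm.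
  apply: (@le_trans _ _ (eta * (s%:R * Cc%:R))); last by rewrite ler_pM2l.
  have -> : Cb%:R * (D%:R * s%:R) = Cb%:R * D%:R * s%:R :> R by ring.
  have -> : eta * (s%:R * Cc%:R) = Cc%:R * eta * s%:R :> R by ring.
  rewrite ler_wpM2r//; apply: le_trans Cceta; by rewrite ler_pM2l.
- move=> n /andP[an _]; split; first by rewrite opprB addrC subrK.
  have := err n an; rewrite ler_norml; move: tb1 s1 s2 kapb8 kb kapb0 kap0; clear.
  by move: (u * s%:R ^+ d.+1) (kap / 2 / 2 ^+ d.+1) => v w; lra.
- move=> n n' an /andP[nn' _] _.
  have := err n an; have := err n' (leq_trans an nn').
  rewrite !ler_norml; move: tb2; clear; lra.
Qed.

End LeadingCoefficient.

(** * Equidistribution when the coefficients have an irrational ratio *)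

Section IrrationalRatio.
Variable R : realType.
Implicit Types (F : nat -> R -> R) (P : {poly R}) (A x y X : R).

Definition rational x := exists2 q : nat, (0 < q)%N & q%:R * x \is a Num.int.

Lemma rationalZ (x : R) (b : int) (D : nat) : (0 < D)%N -> rational x -> rational (b%:~R / D%:R * x).
Proof.
move=> D0 [q q0 hq]; exists (q * D)%N; first by rewrite muln_gt0 q0.
have D0' : D%:R != 0 :> R by rewrite pnatr_eq0 -lt0n.
have -> : (q * D)%:R * (b%:~R / D%:R * x) = b%:~R * (q%:R * x) by rewrite natrM; field.
by rewrite rpredM// intr_int.
Qed.

Lemma rational_divl (x : R) (b : int) (D : nat) : (0 < D)%N -> b != 0 ->
  rational (b%:~R / D%:R * x) -> rational x.
Proof.
move=> D0 b0 [q q0 hq]; exists (q * `|b|)%N; first by rewrite muln_gt0 q0 absz_gt0.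
have D0' : D%:R != 0 :> R by rewrite pnatr_eq0 -lt0n.
have h : q%:R * (b%:~R / D%:R * x) * D%:R \is a Num.int by rewrite rpredM// natr_int.
rewrite natrM natr_absz intr_norm.
have e : q%:R * (b%:~R / D%:R * x) * D%:R = q%:R * b%:~R * x by field.
rewrite e in h; case: (ger0P (b%:~R : R)) => _ //.
by rewrite mulrN mulNr rpredN.
Qed.

Lemma common_denominator n (x : nat -> R) (p : pred nat) :
  (forall i, (i < n)%N -> p i -> rational (x i)) ->
  exists2 q : nat, (0 < q)%N & forall i, (i < n)%N -> p i -> q%:R * x i \is a Num.int.
Proof.
elim: n => [|n IH] h; first by exists 1%N.
have [i ni pi|q q0 hq] := IH; first by apply: h => //; exact: ltnW.
case pn : (p n); last first.
  exists q => // i; rewrite ltnS leq_eqVlt => /orP[/eqP->|]; last exact: hq.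
  by rewrite pn.
have [r r0 hr] := h n (ltnSn n) pn.
exists (q * r)%N; first by rewrite muln_gt0 q0.
move=> i; rewrite ltnS leq_eqVlt => /orP[/eqP-> _|ni pi].
  by rewrite natrM -mulrA rpredM// natr_int.
by rewrite natrM [q%:R * _]mulrC -mulrA rpredM ?natr_int// hq.
Qed.

Lemma finite_threshold (T : finType) (p : T -> R -> Prop) :
  (forall t, exists X0, forall X, X0 <= X -> p t X) ->
  exists X0, forall t X, X0 <= X -> p t X.
Proof.
move=> /choice[g hg]; exists (\sum_t `|g t|) => t X hX; apply: hg.
apply: (le_trans (ler_norm _)); apply: le_trans hX.
by rewrite (bigD1 t)//= lerDl sumr_ge0.
Qed.

Lemma diffs_int ss (phi : nat -> R) : (forall n, phi n \is a Num.int) ->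
  forall n, diffs ss phi n \is a Num.int.
Proof.
elim: ss phi => //= s ss IH phi h n; apply: IH => i.
by rewrite rpredB.
Qed.

Lemma diffs_bigsum ss N (phi : nat -> nat -> R) n :
  diffs ss (fun i => \sum_(l < N) phi l i) n = \sum_(l < N) diffs ss (phi l) n.
Proof.
elim: N => [|N IH].
  rewrite big_ord0 -[RHS](mul0r (diffs ss (fun=> 0) n)) -diffsZ.
  by apply: eq_diffs => i; rewrite big_ord0 mul0r.
by rewrite big_ord_recr/= -IH -diffsD; apply: eq_diffs => i; rewrite big_ord_recr.
Qed.

Lemma towerZ F n A (c : R) : tower F n A -> tower (fun i x => c * F i x) n A.
Proof. by move=> tF i x ni Ax; have := tF i x ni Ax; exact: is_deriveZ. Qed.

Lemma tower_poly P n A : tower (fun i x => (P^`(i)).[x]) n A.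
Proof. by move=> i x _ _; rewrite derivnS; exact: is_derive_poly. Qed.

Lemma diffs_monomial ss l (n : nat) : (l <= size ss)%N ->
  diffs ss (fun i => i%:R ^+ l) n =
  if l == size ss then (\prod_(s <- ss) s%:R) * (l`!)%:R else 0 :> R.
Proof.
move=> ls; have t := @tower_poly 'X^l (size ss) 0.
have [z _] := diffs_tower t (ler0n R n).
rewrite derivn0 derivnXn hornerMn hornerXn.
have -> : diffs ss (fun i => ('X^l : {poly R}).[i%:R]) n = diffs ss (fun i => i%:R ^+ l) n.
  by apply: eq_diffs => i; rewrite hornerXn.
move=> ->; case: (ltngtP l (size ss)) ls => // [lt|->] _.
  by rewrite ffact_small// mulr0n mulr0.
by rewrite subnn expr0 ffactnn.
Qed.

Lemma expnDm (n s l : nat) : exists k, ((n + s) ^ l = n ^ l + s * k)%N.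
Proof.
elim: l => [|l [k e]]; first by exists 0%N; rewrite muln0.
by exists (n ^ l + n * k + s * k)%N; rewrite !expnS e; ring.
Qed.

Lemma diffs_high_int ss s Q (c : R) l n : Q%:R * c \is a Num.int ->
  diffs ((Q * s)%N :: ss) (fun i => c * i%:R ^+ l) n \is a Num.int.
Proof.
move=> hc /=; apply: diffs_int => i.
have [k] := expnDm i (Q * s) l; rewrite -[(i + Q * s)%:R ^+ l]natrX => ->.
rewrite natrD natrX [in X in X - _]mulrDr addrAC subrr add0r.
have -> : c * (Q * s * k)%:R = Q%:R * c * (s * k)%:R by rewrite !natrM; ring.
by rewrite rpredM// natr_int.
Qed.

(* [F 0] is a polynomial up to an error whose derivatives decay like those of [ln]. *)
Definition near_poly F d A Ce P := [/\ size P = d.+2, 0 < lead_coef P, 0 <= Ce &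
  forall i x, (0 < i <= d.+1)%N -> A <= x -> `|F i x - (P^`(i)).[x]| <= Ce / x ^+ i].

Lemma near_poly_top F d A Ce P x : near_poly F d A Ce P -> A <= x ->
  `|F d.+1 x - (d.+1)`!%:R * lead_coef P| <= Ce / x ^+ d.+1.
Proof.
move=> [sP _ _ hE] Ax; have := hE d.+1 x; rewrite leqnn/= => /(_ isT Ax).
have -> // : (P^`(d.+1)).[x] = (d.+1)`!%:R * lead_coef P.
have -> : P^`(d.+1) = ((d.+1)`!%:R * lead_coef P)%:P.
  apply/polyP => i; rewrite coef_derivn coefC lead_coefE sP/=.
  case: eqP => [->|/eqP i0]; first by rewrite addn0 ffactnn mulr_natl.
  by rewrite nth_default ?mul0rn// sP; move: i0; clear; lia.
by rewrite hornerC.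
Qed.

Lemma near_poly_bounded F d A Ce P : 0 < A -> near_poly F d A Ce P ->
  exists2 M : R, 0 < M & forall x, A <= x -> F d.+1 x <= M.
Proof.
move=> A0 nP; have [sP lP Ce0 _] := nP.
have Ad0 : 0 < A ^+ d.+1 by rewrite exprn_gt0.
have L0 : 0 < (d.+1)`!%:R * lead_coef P by rewrite mulr_gt0// ltr0n fact_gt0.
have w0 : 0 <= Ce / A ^+ d.+1 by rewrite divr_ge0// ltW.
exists ((d.+1)`!%:R * lead_coef P + Ce / A ^+ d.+1); first by rewrite ltr_wpDr.
move=> x Ax; have := near_poly_top nP Ax.
have : Ce / x ^+ d.+1 <= Ce / A ^+ d.+1.
  rewrite ler_wpM2l// lef_pV2 ?posrE ?exprn_gt0// ?(lt_le_trans A0)//.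
  by apply: lerXn2r; rewrite ?nnegrE ?(ltW A0)// (le_trans (ltW A0)).
by rewrite ler_norml; clear; lra.
Qed.

(* Near [beta0] the rational coefficients of degree above [j] are killed by differencing with steps
   divisible by their denominators; [j] differences isolate the irrational multiple [lam]. *)
Lemma small_near_rational F d A Ce P j eps (D : nat) (b : int) (C : R) :
  growth F d.+1 A -> near_poly F d A Ce P -> (0 < j <= d)%N ->
  (forall l, (j < l < d.+2)%N -> rational (P`_l / lead_coef P)) ->
  ~ rational (P`_j / lead_coef P) ->
  0 < eps <= 1 -> (0 < D)%N -> b != 0 -> 0 < C ->
  exists X0 : R, forall X, X0 <= X -> forall (a m : nat) (beta : R), X <= a%:R -> (m <= a)%N ->
    a%:R <= 64 * m%:R :> R ->
    `|beta * ((d.+1)`!%:R * lead_coef P) - b%:~R / D%:R| <= C / a%:R ^+ d.+1 ->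
    avg_small (fun n => beta * F 0%N n%:R) a m eps.
Proof.
move=> gF nP /andP[j0 jd] rat irr eps01 D0 b0 C0.
have [sP lP Ce0 hE] := nP; have A0 := growth_gt0 gF.
set L : R := _ * lead_coef P.
have f0 : 0 < (d.+1)`!%:R :> R by rewrite ltr0n fact_gt0.
have L0 : 0 < L by rewrite mulr_gt0.
have D0' : 0 < D%:R :> R by rewrite ltr0n.
pose beta0 := b%:~R / D%:R / L.
have b0E l : beta0 * P`_l = b%:~R / (D * (d.+1)`!)%:R * (P`_l / lead_coef P).
  by rewrite /beta0 /L natrM; field; rewrite !gt_eqF.
have Df0 : (0 < D * (d.+1)`!)%N by rewrite muln_gt0 D0 fact_gt0.
have [|Q Q0 hQ] := @common_denominator d.+2 (fun l => beta0 * P`_l) (fun l => (j < l)%N).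
  by move=> l ld jl; rewrite b0E; apply: rationalZ => //; apply: rat; rewrite jl.
pose lam := beta0 * P`_j * (j`!)%:R * Q%:R ^+ j.
have lamirr (D' : nat) (b' : int) : (0 < D')%N -> D'%:R * lam - b'%:~R != 0.
  move=> D'0; apply/eqP => e; apply: irr.
  apply: (@rational_divl _ b (D * (d.+1)`!)%N) => //; rewrite -b0E.
  exists (D' * (j`! * Q ^ j))%N; first by rewrite !muln_gt0 D'0 fact_gt0 expn_gt0 Q0.
  have -> : (D' * (j`! * Q ^ j))%:R * (beta0 * P`_j) = D'%:R * lam.
    by rewrite /lam !natrM natrX; ring.
  by move/eqP: e; rewrite subr_eq0 => /eqP ->; exact: intr_int.
have [kap /andP[kap0 kap2] hW] := weyl j.-1 eps01.
have [Q' hQ'] := nat_ge (2 / kap).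
have Q'0' : 0 < Q'%:R :> R by apply: lt_le_trans hQ'; rewrite divr_gt0.
have Q'0 : (0 < Q')%N by rewrite -(ltr0n R).
have [D' [b' [/andP[D'0 D'Q] hDb]]] := dirichlet lam Q'0.
set del := D'%:R * lam - b'%:~R in hDb.
have del0 : 0 < `|del| by rewrite normr_gt0 lamirr.
have delk : `|del| <= kap / 2.
  apply: (le_trans hDb); have : 2 <= Q'%:R * kap by rewrite -ler_pdivrMr.
  by rewrite -[_^-1]mul1r ler_pdivrMr//; clear; lra.
have kap1 : 0 < `|del| / 2 <= kap by move: del0 delk kap0; clear; lra.
have [C' C'0 {}hW] := hW _ kap1.
have C'0' : 0 < C'%:R :> R by rewrite ltr0n.
pose S := (Q * D')%N.
have S0 : (0 < S)%N by rewrite muln_gt0 Q0.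
pose ss := S :: nseq j.-1 Q.
have sizess : size ss = j by rewrite /= size_nseq prednK.
have prodss : \prod_(s <- ss) s%:R = D'%:R * Q%:R ^+ j :> R.
  by rewrite big_cons prod_nseq natrM -[in RHS](prednK j0) exprS; ring.
pose Pi : R := D'%:R * Q%:R ^+ j.
have Pi0 : 0 < Pi by rewrite mulr_gt0 ?exprn_gt0 ?ltr0n.
have [M M0 hM] := near_poly_bounded A0 nP.
have [Cj Cj0 hCj] := growth_upper gF (leq_subr j d.+1).
have jd1 : (d.+1 - (d.+1 - j) = j)%N by move: jd; clear; lia.
rewrite jd1 in hCj.
pose tau := Num.min (`|del| / 2) (C'%:R^-1 / 2).
have tau0 : 0 < tau by rewrite lt_min !divr_gt0// invr_gt0.
have tau1 : tau <= `|del| / 2 by rewrite ge_min lexx.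
have tau2 : tau <= C'%:R^-1 / 2 by rewrite ge_min lexx orbT.
clearbody tau.
pose E1 := Pi * (C / L * (Cj * (M * 4 ^+ (d.+1 - j))) + `|beta0| * Ce).
have E10 : 0 <= E1.
  apply: mulr_ge0; first exact: ltW.
  apply: addr_ge0; last exact: mulr_ge0.
  apply: mulr_ge0; first by rewrite divr_ge0// ltW.
  by apply: mulr_ge0; [exact: ltW|rewrite mulr_ge0 ?exprn_ge0// ltW].
exists (E1 / tau + 8 * A + 64 * (C' * S)%:R + (sumn ss)%:R + 1) => X hX a m beta Xa ma am hbeta.
have w1 : 0 <= E1 / tau by rewrite divr_ge0// ltW.
have w2 : 0 <= (C' * S)%:R :> R by [].
have w3 : 0 <= (sumn ss)%:R :> R by [].
have aA : 8 * A <= a%:R by move: hX Xa w1 w2 w3; clear; lra.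
have a1 : 1 <= a%:R :> R by move: hX Xa w1 w2 w3 A0; clear; lra.
have a0 : 0 < a%:R :> R by move: a1; clear; lra.
have aE : E1 <= a%:R * tau by rewrite -ler_pdivrMr//; move: hX Xa w2 w3 A0; clear; lra.
have aCS : (C' * S <= m)%N.
  rewrite -(ler_nat R); have : 64 * (C' * S)%:R <= a%:R :> R by move: hX Xa w1 w3 A0; clear; lra.
  by move: am; clear; lra.
have ass : (sumn ss <= a)%N by rewrite -(ler_nat R); move: hX Xa w1 w2 A0; clear; lra.
pose delta := beta - beta0.
have hdelta : `|delta| <= C / L / a%:R ^+ d.+1.
  have -> : C / L / a%:R ^+ d.+1 = C / a%:R ^+ d.+1 / L by ring.
  rewrite ler_pdivlMr// -[X in _ * X]ger0_norm ?(ltW L0)// -normrM.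
  by rewrite (_ : delta * L = beta * L - b%:~R / D%:R)// /delta /beta0; field; rewrite !gt_eqF.
pose G i x := beta * F i x - beta0 * (P^`(i)).[x].
have tG : tower G (size ss) A.
  rewrite sizess; apply: towerB; apply: towerZ; last exact: tower_poly.
  by apply: tower_le (growth_tower gF) => //; move: jd; clear; lia.
(* The distance of [beta] from [beta0] is [O(a^-(d+1))] while [F j] is [O(a^(d+1-j))], and the
   deviation of [F j] from the derivative of [P] is [O(a^-j)]; as [j > 0], all this is small after
   [j] differences. *)
have hG n : (a <= n <= a + m + C' * S)%N -> `|diffs ss (fun i => G 0%N i%:R) n| <= tau.
  move=> /andP[n1 n2].
  have An : A <= n%:R.
    apply: (@le_trans _ _ a%:R); last by rewrite ler_nat.
    by move: aA A0; clear; lra.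
  have [z /andP[z1 z2] ->] := diffs_tower tG An.
  rewrite sizess prodss -/Pi.
  have az : a%:R <= z by apply: le_trans z1; rewrite ler_nat.
  have Az : A <= z by exact: le_trans z1.
  have z0 : 0 < z by exact: lt_le_trans Az.
  have z4 : z <= 4 * a%:R.
    apply: (le_trans z2); rewrite -natrM ler_nat; move: n2 aCS ma ass; clear; lia.
  have aj : a%:R <= z ^+ j.
    have -> : j = j.-1.+1 by rewrite prednK.
    rewrite exprS; apply: (le_trans az); rewrite ler_peMr ?(ltW z0)// exprn_ege1//.
    by apply: le_trans az.
  have FM : F j z <= Cj * (M * (4 * a%:R) ^+ (d.+1 - j)).
    have h4 : 1 <= 4 * a%:R :> R by move: a1; clear; lra.
    have h8 : 8 * A <= 4 * a%:R by move: aA a0; clear; lra.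
    have hz : A <= z <= 4 * a%:R by rewrite Az.
    apply: (le_trans (hCj (4 * a%:R) z h8 h4 hz)).
    rewrite ler_pM2l//; apply: ler_wpM2r.
      by rewrite exprn_ge0//; move: h4; clear; lra.
    by apply: hM; move: h8 A0; clear; lra.
  have Fj0 : 0 < F j z by apply: (growth_pos gF) => //; move: jd; clear; lia.
  have -> : G j z = delta * F j z + beta0 * (F j z - (P^`(j)).[z]) by rewrite /G /delta; ring.
  rewrite normrM gtr0_norm//.
  apply: (@le_trans _ _ (E1 / a%:R)); last by rewrite ler_pdivrMr// mulrC.
  have -> : E1 / a%:R = Pi * (C / L * (Cj * (M * 4 ^+ (d.+1 - j))) / a%:R + `|beta0| * (Ce / a%:R)).
    by rewrite /E1; ring.
  rewrite ler_pM2l//; apply: (le_trans (ler_normD _ _)); rewrite !normrM.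
  apply: lerD; last first.
    rewrite ler_wpM2l//; have hj : (0 < j <= d.+1)%N by rewrite j0 ltnW.
    apply: (le_trans (hE j z hj Az)); rewrite ler_wpM2l// lef_pV2 ?posrE ?exprn_gt0//.
  rewrite [`|F j z|]gtr0_norm//.
  apply: (@le_trans _ _ (C / L / a%:R ^+ d.+1 * (Cj * (M * (4 * a%:R) ^+ (d.+1 - j))))).
    by apply: ler_pM => //; exact: ltW.
  have -> : a%:R ^+ d.+1 = a%:R ^+ j * a%:R ^+ (d.+1 - j) :> R.
    by rewrite -exprD subnKC// ltnW.
  rewrite exprMn; have ad0 : 0 < a%:R ^+ (d.+1 - j) :> R by rewrite exprn_gt0.
  have aj0 : 0 < a%:R ^+ j :> R by rewrite exprn_gt0.
  have -> : C / L / (a%:R ^+ j * a%:R ^+ (d.+1 - j)) * (Cj * (M * (4 ^+ (d.+1 - j) * a%:R ^+ (d.+1 - j))))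
     = C / L * (Cj * (M * 4 ^+ (d.+1 - j))) / a%:R ^+ j.
    by field; rewrite !gt_eqF.
  apply: ler_wpM2l.
    by rewrite !mulr_ge0 ?exprn_ge0 ?invr_ge0// ltW.
  rewrite lef_pV2 ?posrE//; have -> : j = j.-1.+1 by rewrite prednK.
  by rewrite exprS ler_peMr ?(ltW a0)// exprn_ege1.
(* [beta0 * P] is split by degree: monomials above [j] contribute the integer [z n], the one of
   degree [j] contributes [D' * lam], and those below [j] disappear. *)
pose z n := diffs ss (fun i => \sum_(l < d.+2 | (j < l)%N) (beta0 * P`_l) * i%:R ^+ l) n.
have zint n : z n \is a Num.int.
  have -> : z n = \sum_(l < d.+2) diffs ss (fun i => if (j < l)%N then beta0 * P`_l * i%:R ^+ l else 0) n.
    rewrite -(diffs_bigsum ss d.+2 (fun l i => if (j < l)%N then beta0 * P`_l * i%:R ^+ l else 0)).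
    by apply: eq_diffs => i; rewrite big_mkcond.
  apply: rpred_sum => l _; case jl : (j < l)%N; last first.
    by apply: diffs_int => i; exact: rpred0.
  by apply: diffs_high_int; apply: hQ.
have main n : diffs ss (fun i => beta * F 0%N i%:R) n
    = z n + D'%:R * lam + diffs ss (fun i => G 0%N i%:R) n.
  have -> : diffs ss (fun i => beta * F 0%N i%:R) n
     = diffs ss (fun i => beta0 * P.[i%:R]) n + diffs ss (fun i => G 0%N i%:R) n.
    by rewrite -diffsD; apply: eq_diffs => i; rewrite /G derivn0; ring.
  congr (_ + _).
  have -> : diffs ss (fun i => beta0 * P.[i%:R]) n =
     z n + diffs ss (fun i => \sum_(l < d.+2) (if (j < l)%N then 0 else beta0 * P`_l * i%:R ^+ l)) n.
    rewrite -diffsD; apply: eq_diffs => i.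
    rewrite horner_coef sP mulr_sumr (bigID (fun l : 'I_d.+2 => (j < l)%N))/=; congr (_ + _).
      by apply: eq_bigr => l _; rewrite mulrA.
    by rewrite big_mkcond/=; apply: eq_bigr => l _; case: (j < l)%N => //=; rewrite mulrA.
  congr (_ + _).
  rewrite (diffs_bigsum ss d.+2 (fun l i => if (j < l)%N then 0 else beta0 * P`_l * i%:R ^+ l)).
  have jlt : (j < d.+2)%N by move: jd; clear; lia.
  move: (sizess) (prodss); move: (ss) => s0 sz0 pr0.
  rewrite (bigD1 (Ordinal jlt))//= [X in _ + X]big1 ?addr0.
    rewrite ltnn/= diffsZ diffs_monomial ?sz0// eqxx pr0 /lam; ring.
  move=> l lj; case: (ltngtP j l) => jl.
  - by rewrite -[RHS](mul0r (diffs s0 (fun=> 0) n)) -diffsZ; apply: eq_diffs => i; rewrite mul0r.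
  - by rewrite diffsZ diffs_monomial ?sz0 ?ltn_eqF// ?mulr0// ltnW.
  - by move: lj; rewrite -val_eqE/= jl eqxx.
have ssS : all (fun s => 0 < s <= S)%N ss.
  rewrite /= S0 leqnn/=; apply/allP => s /nseqP[-> _]; rewrite Q0/= /S.
  by rewrite leq_pmulr.
have s1 : size ss = j.-1.+1 by rewrite sizess prednK.
case: (ger0P del) del0 delk tau1 kap1 hW => sd del0 delk tau1 kap1 hW.
- apply: (hW ss S _ a m (fun n => del + diffs ss (fun i => G 0%N i%:R) n)) => //.
  + move=> n hn; split.
      rewrite main (_ : _ - _ = z n + b'%:~R); last by rewrite /del; ring.
      by rewrite rpredD// intr_int.
    have := hG n hn; rewrite ler_norml; move: tau1 delk; clear; lra.
  + move=> n n' n1 /andP[n2 n3] n4.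
    have h1 : (a <= n <= a + m + C' * S)%N by move: n1 n2 n4; clear; lia.
    have h2 : (a <= n' <= a + m + C' * S)%N by move: n1 n2 n4; clear; lia.
    have := hG n h1; have := hG n' h2; rewrite !ler_norml; move: tau2; clear; lra.
- apply: avg_smallN.
  have mainN n : diffs ss (fun i => - (beta * F 0%N i%:R)) n
     = - (z n + D'%:R * lam + diffs ss (fun i => G 0%N i%:R) n) by rewrite diffsN main.
  apply: (hW ss S _ a m (fun n => - del - diffs ss (fun i => G 0%N i%:R) n)) => //.
  + move=> n hn; split.
      rewrite mainN (_ : _ - _ = - (z n + b'%:~R)); last by rewrite /del; ring.
      by rewrite rpredN rpredD// intr_int.
    have := hG n hn; rewrite ler_norml; move: tau1 delk; clear; lra.
  + move=> n n' n1 /andP[n2 n3] n4.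
    have h1 : (a <= n <= a + m + C' * S)%N by move: n1 n2 n4; clear; lia.
    have h2 : (a <= n' <= a + m + C' * S)%N by move: n1 n2 n4; clear; lia.
    have := hG n h1; have := hG n' h2; rewrite !ler_norml; move: tau2; clear; lra.
Qed.

Lemma near_poly_diffs F d A Ce P : 0 < A -> near_poly F d A Ce P -> tower F d.+1 A ->
  forall ss (a n : nat), A <= a%:R -> size ss = d.+1 -> (a <= n)%N ->
  `|diffs ss (fun i => F 0%N i%:R) n - (d.+1)`!%:R * lead_coef P * \prod_(s <- ss) s%:R|
     <= Ce * (\prod_(s <- ss) s%:R) / a%:R ^+ d.+1.
Proof.
move=> A0 nP tF ss a n Aa sss an; have [_ _ Ce0 _] := nP.
have an' : a%:R <= n%:R :> R by rewrite ler_nat.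
have An : A <= n%:R by exact: le_trans an'.
have tF' : tower F (size ss) A by rewrite sss.
have [z /andP[z1 _] ->] := diffs_tower tF' An.
have a0 : 0 < a%:R :> R by exact: lt_le_trans Aa.
have az : a%:R <= z by exact: le_trans z1.
rewrite sss; set Pi := \prod_(s <- ss) _.
have Pi0 : 0 <= Pi by apply: prodr_ge0.
have -> : Pi * F d.+1 z - (d.+1)`!%:R * lead_coef P * Pi = Pi * (F d.+1 z - (d.+1)`!%:R * lead_coef P) by ring.
rewrite normrM ger0_norm// [Ce * Pi]mulrC -mulrA ler_wpM2l//.
apply: (le_trans (near_poly_top nP (le_trans Aa az))).
rewrite ler_wpM2l// lef_pV2 ?posrE ?exprn_gt0 ?(lt_le_trans a0)//.
by apply: lerXn2r; rewrite ?nnegrE ?(ltW a0)// (le_trans (ltW a0)).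
Qed.

(** The leading coefficient leaves only frequencies near [b / (D * L)] with [D <= Q]. As
    [|beta| <= R0] these fractions are finitely many, so the thresholds obtained for each of them
    have a common bound. The fraction 0 is excluded by [C3 / T <= |beta|]. *)
Lemma equidistributed_irrational F d A Ce P j : growth F d.+1 A -> near_poly F d A Ce P ->
  (0 < j <= d)%N -> (forall l, (j < l < d.+2)%N -> rational (P`_l / lead_coef P)) ->
  ~ rational (P`_j / lead_coef P) -> equidistributed (F 0%N).
Proof.
move=> gF nP jd rat irr; have A0 := growth_gt0 gF; have [_ lP Ce0 _] := nP.
have [C1 [C2 [K [C10 C20 K0 win]]]] := growth_window gF.
exists C1, C2; split=> // eps R0 eps01 R00.
set L : R := (d.+1)`!%:R * lead_coef P.
have L0 : 0 < L by rewrite mulr_gt0// ltr0n fact_gt0.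
have [Q Q0 LC] := leading_coefficient d eps01.
have eta0 : 0 < 64^-1 :> R by [].
have [C [X1 [C0 hLC]]] := LC L Ce 64^-1 R0 Ce0 eta0 R00.
have [M M0 hM] := near_poly_bounded A0 nP.
have [N hN] := nat_ge (Q%:R * (R0 * L + C)).
(* Numerators are encoded by a sign and an absolute value, so that the fractions are indexed by a
   finite type. *)
have [X2 hX2] : exists X2, forall (t : 'I_Q.+1 * 'I_N.+1 * bool) X, X2 <= X ->
    (0 < t.1.1)%N -> (-1) ^+ t.2 * (t.1.2 : nat)%:Z != 0 ->
    forall (a m : nat) (beta : R), X <= a%:R -> (m <= a)%N -> a%:R <= 64 * m%:R :> R ->
    `|beta * L - ((-1) ^+ t.2 * (t.1.2 : nat)%:Z)%:~R / t.1.1%:R| <= C / a%:R ^+ d.+1 ->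
    avg_small (fun n => beta * F 0%N n%:R) a m eps.
  apply: finite_threshold => -[[D b] s] /=.
  case: (posnP D) => [_|D0]; first by exists 0.
  case: (eqVneq ((-1) ^+ s * (b : nat)%:Z) 0) => [_|b0]; first by exists 0.
  have [X0 hX0] := small_near_rational gF nP jd rat irr eps01 D0 b0 C0.
  by exists X0 => X hX _ _; exact: hX0.
pose C3 := C * K * M * 2 ^+ d.+1 / L + 1.
have C30 : 0 < C3 by rewrite ltr_wpDl// divr_ge0 ?(ltW L0)// !mulr_ge0// ltW.
exists C3 => // B; have [X0 hX0] := win B.
pose X := `|X0| + 2 * `|X1| + 2 * `|X2| + 2 * A + 4.
have n0 := normr_ge0 X0; have n1 := normr_ge0 X1; have n2 := normr_ge0 X2.
have [|a [m [[w1 w2 w3] basics steps /andP[T0 TK]]]] := hX0 X.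
  by have := ler_norm X0; rewrite /X; move: n1 n2 A0; clear; lra.
exists a, m => T; split=> // b /andP[b1 b2].
have l1 := ler_norm X1; have l2 := ler_norm X2.
have aX1 : X1 <= a%:R by move: w1 l1 l2 n0 n1 n2 A0; rewrite /X; clear; lra.
have aX2 : X2 <= a%:R by move: w1 l1 l2 n0 n1 n2 A0; rewrite /X; clear; lra.
have aA : A <= a%:R by move: w1 n0 n1 n2 A0; rewrite /X; clear; lra.
have AX : A <= X by move: n0 n1 n2 A0; rewrite /X; clear; lra.
have a0 : 0 < a%:R :> R by exact: lt_le_trans aA.
have X02 : 0 <= X <= 2 * a%:R by move: w1 AX A0; clear; lra.
have ma : (m <= a)%N.
  by rewrite -(ler_nat R); move: w1 w2 AX A0; rewrite natrD natrM; clear; lra.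
have am : a%:R <= 64 * m%:R :> R.
  have m0 := ler0n R m.
  by move: m0 w2 w3 AX A0; rewrite natrD natrM; clear; lra.
have etam : 64^-1 * a%:R <= m%:R :> R by move: am; clear; lra.
have tF : tower F d.+1 A by apply: tower_le (growth_tower gF) => //; exact: leqW.
have [//|[D [b' [/andP[D0 DQ] hDb]]]] := hLC (fun i => F 0%N i%:R) a m b aX1 etam b2
  (fun ss n => near_poly_diffs A0 nP tF aA).
have ad0 : 0 < a%:R ^+ d.+1 :> R by rewrite exprn_gt0.
(* A frequency this close to 0 would satisfy [|b| * T <= C3 - 1], since [T] is [O(a^(d+1))]. *)
have b'0 : b' != 0.
  apply/eqP => b'0; move: hDb; rewrite b'0 mul0r subr0 normrM (gtr0_norm L0) => hb.
  have : C3 <= C * K * M * 2 ^+ d.+1 / L; last by rewrite /C3; clear; lra.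
  have C3T : C3 <= `|b| * T by rewrite -ler_pdivrMr.
  apply: (le_trans C3T).
  have T1 : T <= K * (M * (2 ^+ d.+1 * a%:R ^+ d.+1)).
    apply: (le_trans TK); rewrite ler_pM2l//; apply: ler_pM.
    - by apply/ltW/(growth_pos gF).
    - by rewrite exprn_ge0//; case/andP: X02.
    - exact: hM.
    - rewrite -exprMn; case/andP: X02 => ? ?; apply: lerXn2r; rewrite ?nnegrE//.
  have {}hb : `|b| <= C / a%:R ^+ d.+1 / L by rewrite ler_pdivlMr.
  have -> : C * K * M * 2 ^+ d.+1 / L = (C / a%:R ^+ d.+1 / L) * (K * (M * (2 ^+ d.+1 * a%:R ^+ d.+1))).
    by field; rewrite !gt_eqF.
  by apply: ler_pM => //; exact: ltW.
have b'N : (`|b'| <= N)%N.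
  rewrite -(ler_nat R); apply: le_trans hN; rewrite natr_absz intr_norm.
  have D0' : 0 < D%:R :> R by rewrite ltr0n.
  have -> : `|b'%:~R| = D%:R * `|b'%:~R / D%:R| :> R.
    by rewrite normrM normfV (gtr0_norm D0'); field; rewrite gt_eqF.
  apply: ler_pM => //; first by rewrite ler_nat.
  have bL : `|b * L| <= R0 * L by rewrite normrM (gtr0_norm L0) ler_pM2r.
  have Ca : C / a%:R ^+ d.+1 <= C.
    rewrite ler_pdivrMr// ler_peMr ?(ltW C0)// exprn_ege1//.
    by rewrite ler1n -(ltr0n R).
  move: (ler_distD (b * L) (b'%:~R / D%:R) 0); rewrite !subr0 distrC.
  by move: hDb bL Ca; clear; lra.
have b'E : b' = (-1) ^+ (b' < 0)%R * (`|b'|%N)%:Z by exact: intEsign.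
apply: (hX2 (Ordinal (_ : D < Q.+1)%N, Ordinal (_ : `|b'| < N.+1)%N, (b' < 0)%R) a%:R) => //=.
- by rewrite -b'E.
- by rewrite -b'E.
Qed.

End IrrationalRatio.

(** * Sums in an arithmetic progression of arguments *)

Section NatPolynomial.
Variable R : realType.

Definition psum (c : nat -> nat) d h := (\sum_(j < d.+2) c j * h ^ j)%N.

(** The increment is [s * (1 + V * z)], not only congruent to [s] modulo [V]: the factor [s] is what
    later cancels part of the denominator [q = s * l]. *)
Lemma psum_step c V d h s : c 0%N = 0%N -> c 1%N = 1%N -> (forall j, (1 < j < d.+2)%N -> (V %| c j)%N) ->
  exists z, (psum c d (h + s) = psum c d h + s + s * V * z)%N.
Proof.
move=> c0 c1 hV; elim: d hV => [_|d IH hV].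
  exists 0%N; rewrite /psum !big_ord_recr !big_ord0/= c0 c1 !expn1 muln0.
  by rewrite !mul0n !mul1n !addn0.
have [|z e] := IH; first by move=> j /andP[j1 jd]; apply: hV; rewrite j1 ltnW.
have E x : psum c d.+1 x = (psum c d x + c d.+2 * x ^ d.+2)%N by rewrite /psum big_ord_recr.
rewrite !E e.
have /dvdnP[v ->] := hV d.+2 (ltnSn _); have [k ->] := expnDm h s d.+2.
by exists (z + v * k)%N; ring.
Qed.

Definition rpoly (c : nat -> nat) d : {poly R} := \poly_(j < d.+2) (c j)%:R.

Lemma rpolyE c d (h : nat) : (rpoly c d).[h%:R] = (psum c d h)%:R.
Proof.
by rewrite horner_poly /psum natr_sum; apply: eq_bigr => j _; rewrite natrM natrX.
Qed.

Lemma horner_mono (q : {poly R}) x y : (forall i, 0 <= q`_i) -> 0 <= x -> x <= y -> q.[x] <= q.[y].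
Proof.
move=> q0 x0 xy; rewrite !horner_coef; apply: ler_sum => i _.
by rewrite ler_wpM2l//; apply: lerXn2r => //; rewrite nnegrE// (le_trans x0).
Qed.

Lemma horner_scale (q : {poly R}) n (x lam : R) : (forall i, 0 <= q`_i) -> (size q <= n.+1)%N -> 0 <= x -> 1 <= lam ->
  q.[lam * x] <= lam ^+ n * q.[x].
Proof.
move=> q0 qn x0 lam1; rewrite !horner_coef mulr_sumr; apply: ler_sum => i _.
rewrite exprMn mulrCA ler_wpM2r ?mulr_ge0 ?exprn_ge0//.
by rewrite ler_weXn2l// -ltnS; exact: leq_trans (ltn_ord i) qn.
Qed.

Section Bounds.
Variables (c : nat -> nat) (d : nat).
Hypothesis c1 : c 1%N = 1%N.
Let q := (rpoly c d)^`().

Let q_ge0 i : 0 <= q`_i.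
Proof. by rewrite coef_deriv mulrn_wge0// coef_poly; case: ifP. Qed.

Let size_q : (size q <= d.+1)%N.
Proof.
by apply/leq_sizeP => j dj; rewrite coef_deriv coef_poly ltnS ltnNge dj mul0rn.
Qed.

Let q_ge1 x : 0 <= x -> 1 <= q.[x].
Proof.
move=> x0; apply: (@le_trans _ _ q.[0]); last exact: horner_mono.
by rewrite horner_coef0 coef_deriv coef_poly/= c1.
Qed.

Lemma psum_mv (n s : nat) : exists2 z, n%:R <= z <= (n + s)%:R & (psum c d (n + s))%:R - (psum c d n)%:R = q.[z] * s%:R.
Proof.
have [||z hz e] := @mean_value _ (fun x => (rpoly c d).[x]) (fun x => q.[x]) n%:R n%:R (n + s)%:R _ (lexx _).
- by move=> x _; exact: is_derive_poly.
- by rewrite ler_nat leq_addr.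
by exists z => //; rewrite -!rpolyE e natrD addrAC subrr add0r.
Qed.

(** The derivative has nonnegative coefficients, degree at most [d] and value at least 1, so it is
    nondecreasing and changes by a factor of at most [2 ^ d] between [a] and [2 * a]. *)
Lemma psum_growth (a m : nat) : (0 < a)%N -> (m <= a)%N ->
  let T := (psum c d (a + m))%:R - (psum c d a)%:R : R in
  [/\ m%:R <= T, T <= 2 ^+ d * q.[1] * a%:R ^+ d.+1 &
    forall n, (a <= n < a + m)%N ->
     (0 : R) <= (psum c d n.+1)%:R - (psum c d n)%:R <= 2 ^+ d * T / m%:R].
Proof.
move=> a0 ma T; have [z /andP[z1 z2] TE] := psum_mv a m.
have a0' : 0 < a%:R :> R by rewrite ltr0n.
have a1 : 1 <= a%:R :> R by rewrite ler1n.
have z0 : 0 <= z by exact: le_trans z1.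
have a2 : (a + m)%:R <= 2 * a%:R :> R by rewrite -natrM ler_nat; move: ma; clear; lia.
have za : q.[z] <= 2 ^+ d * q.[a%:R].
  by apply: le_trans (horner_scale q_ge0 size_q _ _) => //; [apply: horner_mono => //; exact: le_trans a2|rewrite ler1n].
have qa : q.[a%:R] <= a%:R ^+ d * q.[1].
  by rewrite -[X in q.[X]]mulr1; apply: horner_scale.
have q1 := q_ge1 ler01.
split; rewrite /T ?TE.
- by rewrite ler_peMl// q_ge1.
- have -> : 2 ^+ d * q.[1] * a%:R ^+ d.+1 = 2 ^+ d * (a%:R ^+ d * q.[1]) * a%:R by rewrite exprS; ring.
  apply: ler_pM => //.
  + by rewrite (le_trans ler01)// q_ge1.
  + by apply: (le_trans za); rewrite ler_pM2l// exprn_gt0.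
  + by rewrite ler_nat.
- move=> n /andP[n1 n2]; have [w /andP[w1 w2]] := psum_mv n 1.
  rewrite addn1 mulr1 => ->.
  have w0 : 0 <= w by exact: le_trans w1.
  rewrite (le_trans ler01 (q_ge1 w0))/=.
  have m0 : 0 < m%:R :> R by rewrite ltr0n; move: n1 n2; clear; lia.
  rewrite mulrA mulfK ?gt_eqF//; apply: (@le_trans _ _ (2 ^+ d * q.[a%:R])).
    apply: le_trans (horner_scale q_ge0 size_q _ _) => //; last by rewrite ler1n.
    apply: horner_mono => //; apply: (le_trans w2); apply: le_trans a2; rewrite ler_nat.
    by move: n2; clear; lia.
  by rewrite ler_pM2l ?exprn_gt0//; apply: horner_mono.
Qed.

Lemma psum_increment (a n s : nat) : (0 < a)%N -> (n + s <= 4 * a)%N ->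
  (0 : R) <= (psum c d (n + s))%:R - (psum c d n)%:R <= s%:R * (4 ^+ d * q.[1] * a%:R ^+ d).
Proof.
move=> a0 ns; have [z /andP[z1 z2] ->] := psum_mv n s.
have z0 : 0 <= z by exact: le_trans z1.
have a1 : 1 <= a%:R :> R by rewrite ler1n.
rewrite mulr_ge0//=; last by rewrite (le_trans ler01)// q_ge1.
rewrite mulrC ler_wpM2l//; have -> : 4 ^+ d * q.[1] * a%:R ^+ d = (4 * a%:R) ^+ d * q.[1] by rewrite exprMn; ring.
apply: le_trans (horner_scale q_ge0 size_q ler01 _); last by rewrite mulr_ege1 ?ler1n.
rewrite mulr1; apply: horner_mono => //; apply: (le_trans z2); by rewrite -natrM ler_nat.
Qed.

End Bounds.

(* Differencing with step [q / l] turns the frequency [b / q] into [b / l] modulo 1, since [psum]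
   is the identity modulo [V], hence modulo [l]. *)
Lemma psum_rational_small c d V (N : nat) (C eta eps : R) :
  c 0%N = 0%N -> c 1%N = 1%N -> (forall j, (1 < j < d.+2)%N -> (V %| c j)%N) ->
  (0 < N)%N -> 0 < C -> 0 < eta -> 0 < eps <= 1 ->
  exists X0 : R, forall (b : int) (q l a m : nat) (theta : R), (0 < q <= N)%N -> coprime `|b| q ->
    prime l -> (l %| q)%N -> (l %| V)%N -> X0 <= a%:R -> (m <= a)%N -> eta * a%:R <= m%:R ->
    `|theta - b%:~R / q%:R| <= C / a%:R ^+ d.+1 ->
    avg_small (fun n => theta * (psum c d n)%:R) a m eps.
Proof.
move=> c0 c1 hV N0 C0 eta0 /andP[eps0 eps1].
have N0' : 0 < N%:R :> R by rewrite ltr0n.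
have kap0 : 0 < (2 * N%:R)^-1 :> R by rewrite invr_gt0 mulr_gt0.
have [C0' C0'0 hW] := weyl_base kap0 eps0.
have C0'0' : 0 < C0'%:R :> R by rewrite ltr0n.
set q1 : R := (rpoly c d)^`().[1].
pose tau : R := Num.min (2 * N%:R)^-1 (C0'%:R^-1 / 2).
have tau0 : 0 < tau by rewrite lt_min kap0 divr_gt0// invr_gt0.
have tau1 : tau <= (2 * N%:R)^-1 by rewrite ge_min lexx.
have tau2 : tau <= C0'%:R^-1 / 2 by rewrite ge_min lexx orbT.
clearbody tau.
pose E1 := C * (N%:R * (4 ^+ d * `|q1|)).
have E10 : 0 <= E1 by rewrite !mulr_ge0// ltW.
exists ((C0' * N)%:R / eta + E1 / tau + 1) => b q l a m theta /andP[q0 qN] bq pl lq lV aX ma em hth.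
have w1 : 0 <= (C0' * N)%:R / eta :> R by rewrite divr_ge0// ltW.
have w2 : 0 <= E1 / tau by rewrite divr_ge0// ltW.
have a1 : 1 <= a%:R :> R by move: aX w1 w2; clear; lra.
have a0 : (0 < a)%N by rewrite -(ltr0n R) (lt_le_trans _ a1).
have a0' : 0 < a%:R :> R by rewrite ltr0n.
have CNm : (C0' * N <= m)%N.
  rewrite -(ler_nat R); apply: le_trans em; rewrite mulrC -ler_pdivrMr//; move: aX w2; clear; lra.
have E1a : E1 / a%:R <= tau.
  rewrite ler_pdivrMr// [leRHS]mulrC -ler_pdivrMr//; move: aX w1; clear; lra.
have l0 := prime_gt0 pl.
(* With this sign the perturbation [del] is never positive, so a phase equal to 1/2, as for [l = 2],
   is not pushed beyond 1/2. *)
wlog bneg : b theta bq hth / theta - b%:~R / q%:R <= 0.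
  move=> H; case: (lerP (theta - b%:~R / q%:R) 0) => [|pos]; first exact: H.
  apply: avg_smallN; apply: (@eq_avg_small _ (fun n => - theta * (psum c d n)%:R)).
    by move=> n; rewrite mulNr.
  apply: (H (- b) (- theta)); first by rewrite abszN.
    by rewrite rmorphN mulNr -opprD normrN.
  by rewrite rmorphN mulNr -opprD oppr_le0 ltW.
set beta := theta - _ in hth bneg.
have /dvdnP[s qE] := lq.
have s0 : (0 < s)%N by move: q0; rewrite qE muln_gt0 => /andP[].
have sN : (s <= N)%N by apply: leq_trans qN; rewrite qE leq_pmulr.
have lN : (l <= N)%N by apply: leq_trans qN; rewrite qE leq_pmull.
have /dvdnP[v VE] := lV.
pose del n := beta * ((psum c d (n + s))%:R - (psum c d n)%:R).
have hdel n : (n + s <= 4 * a)%N -> - tau <= del n <= 0.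
  move=> ns; have /andP[i1 i2] := psum_increment d c1 a0 ns.
  rewrite /del; apply/andP; split; last by rewrite mulr_le0_ge0.
  apply: (@le_trans _ _ (- (E1 / a%:R))); first by rewrite lerN2.
  rewrite -[leRHS]opprK lerN2 -mulNr.
  have -> : E1 / a%:R = (C / a%:R ^+ d.+1) * (N%:R * (4 ^+ d * `|q1| * a%:R ^+ d)).
    have ad0 : 0 < a%:R ^+ d :> R by rewrite exprn_gt0.
    by rewrite /E1 exprS; field; rewrite !gt_eqF.
  apply: ler_pM => //; first by rewrite oppr_ge0.
    by rewrite -(ler0_norm bneg).
  apply: (le_trans i2); apply: (@le_trans _ _ (s%:R * (4 ^+ d * `|q1| * a%:R ^+ d))).
    by rewrite ler_wpM2l// ler_wpM2r ?exprn_ge0// ler_wpM2l ?exprn_ge0// ler_norm.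
  by rewrite ler_wpM2r ?ler_nat// !mulr_ge0// exprn_ge0.
have l0' : 0 < l%:R :> R by rewrite ltr0n.
have s0' : 0 < s%:R :> R by rewrite ltr0n.
have lN' : N%:R^-1 <= l%:R^-1 :> R by rewrite lef_pV2 ?posrE// ler_nat.
have kapE : (2 * N%:R)^-1 = N%:R^-1 / 2 :> R by rewrite invfM mulrC.
have linv : 2 * tau <= l%:R^-1.
  by move: tau1 kapE lN'; clear; lra.
(* The phase modulo 1 is [r / l] up to [del]. As [l] divides [q] and [b] is prime to [q], [r] is not
   0, hence the phase is at least [1 / l] away from the integers. *)
set w := (b %/ l)%Z; set r := (b %% l)%Z.
have bE : b = w * l%:Z + r by exact: divz_eq.
have lz : l%:Z != 0 by rewrite -lt0n in l0 *.
have r_ge0 : 0 <= r by rewrite modz_ge0.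
have r_lt : r < l by rewrite -[X in _ < X]gez0_abs// ltz_mod.
have r_neq0 : r != 0.
  apply/negP => r0.
  have lb : (l %| `|b|)%N by have /dvdz_mod0P : (b %% l)%Z = 0; [exact/eqP|rewrite dvdzE].
  have : (l %| 1)%N by rewrite -(eqP bq) dvdn_gcd lb lq.
  by rewrite dvdn1 => /eqP l1; move: pl; rewrite l1.
pose rho : R := r%:~R / l%:R.
have step n : exists z : int, theta * (psum c d (n + s))%:R - theta * (psum c d n)%:R = rho + del n + z%:~R.
  have [z e] := psum_step n s c0 c1 hV.
  exists (w + b * (v * z)%:Z).
  have eR : (psum c d (n + s))%:R - (psum c d n)%:R = s%:R * (1 + V%:R * z%:R) :> R.
    by rewrite e !natrD !natrM; ring.
  have -> : theta * (psum c d (n + s))%:R - theta * (psum c d n)%:R =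
    b%:~R / q%:R * ((psum c d (n + s))%:R - (psum c d n)%:R) + del n by rewrite /del /beta; ring.
  rewrite eR qE VE rmorphD rmorphM /= !natrM /rho -!pmulrn natrM.
  have -> : b%:~R = w%:~R * l%:R + r%:~R :> R by rewrite {1}bE rmorphD rmorphM.
  by field; rewrite !gt_eqF.
have CsN : (C0' * s <= m)%N by apply: leq_trans CNm; rewrite leq_mul2l sN orbT.
have CsN' : (s <= C0' * s)%N by rewrite leq_pmull.
have hdel' n : (n <= a + m + C0' * s)%N -> - tau <= del n <= 0.
  by move=> hn; apply: hdel; move: hn CsN CsN' ma; clear; lia.
have osc (sh : R) n n' : (a <= n)%N -> (n <= n' <= n + C0' * s)%N -> (n' <= a + m + C0' * s)%N ->
     `|rho - sh + del n' - (rho - sh + del n)| <= C0'%:R^-1.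
  move=> n1 /andP[n2 n3] n4; have h1 := hdel' _ n4; have h2 := hdel' _ (leq_trans n2 n4).
  by move: h1 h2 tau2; rewrite ler_norml; clear; lra.
have r1 : l%:R^-1 <= rho.
  rewrite -[_^-1]mul1r ler_pM2r ?invr_gt0// -[1]/(1%:~R) ler_int.
  by move: r_ge0 r_neq0; clear; lia.
have r2 : rho <= 1 - l%:R^-1.
  have -> : 1 - l%:R^-1 = (l%:R - 1) / l%:R :> R by field; rewrite gt_eqF.
  have h : r%:~R + 1 <= l%:R :> R.
    by rewrite [leRHS]pmulrn -[1 in X in X <= _]/(1%:~R) -intrD ler_int; move: r_lt; clear; lia.
  by rewrite ler_pM2r ?invr_gt0//; move: h; clear; lra.
case: (leP (2 * r) l) => hr.
- have r3 : rho <= 2^-1.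
    have h : 2 * r%:~R <= l%:R :> R by rewrite -[2]/(2%:~R) -intrM [leRHS]pmulrn ler_int.
    by rewrite ler_pdivrMr//; move: h; clear; lra.
  apply: (hW s _ a m (fun n => rho - 0 + del n)) => //; last exact: osc.
  move=> n /andP[n1 n2]; have [z ->] := step n; split.
    by rewrite (_ : _ - _ = z%:~R) ?intr_int//; ring.
  rewrite subr0 ger0_norm; move: (hdel' _ n2) tau1 kapE lN' tau0 r1 r3; clear; lra.
(* Here [2 * r >= l + 1], which leaves a margin [1 / (2 l)] above 1/2 for the negative perturbation,
   so [rho - 1 + del] lies between -1/2 and [- 1 / l]. *)
- have r3 : 2^-1 + tau <= rho.
    have h1 : l%:R + 1 <= 2 * r%:~R :> R.
      by rewrite -[2]/(2%:~R) -intrM [l%:R]pmulrn -[1 in X in X <= _]/(1%:~R) -intrD ler_int; move: hr; clear; lia.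
    apply: (@le_trans _ _ ((l%:R + 1) / 2 / l%:R)); last first.
      by rewrite ler_pM2r ?invr_gt0//; move: h1; clear; lra.
    have -> : (l%:R + 1) / 2 / l%:R = 2^-1 + l%:R^-1 / 2 :> R by field; rewrite gt_eqF.
    by move: linv; clear; lra.
  apply: (hW s _ a m (fun n => rho - 1 + del n)) => //; last exact: osc.
  move=> n /andP[n1 n2]; have [z ->] := step n; split.
    by rewrite (_ : _ - _ = (z + 1)%:~R) ?intr_int// intrD; ring.
  rewrite ler0_norm; move: (hdel' _ n2) tau1 kapE lN' tau0 r2 r3; clear; lra.
Qed.

End NatPolynomial.

(** * Monochromatic sums of selected integers along a natural polynomial *)

Section LatticeSums.
Variable R : realType.

Lemma near_poly_rpoly c d : (0 < c d.+1)%N ->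
  near_poly (fun i x => ((rpoly R c d)^`(i)).[x]) d 1 0 (rpoly R c d).
Proof.
move=> cd; have cd0 : (c d.+1)%:R != 0 :> R by rewrite pnatr_eq0 -lt0n.
have sz : size (rpoly R c d) = d.+2 by apply: size_poly_eq.
split => //; first by rewrite lead_coefE sz coef_poly ltnSn ltr0n.
by move=> i x _ _; rewrite subrr normr0 mul0r.
Qed.

Lemma lead_coef_rpoly c d : (0 < c d.+1)%N -> lead_coef (rpoly R c d) = (c d.+1)%:R.
Proof.
by move=> cd; have [sz _ _ _] := near_poly_rpoly cd; rewrite lead_coefE sz coef_poly ltnSn.
Qed.

Lemma psum_diffs c d (a n : nat) ss : (0 < c d.+1)%N -> (0 < a)%N -> size ss = d.+1 -> (a <= n)%N ->
  `|diffs ss (fun i => (psum c d i)%:R) n - (d.+1)`!%:R * (c d.+1)%:R * \prod_(s <- ss) s%:R|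
   <= 0 * (\prod_(s <- ss) s%:R) / a%:R ^+ d.+1 :> R.
Proof.
move=> cd a0 sz an; rewrite -(lead_coef_rpoly cd).
have -> : diffs ss (fun i => (psum c d i)%:R) n = diffs ss (fun i => ((rpoly R c d)^`(0)).[i%:R]) n.
  by apply: eq_diffs => i; rewrite derivn0 rpolyE.
have := near_poly_diffs (@ltr01 R) (near_poly_rpoly cd) (@tower_poly R (rpoly R c d) d.+1 1).
by apply => //; rewrite ler1n.
Qed.

(** A frequency whose sum is not small lies near a reduced fraction [b / q] with [q] dividing
    [Q * (d+1)! * c d.+1]. If [q > 1], any prime factor [l] of [q] divides [V], and a difference
    with step [q / l] shows that the sum is small after all; if [q = 1] the frequency is near an
    integer, against its bounds. Only the primes of [c d.+1] are asked to divide [V], because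
    [c d.+1] will itself contain a power of [V]. *)
Lemma psum_small d (eps : R) : 0 < eps <= 1 -> exists2 Q : nat, (0 < Q)%N &
  forall (V : nat) (c : nat -> nat), c 0%N = 0%N -> c 1%N = 1%N -> (0 < c d.+1)%N ->
  (forall j, (1 < j < d.+2)%N -> (V %| c j)%N) ->
  (forall l, prime l -> (l %| Q * ((d.+1)`! * c d.+1))%N -> (l %| V)%N) ->
  forall eta : R, 0 < eta -> exists C X0 : R, 0 < C /\ forall (a m : nat) theta, X0 <= a%:R -> (m <= a)%N ->
    eta * a%:R <= m%:R -> C / a%:R ^+ d.+1 <= `|theta| <= 2^-1 ->
    avg_small (fun n => theta * (psum c d n)%:R) a m eps.
Proof.
move=> eps01; have [Q0 Q00 LC] := leading_coefficient d eps01.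
exists (Q0`!); first exact: fact_gt0.
move=> V c c0 c1 cd hV hl eta eta0.
set M := ((d.+1)`! * c d.+1)%N in hl.
have M0 : (0 < M)%N by rewrite muln_gt0 fact_gt0.
have M0' : 0 < M%:R :> R by rewrite ltr0n.
have half0 : 0 < 2^-1 :> R by [].
have [C [X1 [C0 hLC]]] := LC M%:R 0 eta 2^-1 (lexx _) eta0 half0.
pose N := (Q0`! * M)%N.
have N0 : (0 < N)%N by rewrite muln_gt0 fact_gt0.
have CM0 : 0 < C / M%:R by rewrite divr_gt0.
have [X2 hX2] := psum_rational_small c0 c1 hV N0 CM0 eta0 eps01.
exists (C / M%:R + 1), (`|X1| + `|X2| + 2 * (C / M%:R) + 2); split; first by rewrite ltr_wpDl// ltW.
move=> a m theta aX ma em /andP[th1 th2].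
have n1 := normr_ge0 X1; have n2 := normr_ge0 X2; have l1 := ler_norm X1; have l2 := ler_norm X2.
have aX1 : X1 <= a%:R by move: aX n1 n2 l1 l2 CM0; clear; lra.
have aX2 : X2 <= a%:R by move: aX n1 n2 l1 l2 CM0; clear; lra.
have a1 : 1 <= a%:R :> R by move: aX n1 n2 CM0; clear; lra.
have aC : 2 * (C / M%:R) < a%:R by move: aX n1 n2; clear; lra.
have a0' : 0 < a%:R :> R by exact: lt_le_trans a1.
have a0 : (0 < a)%N by rewrite -(ltr0n R).
have ad0 : 0 < a%:R ^+ d.+1 :> R by rewrite exprn_gt0.
have [|//|[D [b [/andP[D0 DQ] hDb]]]] := hLC (fun n => (psum c d n)%:R) a m theta aX1 em th2.
  by move=> ss n sz an; rewrite natrM; exact: psum_diffs.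
have D0' : 0 < D%:R :> R by rewrite ltr0n.
set g := gcdn `|b| (D * M).
have g0 : (0 < g)%N by rewrite gcdn_gt0 muln_gt0 D0 M0 orbT.
have g0' : 0 < g%:R :> R by rewrite ltr0n.
have /dvdnP[q qE] : (g %| D * M)%N by exact: dvdn_gcdr.
have q0 : (0 < q)%N by move: (muln_gt0 D M); rewrite qE muln_gt0 D0 M0 => /andP[].
have q0' : 0 < q%:R :> R by rewrite ltr0n.
have /dvdnP[b1 bE] : (g %| `|b|)%N by exact: dvdn_gcdl.
(* The fraction has to be reduced, since otherwise the residue modulo [l] of the numerator could
   vanish. *)
have cop : coprime b1 q.
  rewrite /coprime; have : (gcdn b1 q * g == 1 * g)%N by rewrite muln_gcdl -bE -qE mul1n.
  by rewrite eqn_pmul2r.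
pose b' := (-1) ^+ (b < 0)%R * b1%:Z.
have b'E : b%:~R = b'%:~R * g%:R :> R.
  by rewrite {1}(intEsign b) bE /b' PoszM mulrA intrM.
have DMg : D%:R * M%:R = q%:R * g%:R :> R by rewrite -!natrM qE.
have thE : b%:~R / D%:R / M%:R = b'%:~R / q%:R :> R.
  have -> : b%:~R / D%:R / M%:R = b%:~R / (D%:R * M%:R) :> R by field; rewrite !gt_eqF.
  by rewrite DMg b'E; field; rewrite !gt_eqF.
have hth : `|theta - b'%:~R / q%:R| <= C / M%:R / a%:R ^+ d.+1.
  have -> : C / M%:R / a%:R ^+ d.+1 = C / a%:R ^+ d.+1 / M%:R by ring.
  rewrite ler_pdivlMr// -[X in _ * X]ger0_norm ?(ltW M0')// -normrM -thE.
  by rewrite (_ : _ * M%:R = theta * M%:R - b%:~R / D%:R)//; field; rewrite !gt_eqF.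
have DQd : (D %| Q0`!)%N by rewrite dvdn_fact// D0.
have qN : (q %| N)%N by apply: (@dvdn_trans (D * M)); [rewrite qE dvdn_mulr|rewrite dvdn_pmul2r].
case: (ltngtP q 1) => [|q1|q1]; first by rewrite ltnS leqNgt q0.
  have pl := pdiv_prime q1; have lq := pdiv_dvd q.
  apply: (hX2 b' q (pdiv q)) => //.
  - by rewrite q0 dvdn_leq.
  - by rewrite /b' abszM absz_sign mul1n.
  - by apply: hl => //; exact: dvdn_trans lq qN.
(* A nonzero integer is too far from [|theta| <= 1/2]; near 0 the lower bound on [|theta|], whose
   constant is [C / M + 1], fails. *)
exfalso; move: hth; rewrite q1 divr1.
have Ca : C / M%:R / a%:R ^+ d.+1 <= C / M%:R / a%:R.
  rewrite ler_pM2l// lef_pV2 ?posrE// exprS ler_peMr ?(ltW a0')// exprn_ege1//.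
have Ca2 : C / M%:R / a%:R < 2^-1 by rewrite ltr_pdivrMr//; move: aC; clear; lra.
case: (eqVneq b' 0) => [->|b'0] hth.
  move: hth; rewrite subr0 => hth.
  have : C / M%:R / a%:R ^+ d.+1 < (C / M%:R + 1) / a%:R ^+ d.+1.
    by rewrite ltr_pM2r ?invr_gt0//; move: (C / M%:R); clear => x; lra.
  by move: th1 hth; clear; lra.
have : 1 <= `|b'%:~R : R|.
  by rewrite -intr_norm -[1]/(1%:~R) ler_int; move: b'0; clear; lia.
by move: hth Ca Ca2 th2; rewrite !ler_norml ler_normr; clear; lra.
Qed.

(** One integer [w i] from every block of 21 forms a set of density 1/21, so one colour has density
    about [1 / (21 k)] in the middle of the range of [psum]. The targets are exact integers, hence
    [J = 1], and the blocks to be avoided are single points. [Q] precedes [V] and [c], as [eps]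
    depends on [d] and [k] only. The last two inequalities are there to make the summands positive
    later. *)
Lemma monochromatic_lattice_sums d k : (0 < k)%N -> exists2 Q : nat, (0 < Q)%N &
  forall (V : nat) (c : nat -> nat), c 0%N = 0%N -> c 1%N = 1%N -> (0 < c d.+1)%N ->
  (forall j, (1 < j < d.+2)%N -> (V %| c j)%N) ->
  (forall l, prime l -> (l %| Q * ((d.+1)`! * c d.+1))%N -> (l %| V)%N) ->
  forall eta : R, 0 < eta -> exists X0 : R, forall (a m : nat), X0 <= a%:R -> (m <= a)%N ->
    eta * a%:R <= m%:R -> forall (w : nat -> nat) (col : nat -> 'I_k),
    (forall i, 21 * i <= w i < 21 * i.+1)%N ->
    exists i i' h, [/\ w i <> w i', col (w i) = col (w i'), (a <= h < a + m)%N,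
      (w i + w i' = psum c d h)%N & (psum c d a <= 2 * w i)%N /\ (psum c d a <= 2 * w i')%N].
Proof.
move=> k0; have k0' : 0 < k%:R :> R by rewrite ltr0n.
have k1' : 1 <= k%:R :> R by rewrite ler1n.
pose delta : R := (16 * k%:R)^-1.
have delta1 : 0 < delta <= 1.
  by rewrite /delta invr_gt0 mulr_gt0//= invf_le1 ?mulr_gt0//; move: k1'; clear; lra.
pose C1 : R := 2 ^+ d.
have C11 : 1 <= C1 by rewrite exprn_ege1//; clear; lra.
have c160 : 0 < 16 * (16 * C1) by move: C11; clear; lra.
pose eps := delta / (16 * (16 * C1)).
have /andP[de0 de1] := delta1.
have eps0 : 0 < eps by apply: divr_gt0.
have eps1 : eps <= 1 by rewrite ler_pdivrMr// mul1r; move: C11 de1; clear; lra.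
have eps01 : 0 < eps <= 1 by rewrite eps0.
have [Q Q0 hQ] := psum_small d eps01; exists Q => // V c c0 c1 cd hV hl eta eta0.
have [C [X1 [C0 hX1]]] := hQ V c c0 c1 cd hV hl eta eta0.
pose K : R := 2 ^+ d * `|((rpoly R c d)^`()).[1]|.
have K0 : 0 <= K by rewrite mulr_ge0 ?exprn_ge0.
pose C3 := C * K + 1.
have C30 : 0 < C3 by rewrite ltr_wpDl// mulr_ge0// ltW.
have [T0 T00 hdense] := dense_sums C11 delta1 (ltn0Sn 0) C30 (@ler01 R).
exists (`|X1| + (T0 + 400) / eta + 1) => a m aX ma em w col hw.
have n1 := normr_ge0 X1; have l1 := ler_norm X1.
have w0 : 0 <= (T0 + 400) / eta by rewrite divr_ge0 ?(ltW eta0)//; move: T00; clear; lra.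
have aX1 : X1 <= a%:R by move: aX n1 l1 w0; clear; lra.
have a1 : 1 <= a%:R :> R by move: aX n1 w0; clear; lra.
have a0 : (0 < a)%N by rewrite -(ltr0n R) (lt_le_trans _ a1).
have Tm : T0 + 400 <= m%:R.
  by apply: le_trans em; rewrite mulrC -ler_pdivrMr//; move: aX n1; clear; lra.
have [mT TK step] := psum_growth R d c1 a0 ma.
set T := _ - _ in mT TK step.
have T400 : T0 + 400 <= T by exact: le_trans mT.
have T0' : 0 < T by move: T400 T00; clear; lra.
set Ba := psum c d a in T mT TK step T400 T0' *.
have Ba0 := ler0n R Ba.
pose lo := (Num.truncn ((Ba%:R + T / 4) / 42)).+1.
pose hi := Num.truncn ((Ba%:R + 3 * T / 4) / 42).
have [lo1 lo2] : Ba%:R + T / 4 <= 42 * lo%:R /\ 42 * lo%:R <= Ba%:R + T / 4 + 42.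
  have /truncn_itv/andP[t1 t2] : 0 <= (Ba%:R + T / 4) / 42.
    by rewrite divr_ge0// addr_ge0// divr_ge0// ltW.
  rewrite /lo; split; first by move: t2; clear; lra.
  by rewrite -(natr1 (Num.truncn _)); move: t1; clear; lra.
have [hi1 hi2] : 42 * hi%:R <= Ba%:R + 3 * T / 4 /\ Ba%:R + 3 * T / 4 <= 42 * hi%:R + 42.
  have /truncn_itv/andP[t1 t2] : 0 <= (Ba%:R + 3 * T / 4) / 42.
    by rewrite divr_ge0// addr_ge0// divr_ge0// mulr_ge0// ltW.
  rewrite /hi; split; first by move: t1; clear; lra.
  by move: t2; rewrite -(natr1 (Num.truncn _)); clear; lra.
clearbody lo hi.
have lohi : T / 256 <= hi%:R - lo%:R by move: lo1 lo2 hi1 hi2 T400 T00; clear; lra.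
have lohi' : (lo <= hi)%N by rewrite -(ler_nat R); move: lohi T0'; clear; lra.
pose N := (21 * hi)%N.
have ltN (i : 'I_(hi - lo)) : (w (lo + i) < N)%N.
  have /andP[_ h] := hw (lo + i)%N; apply: (leq_trans h).
  by rewrite leq_mul2l/=; move: (ltn_ord i); clear; lia.
pose f i : 'I_N := Ordinal (ltN i).
have injf : injective f.
  move=> i i' /(congr1 val)/= e; apply: val_inj => /=.
  by have := hw (lo + i)%N; have := hw (lo + i')%N; rewrite e; clear; lia.
pose X : {set 'I_N} := (f @: [set: 'I_(hi - lo)])%SET.
have cardX : #|X| = (hi - lo)%N by rewrite card_imset// cardsT card_ord.
have [i0 hcol] := pigeonhole_card X (fun x : 'I_N => col x) k0.
set A := [set x in X | _] in hcol.
have AE (x : 'I_N) : x \in A -> exists2 i, (lo <= i < hi)%N & x = w i :> nat /\ col x = i0.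
  rewrite !inE => /andP[/imsetP[i _ ->] /eqP h]; exists (lo + i)%N => //.
  by move: (ltn_ord i) lohi'; clear; lia.
have cardA : delta * T / 16 <= #|A|%:R.
  have h1 : T / 256 <= k%:R * #|A|%:R.
    by apply: (le_trans lohi); rewrite -natrB// -natrM ler_nat -cardX.
  have -> : delta * T / 16 = T / 256 / k%:R by rewrite /delta; field; rewrite gt_eqF.
  by rewrite ler_pdivrMr// [leRHS]mulrC.
have rangeA (x : 'I_N) : x \in A -> Ba%:R + T / 4 <= 2 * x%:R <= Ba%:R + 3 * T / 4.
  move=> /AE[i /andP[i1 i2] [-> _]]; have /andP[h1 h2] := hw i.
  apply/andP; split.
    apply: (le_trans lo1); rewrite -!natrM ler_nat; move: h1 i1; clear; lia.
  apply: le_trans hi1; rewrite -!natrM ler_nat; move: h2 i2; clear; lia.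
have sameA u : \sum_(x in A) \sum_(y in A) ((x + y == u)%N && (x == y :> nat))%:R <= 1 :> R.
  have h : forall x, x \in A -> (2 * (x %% 1) < 1)%N by move=> x _; rewrite modn1.
  apply: le_trans (sum_same_block_le R u (ltn0Sn 0) h).
  by apply: ler_sum => x _; apply: ler_sum => y _; rewrite !divn1.
have small theta t : `|theta| <= 2^-1 -> C3 / T <= `|theta| ->
     `|\sum_(n < m) \sum_(j < 1) cs (theta * (psum c d (a + n) + j)%:R + t)|
        <= delta / (16 * (16 * C1)) * (m * 1)%:R.
  move=> th2 thC; rewrite muln1 -/eps.
  have hth : C / a%:R ^+ d.+1 <= `|theta| <= 2^-1.
    rewrite th2 andbT; apply: le_trans thC.
    rewrite ler_pdivlMr// mulrAC ler_pdivrMr ?exprn_gt0// ?(lt_le_trans ltr01 a1)//.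
    have h1 : T <= K * a%:R ^+ d.+1.
      apply: (le_trans TK); rewrite ler_wpM2r ?exprn_ge0// /K ler_wpM2l ?exprn_ge0//.
      exact: ler_norm.
    apply: (le_trans (ler_wpM2l (ltW C0) h1)); rewrite mulrA ler_wpM2r ?exprn_ge0//.
    by rewrite /C3; clear; lra.
  have := hX1 a m theta aX1 ma em hth t; congr (`| _ | <= _).
  by apply: eq_bigr => n _; rewrite big_ord1 addn0.
have T0T : T0 <= T by move: T400; clear; lra.
have T0m : T0 <= m%:R by move: Tm; clear; lra.
have [x [y [h [j [[xA yA] xy hm j1 e]]]]] :=
  hdense (psum c d) a m N A id T erefl T0T T0m step rangeA cardA sameA small.
have [i _ [xi xc]] := AE x xA; have [i' _ [yi yc]] := AE y yA.
exists i, i', h; rewrite -xi -yi; split => //.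
- by rewrite xc yc.
- by rewrite e; move: j1; rewrite ltnS leqn0 => /eqP ->; rewrite addn0.
- have /andP[r1 _] := rangeA x xA; have /andP[r2 _] := rangeA y yA.
  by split; rewrite -(ler_nat R) natrM; move: r1 r2 T0'; clear; lra.
Qed.

End LatticeSums.

(** * Passing to an arithmetic progression of arguments *)

Section Lattice.
Variable R : realType.

Lemma eventually_pos_poly (q : {poly int}) : 0 < lead_coef q ->
  exists N : nat, forall n : nat, (N <= n)%N -> 0 < q.[n%:Z].
Proof.
elim/poly_ind: q => [|q c IH]; first by rewrite lead_coef0.
case: (eqVneq q 0) => [->|q0] hlead.
  by exists 0%N => n _; move: hlead; rewrite mul0r add0r lead_coefC hornerC.
have [|N hN] := IH.
  move: hlead; rewrite lead_coefDl ?lead_coefMX// size_polyC size_mulX//.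
  by case: (c != 0) => //=; rewrite ltnS lt0n size_poly_eq0.
exists (maxn N (`|c|%N + 1)) => n; rewrite geq_max => /andP[n1 n2].
rewrite !hornerE; have := hN n n1; move: (q.[n%:Z]) => v v0.
have : n%:Z <= v * n%:Z by rewrite ler_peMl//; move: v0; clear; lia.
by move: n2; clear; lia.
Qed.

(** Steps of at most 1/10 cannot jump over a window of length 1/5, and steps of at least 1/20 reach
    it within 20 steps. *)
Lemma rotation_hits_pos (y delta : R) : 20^-1 <= delta <= 10^-1 ->
  exists (j : nat) (z : int), (j < 21)%N /\ z%:~R + 10^-1 <= y + j%:R * delta <= z%:~R + 3 / 10.
Proof.
move=> /andP[d1 d2]; have d0 : 0 < delta by move: d1; clear; lra.
pose z := - Num.floor (- (y - 10^-1)).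
have := floor_itv (- (y - 10^-1)); rewrite -/z intrD => /andP[z1 z2].
have zE : (Num.floor (- (y - 10^-1)))%:~R = - z%:~R :> R by rewrite /z rmorphN opprK.
rewrite zE in z1 z2.
pose t := z%:~R + 10^-1 - y.
have t0 : 0 <= t by rewrite /t; move: z1; clear; lra.
have t1 : t < 1 by rewrite /t; move: z2; clear; lra.
have td0 : 0 <= t / delta by rewrite divr_ge0// ltW.
have /andP[j1 j2] := truncn_itv td0.
set j := Num.truncn _ in j1 j2.
rewrite ler_pdivlMr// in j1; rewrite ltr_pdivrMr// in j2.
exists j.+1, z; split.
  rewrite ltnS -(ltr_nat R).
  have : j%:R * 20^-1 <= j%:R * delta by rewrite ler_wpM2l.
  by move: j1 t1; clear; lra.
by rewrite -natr1 mulrDl mul1r; move: j1 j2 d2; rewrite /t -natr1 mulrDl mul1r; clear; lra.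
Qed.

Lemma rotation_hits (y delta : R) : 20^-1 <= `|delta| <= 10^-1 ->
  exists (j : nat) (z : int), (j < 21)%N /\ z%:~R + 10^-1 <= y + j%:R * delta <= z%:~R + 3 / 10.
Proof.
case: (ger0P delta) => _ hd; first exact: rotation_hits_pos.
(* The window is symmetric about 1/5, so reflection in this point reverses the rotation. *)
have [j [z [j21 hz]]] := rotation_hits_pos (4 / 10 - y) hd.
by exists j, (- z); split => //; rewrite rmorphN; move: hz; rewrite mulrN /=; clear; lra.
Qed.

Definition syndetic_bohr (xi gam : R) := forall i, exists u : nat, (21 * i <= u < 21 * i.+1)%N /\
   exists z : int, z%:~R + 10^-1 <= xi + gam * u%:R <= z%:~R + 3 / 10.

Lemma syndetic_bohr_rotation (xi gam : R) (b : int) : 20^-1 <= `|gam - b%:~R| <= 10^-1 ->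
  syndetic_bohr xi gam.
Proof.
move=> h i; have [j [z [j21 hz]]] := rotation_hits (xi + gam * (21 * i)%:R) h.
exists (21 * i + j)%N; split; first by move: j21; clear; lia.
exists (z + b * j%:Z); rewrite intrD intrM -pmulrn.
by move: hz; rewrite natrD; clear; lra.
Qed.

(** The summands are [floor (xi + gam * w i)]. Distinct [w i] give distinct summands because
    [gam >= 1] while the fractional parts differ by at most 1/5; positivity comes from
    [B a <= 2 * w i] and the lower bound at [a]. The doubled window [[1/5, 3/5]] contains no
    integer, hence no carry. *)
Lemma sums_of_lattice (alpha : R -> R) (B : nat -> nat) n0 W (xi gam : R) a m k (col : nat -> 'I_k) (w : nat -> nat) :
  (0 < a)%N -> (0 < W)%N -> 1 <= gam -> 2 <= 2 * xi + gam * (B a)%:R ->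
  (forall h (s : int), (a <= h < a + m)%N -> s%:~R + 5^-1 <= 2 * xi + gam * (B h)%:R <= s%:~R + 3 / 5 ->
     Num.floor (alpha (n0 + W * h)%:R) = s) ->
  (forall i, exists z : int, z%:~R + 10^-1 <= xi + gam * (w i)%:R <= z%:~R + 3 / 10) ->
  (exists i i' h, [/\ w i <> w i', col `|Num.floor (xi + gam * (w i)%:R)|%N = col `|Num.floor (xi + gam * (w i')%:R)|%N,
     (a <= h < a + m)%N, (w i + w i' = B h)%N & (B a <= 2 * w i)%N /\ (B a <= 2 * w i')%N]) ->
  monochromatic_floor_sum alpha col.
Proof.
move=> a0 W0 gam1 h2 hfl hw [i [i' [h [wi wc hh wB [b1 b2]]]]].
have gam0 : 0 < gam by exact: lt_le_trans gam1.
have [z hz] := hw i; have [z' hz'] := hw i'.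
have fl (u : R) (t : int) : t%:~R + 10^-1 <= u <= t%:~R + 3 / 10 -> Num.floor u = t.
  by move=> ht; apply: floor_def; rewrite intrD; move: ht; clear; lra.
rewrite (fl _ _ hz) (fl _ _ hz') in wc.
have pos (t : int) u : (B a <= 2 * u)%N -> t%:~R + 10^-1 <= xi + gam * u%:R <= t%:~R + 3 / 10 -> 0 < t.
  move=> hu ht; rewrite -(ltr0z R).
  have : (B a)%:R <= 2 * u%:R :> R by rewrite -natrM ler_nat.
  rewrite -(ler_pM2l gam0) mulrCA => hu'.
  by move: ht h2 hu'; clear; lra.
have z0 := pos _ _ b1 hz; have z'0 := pos _ _ b2 hz'.
have zz' : z <> z'.
  move=> e; rewrite -e in hz'; apply: wi.
  have wle (u v : nat) : z%:~R + 10^-1 <= xi + gam * u%:R <= z%:~R + 3 / 10 ->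
      z%:~R + 10^-1 <= xi + gam * v%:R <= z%:~R + 3 / 10 -> (u <= v)%N.
    move=> hu hv; rewrite leqNgt; apply/negP => vu.
    have : v%:R + 1 <= u%:R :> R by rewrite natr1 ler_nat.
    rewrite -(ler_pM2l gam0) mulrDr mulr1 => huv.
    by move: hu hv gam1 huv; clear; lra.
  by apply/eqP; rewrite eqn_leq !wle.
exists `|z|%N, `|z'|%N, (n0 + W * h)%N; split => //.
- split; [by move: z0; clear; lia|by move: z'0; clear; lia|].
  by case/andP: (hh) => h1 _; rewrite addn_gt0 muln_gt0 W0 (leq_trans a0 h1) orbT.
- by move: z0 z'0 zz'; clear; lia.
rewrite (hfl h (z + z')) //.
  by move: z0 z'0; clear; lia.
have -> : 2 * xi + gam * (B h)%:R = (xi + gam * (w i)%:R) + (xi + gam * (w i')%:R).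
  by rewrite -wB natrD; ring.
by rewrite intrD; move: hz hz'; clear; lra.
Qed.

(** Coefficients in [h] of the sum of [b j * (b 1 * V * h) ^ j] over [j >= 1], divided by
    [b 1 ^ 2 * V]: the linear one becomes 1 and the higher ones are multiples of [V]. *)
Definition lattice_coef (b : nat -> nat) (V j : nat) :=
  if j == 0%N then 0%N else if j == 1%N then 1%N else (b j * b 1%N ^ (j - 2) * V ^ j.-1)%N.

(* Along [n0 + b 1 V h], with [b j] the Taylor coefficients of [p] at [n0], the polynomial [p]
   runs through the multiples by [b 1 ^ 2 V] of the values of a polynomial congruent to [h] mod [V]. *)
Lemma lattice_substitution (p : {poly int}) d (b : nat -> nat) (n0 V h : nat) : size p = d.+2 ->
  (forall j, (0 < j < d.+2)%N -> (p^`N(j)).[n0%:Z] = b j) ->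
  p.[(n0 + b 1%N * V * h)%N%:Z] = p.[n0%:Z] + (b 1%N ^ 2 * V * psum (lattice_coef b V) d h)%N%:Z.
Proof.
move=> sp hb; rewrite PoszD nderiv_taylor; last exact: mulrC.
rewrite sp big_ord_recl nderivn0 expr0 mulr1; congr (_ + _).
rewrite /psum [in RHS]big_ord_recl /= mul0n add0n.
rewrite big_distrr (big_morph Posz PoszD (erefl (Posz 0)))/=; apply: eq_bigr => j _.
have j1 : (0 < lift ord0 j < d.+2)%N by rewrite ltn_ord.
rewrite (hb _ j1) -!natz -natrX -natrM; congr (_%:R).
rewrite lift0 /lattice_coef /=; case: (nat_of_ord j) => [|i] /=; first by rewrite !expn1; ring.
by rewrite !subSS subn0 !expnMn !expnS; ring.
Qed.

(* The summands are sought of the form [floor (xi + gam * K * u)]; as the fractional parts are kept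
   in [1/10, 3/10], two of them add up without a carry. *)
Definition progression_criterion (F0 : R -> R) (p : {poly int}) (gam : R) k (col : nat -> 'I_k)
    (n0 K W : nat) (eta Y1 : R) := forall Y xi : R, Y1 <= Y -> 1 <= gam * K%:R ->
  syndetic_bohr xi (gam * K%:R) ->
  (forall n h : nat, n = (n0 + W * h)%N -> Y <= n%:R <= (1 + eta) * Y ->
     let v := 2 * xi + gam * (p.[n%:Z] - p.[n0%:Z])%:~R in
     2 <= v /\ forall s : int, s%:~R + 5^-1 <= v <= s%:~R + 3 / 5 -> Num.floor (F0 n%:R) = s) ->
  monochromatic_floor_sum F0 col.

(** For [n0] large all Taylor coefficients of [p] at [n0] are positive integers, so the substituted
    polynomial has natural coefficients. The multiplier [M] remains free, because enlarging [V]
    keeps every divisibility that is needed; it will be used to place [gam * G * M] modulo 1. *)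
Lemma progression_criterion_eventually (F0 : R -> R) d (p : {poly int}) (gam : R) k (col : nat -> 'I_k) :
  (0 < k)%N -> size p = d.+2 -> 0 < lead_coef p -> 0 < gam ->
  exists N0 : nat, forall n0, (N0 <= n0)%N -> exists G W0 : nat, [/\ (0 < G)%N, (0 < W0)%N &
    forall M eta, (0 < M)%N -> 0 < eta <= 1 ->
    exists Y1 : R, progression_criterion F0 p gam col n0 (G * M) (W0 * M) eta Y1].
Proof.
move=> k0 sp lp gam0; have [Q Q0 hQ] := monochromatic_lattice_sums R d k0.
have lpd (j : nat) : (j < d.+2)%N -> exists N : nat, forall n : nat, (N <= n)%N -> 0 < (p^`N(j)).[n%:Z].
  move=> jd; apply: eventually_pos_poly.
  have topc : (p^`N(j))`_(d.+1 - j) = lead_coef p *+ 'C(d.+1, j).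
    by rewrite coef_nderivn lead_coefE sp subnKC.
  have top0 : 0 < (p^`N(j))`_(d.+1 - j) by rewrite topc pmulrn_lgt0// bin_gt0.
  have sz : size (p^`N(j)) = (d.+1 - j).+1.
    apply/eqP; rewrite eqn_leq; apply/andP; split.
      apply/leq_sizeP => i hi; rewrite coef_nderivn nth_default ?mul0rn// sp.
      by move: hi jd; clear; lia.
    rewrite ltnNge; apply/negP => /leq_sizeP/(_ _ (leqnn _)) e.
    by rewrite e ltxx in top0.
  by rewrite lead_coefE sz.
have /choice[N hN] : forall j, exists N : nat, (j < d.+2)%N -> forall n : nat, (N <= n)%N -> 0 < (p^`N(j)).[n%:Z].
  move=> j; case: (ltnP j d.+2) => jd; last by exists 0%N.
  by have [Nj hNj] := lpd j jd; exists Nj => _.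
exists (\sum_(j < d.+2) N j)%N => n0 n0N.
pose b j := `|(p^`N(j)).[n0%:Z]|%N.
have hpos j : (j < d.+2)%N -> 0 < (p^`N(j)).[n0%:Z].
  move=> jd; apply: hN => //; apply: leq_trans n0N.
  by rewrite (bigD1 (Ordinal jd))//= leq_addr.
have hb j : (0 < j < d.+2)%N -> (p^`N(j)).[n0%:Z] = b j.
  by move=> /andP[_ jd]; rewrite gez0_abs// ltW// hpos.
have b0 j : (j < d.+2)%N -> (0 < b j)%N by move=> jd; rewrite absz_gt0 gt_eqF// hpos.
(* The coefficient of degree [d + 1] is a product of [b d.+1] with powers of [b 1] and of [V], or is
   1, so with [Q] and the factorial [V0] contains every prime that can occur. *)
pose V0 := (Q * ((d.+1)`! * b d.+1) * b 1%N)%N.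
have b10 : (0 < b 1)%N by exact: b0.
have V00 : (0 < V0)%N by rewrite !muln_gt0 Q0 fact_gt0 b0.
have G0 : (0 < b 1%N ^ 2 * V0)%N by rewrite muln_gt0 V00 andbT expn_gt0 b10.
have bV0 : (0 < b 1%N * V0)%N by rewrite muln_gt0 V00 b10.
exists (b 1%N ^ 2 * V0)%N, (b 1%N * V0)%N; split => //.
move=> M eta M0 /andP[eta0 eta1].
pose V := (V0 * M)%N; pose c := lattice_coef b V.
have V0' : (0 < V)%N by rewrite muln_gt0 V00.
have cd : (0 < c d.+1)%N.
  rewrite /c /lattice_coef /=; case: eqP => // _.
  by rewrite muln_gt0 expn_gt0 V0' /= andbT muln_gt0 b0//= expn_gt0 b10.
have cV j : (1 < j < d.+2)%N -> (V %| c j)%N.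
  case: j => [|[|j]]//= _; rewrite /c /lattice_coef /=.
  by rewrite dvdn_mull// expnS dvdn_mulr.
have hl l : prime l -> (l %| Q * ((d.+1)`! * c d.+1))%N -> (l %| V)%N.
  move=> pl; have lV0 x : (l %| x)%N -> (x %| V0)%N -> (l %| V)%N.
    by move=> lx xV; rewrite /V dvdn_mulr// (dvdn_trans lx).
  rewrite Euclid_dvdM// => /orP[lQ|]; last rewrite Euclid_dvdM// => /orP[lf|].
  - by apply: (lV0 Q) => //; rewrite /V0 -mulnA dvdn_mulr.
  - by apply: (lV0 (d.+1)`!) => //; rewrite /V0 -mulnA dvdn_mull// -mulnA dvdn_mulr.
  rewrite /c /lattice_coef /=; case: eqP => _.
    by rewrite dvdn1 => /eqP l1; move: pl; rewrite l1.
  rewrite Euclid_dvdM// Euclid_dvdM// !Euclid_dvdX// => /orP[/orP[lb|/andP[lb _]]|/andP[//]].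
  - by apply: (lV0 (b d.+1)) => //; rewrite /V0 mulnA dvdn_mulr// dvdn_mull.
  - by apply: (lV0 (b 1%N)) => //; rewrite /V0 dvdn_mull.
have eta4 : 0 < eta / 4 by rewrite divr_gt0.
have [X0 hX0] := hQ V c erefl erefl cd cV hl _ eta4.
pose W := (b 1%N * V)%N.
have W0 : (0 < W)%N by rewrite muln_gt0 b10.
have W0' : 0 < W%:R :> R by rewrite ltr0n.
exists (W%:R * `|X0| + 8 * ((W + n0)%:R / eta) + 1) => Y xi Y1 gam1 hw hn.
have [w hw'] := choice hw.
have w1 : 0 <= W%:R * `|X0| by rewrite mulr_ge0.
have w2 : 0 <= (W + n0)%:R / eta by rewrite divr_ge0// ltW.
have Y0 : 0 < Y by move: Y1 w1 w2; clear; lra.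
have YW : 8 * (W + n0)%:R <= Y * eta.
  by rewrite -ler_pdivrMr// -mulrA; move: Y1 w1; clear; lra.
(* These choices keep [n0 + W * h] between [Y] and [(1 + eta) * Y] for [a <= h <= a + m]; half of
   [eta] is reserved for [n0] and the rounding. *)
pose a := (Num.truncn (Y / W%:R)).+1; pose m := Num.truncn (eta * Y / (2 * W%:R)).
have [a1 a2] : Y < W%:R * a%:R /\ W%:R * a%:R <= Y + W%:R.
  have /truncn_itv/andP[t1 t2] : 0 <= Y / W%:R by rewrite divr_ge0// ltW.
  rewrite ler_pdivlMr// in t1; rewrite ltr_pdivrMr// in t2.
  by split; [rewrite mulrC|rewrite /a -natr1 mulrDr mulr1 lerD2r mulrC].
have [m1 m2] : 2 * (W%:R * m%:R) <= eta * Y /\ eta * Y <= 2 * (W%:R * m%:R) + 2 * W%:R.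
  have W20 : 0 < 2 * W%:R :> R by rewrite mulr_gt0.
  have /truncn_itv/andP[t1 t2] : 0 <= eta * Y / (2 * W%:R) by rewrite divr_ge0 ?mulr_ge0// ltW.
  rewrite ler_pdivlMr// in t1; rewrite ltr_pdivrMr// -natr1 in t2.
  by split; move: t1 t2; rewrite /m; clear; lra.
have a0 : (0 < a)%N by [].
clearbody a m.
rewrite natrD in YW; have n00 := ler0n R n0.
have aX0 : X0 <= a%:R.
  rewrite -(ler_pM2l W0'); apply: le_trans (ltW a1).
  have : W%:R * X0 <= W%:R * `|X0| by rewrite ler_pM2l// ler_norm.
  by move: Y1 w2; clear; lra.
have etaY : eta * Y <= Y by rewrite ler_piMl// ltW.
have ma : (m <= a)%N.
  by rewrite -(ler_nat R) -(ler_pM2l W0'); move: m1 a1 etaY Y0; clear; lra.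
have em : eta / 4 * a%:R <= m%:R.
  rewrite -(ler_pM2l W0') mulrCA.
  have h1 : eta / 4 * (W%:R * a%:R) <= eta / 4 * (Y + W%:R) by rewrite ler_pM2l.
  have h2 : eta * W%:R <= W%:R by rewrite ler_piMl// ltW.
  have h3 : eta / 4 * (Y + W%:R) = eta * Y / 4 + eta * W%:R / 4 by ring.
  rewrite h3 in h1; apply: (le_trans h1).
  by move: W0' h2 m2 YW n00; rewrite [Y * eta]mulrC; clear; lra.
have sub h : gam * (p.[(n0 + W * h)%N%:Z] - p.[n0%:Z])%:~R
    = gam * (b 1%N ^ 2 * V0 * M)%:R * (psum c d h)%:R.
  rewrite /W (lattice_substitution V h sp hb) addrAC subrr add0r -pmulrn -mulrA -natrM.
  by rewrite /V mulnA.
have win h : (a <= h <= a + m)%N -> Y <= (n0 + W * h)%:R <= (1 + eta) * Y.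
  move=> /andP[h1 h2]; rewrite natrD natrM.
  have h3 : W%:R * a%:R <= W%:R * h%:R :> R by rewrite ler_pM2l// ler_nat.
  have h4 : W%:R * h%:R <= W%:R * (a + m)%:R :> R by rewrite ler_pM2l// ler_nat.
  rewrite natrD mulrDr in h4.
  move: h3 h4 n00 YW a1 a2 m1; clear; lra.
have hn' h : (a <= h <= a + m)%N -> let v := 2 * xi + gam * (b 1%N ^ 2 * V0 * M)%:R * (psum c d h)%:R in
    2 <= v /\ forall s : int, s%:~R + 5^-1 <= v <= s%:~R + 3 / 5 -> Num.floor (F0 (n0 + W * h)%:R) = s.
  move=> hh; rewrite -sub; apply: (hn _ h) => //; last exact: win.
  by rewrite /W /V mulnA.
apply: (@sums_of_lattice F0 (psum c d) n0 W xi (gam * (b 1%N ^ 2 * V0 * M)%:R) a m k col w) => //.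
- by have [] := hn' a _; rewrite ?leqnn ?leq_addr.
- move=> h s /andP[h1 h2]; have [|_ +] := hn' h; first by rewrite h1 ltnW.
  exact.
- by move=> i; have [] := hw' i.
- by apply: (hX0 a m aX0 ma em w (fun u => col `|Num.floor (xi + gam * (b 1%N ^ 2 * V0 * M)%:R * u%:R)|%N)) => i; have [] := hw' i.
Qed.

End Lattice.

(** * The case of rational coefficient ratios *)

Section RationalRatio.
Variable R : realType.
Implicit Types (F : nat -> R -> R) (P : {poly R}) (A x y X : R).

Lemma rational_ratio_poly P d : size P = d.+2 -> 0 < lead_coef P ->
  (forall l, (0 < l < d.+2)%N -> rational (P`_l / lead_coef P)) ->
  exists (gam : R) (p : {poly int}), [/\ 0 < gam, size p = d.+2, 0 < lead_coef p &
    forall n : nat, P.[n%:R] = P`_0 + gam * (p.[n%:Z])%:~R].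
Proof.
move=> sP lP rat; have [|q q0 hq] := @common_denominator R d.+2 (fun l => P`_l / lead_coef P) (fun l => (0 < l)%N).
  by move=> l ld l0; apply: rat; rewrite l0.
have q0' : 0 < q%:R :> R by rewrite ltr0n.
pose f l := Num.floor (q%:R * (P`_l / lead_coef P)).
pose p : {poly int} := \poly_(l < d.+2) (if l == 0%N then 0 else f l).
have fd : f d.+1 = q.
  have ld : P`_d.+1 = lead_coef P by rewrite lead_coefE sP.
  by rewrite /f ld divff ?gt_eqF// mulr1 pmulrn intrKfloor.
have szp : size p = d.+2 by apply: size_poly_eq => /=; rewrite fd; move: q0; clear; lia.
exists (lead_coef P / q%:R), p; split => //.
- by rewrite divr_gt0.
- by rewrite lead_coefE szp coef_poly ltnSn/= fd; move: q0; clear; lia.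
move=> n; rewrite horner_coef sP big_ord_recl expr0 mulr1; congr (_ + _).
rewrite horner_poly [in RHS]big_ord_recl /= mul0r add0r rmorph_sum mulr_sumr; apply: eq_bigr => l _.
rewrite /bump /= ?add1n rmorphM rmorphXn /= -pmulrn mulrA; congr (_ * _).
have -> : (f l.+1)%:~R = q%:R * (P`_l.+1 / lead_coef P) :> R.
  by apply/eqP; rewrite -intrEfloor; apply: hq => //; rewrite ltnS.
by field; rewrite !gt_eqF.
Qed.

Lemma dvd_horner_sub (p : {poly int}) (x m : int) : exists t, p.[x + m] - p.[x] = m * t.
Proof.
elim/poly_ind: p => [|p c [t e]]; first by exists 0; rewrite !horner0 subrr mulr0.
exists (t * (x + m) + p.[x]); rewrite !hornerE.
have -> : p.[x + m] = p.[x] + m * t by rewrite -e; ring.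
by ring.
Qed.

Definition constant_sign (f : R -> R) A := (forall x, A <= x -> 0 <= f x) \/ (forall x, A <= x -> f x <= 0).

(** A monotone function that tends to 0 has constant sign, opposite to that of its derivative. *)
Lemma constant_sign_primitive (f g : R -> R) A : (forall x, A <= x -> is_derive x 1 f (g x)) ->
  (forall eps, 0 < eps -> exists B, forall x, B <= x -> `|f x| <= eps) ->
  constant_sign g A -> constant_sign f A.
Proof.
move=> df lim; have mv x y : A <= x -> x <= y -> exists2 z, x <= z <= y & f y - f x = g z * (y - x).
  exact: (@mean_value _ _ _ A).
have far x eps : 0 < eps -> exists2 y, x <= y & `|f y| <= eps.
  move=> /lim[B hB]; exists (Num.max x B); first by rewrite le_max lexx.
  by apply: hB; rewrite le_max lexx orbT.
case=> sg; [right|left] => x Ax; rewrite leNgt; apply/negP => fx.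
  have e0 : 0 < f x / 2 by rewrite divr_gt0.
  have [y xy hy] := far x _ e0; have [z /andP[z1 z2] e] := mv x y Ax xy.
  have : 0 <= g z * (y - x) by rewrite mulr_ge0 ?subr_ge0// sg// (le_trans Ax).
  by move: hy fx; rewrite -e ler_norml; clear; lra.
have e0 : 0 < - f x / 2 by rewrite divr_gt0// oppr_gt0.
have [y xy hy] := far x _ e0; have [z /andP[z1 z2] e] := mv x y Ax xy.
have : g z * (y - x) <= 0 by rewrite mulr_le0_ge0 ?subr_ge0// sg// (le_trans Ax).
by move: hy fx; rewrite -e ler_norml; clear; lra.
Qed.

Lemma eventually_const (g : R -> int) A (k : nat) :
  (forall x y, A <= x -> x <= y -> g x <= g y) -> (forall x, A <= x -> g x <= g A + k%:Z) ->
  exists2 B, A <= B & forall x, B <= x -> g x = g B.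
Proof.
elim: k A => [|k IH] A mono bnd.
  exists A => // x Ax; apply: le_anti; rewrite (mono A x)// andbT.
  by have := bnd x Ax; rewrite addr0.
have [[x Ax gx]|h] := pselect (exists2 x, A <= x & g A < g x); last first.
  exists A => // x Ax; apply: le_anti; rewrite (mono A x)// andbT leNgt.
  by apply/negP => gx; apply: h; exists x.
have [||B xB hB] := IH x.
- by move=> y z xy; apply: mono; exact: le_trans xy.
- by move=> y xy; have := bnd y (le_trans Ax xy); move: gx; clear; lia.
by exists B => //; exact: le_trans xB.
Qed.

(** At order [d + 2] the polynomial has disappeared and [F d.+2] has constant sign. The differences
    of lower order tend to 0, so the sign passes down to order 1. Thus the error is monotone beyond
    [A]. *)
Lemma near_poly_sign F d A Ce P : growth F d.+1 A -> near_poly F d A Ce P ->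
  constant_sign (fun x => F 1%N x - (P^`(1)).[x]) A.
Proof.
move=> gF [sP lP Ce0 hE]; have A0 := growth_gt0 gF.
have tE : tower (fun i x => F i x - (P^`(i)).[x]) d.+3 A.
  by apply: towerB; [exact: growth_tower gF|exact: tower_poly].
suff h j : (j <= d.+1)%N -> constant_sign (fun x => F (d.+2 - j)%N x - (P^`(d.+2 - j)).[x]) A.
  by have := h d.+1 (leqnn _); rewrite subSn// subnn.
elim: j => [_|j IH jd].
  have P0 x : (P^`(d.+2)).[x] = 0.
    suff -> : P^`(d.+2) = 0 by rewrite horner0.
    by apply: derivn_poly0; rewrite sP.
  rewrite subn0; case: (growth_sign gF) => sg; [left|right] => x Ax; rewrite P0 subr0; exact: sg.
have e : (d.+2 - j = (d.+2 - j.+1).+1)%N by move: jd; clear; lia.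
have i1 : (0 < d.+2 - j.+1 <= d.+1)%N by move: jd; clear; lia.
have := IH (ltnW jd); rewrite e; apply: constant_sign_primitive.
  by move=> x Ax; apply: tE => //; move: jd; clear; lia.
move=> eps eps0; exists (A + 1 + Ce / eps) => x hx.
have w : 0 <= Ce / eps by rewrite divr_ge0// ltW.
have Ax : A <= x by move: hx w; clear; lra.
have x1 : 1 <= x by move: hx w A0; clear; lra.
have x0 : 0 < x by exact: lt_le_trans x1.
apply: (le_trans (hE _ _ i1 Ax)); rewrite ler_pdivrMr ?exprn_gt0//.
apply: (@le_trans _ _ (eps * x)).
  by rewrite mulrC -ler_pdivrMr//; move: hx A0; clear; lra.
rewrite ler_pM2l//; case: (d.+2 - j.+1)%N i1 => // i _.
by rewrite exprS ler_peMr ?(ltW x0)// exprn_ege1.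
Qed.

(** The summands need [xi + gam * K * u] to have fractional part in the window for a syndetic set of
    [u]. For irrational [gam] a suitable [K] makes this a rotation, and every [xi] will do. For
    rational [gam] take [gam * K] an integer; then [xi] itself must lie in the window, and [2 * xi]
    is tied to the value of the slowly varying part. An unbounded error can be steered to the right
    value. A bounded one cannot, and only there is the evenness assumption used. *)
Lemma monochromatic_sums_of_rational F d A Ce P k (col : nat -> 'I_k) :
  growth F d.+1 A -> near_poly F d A Ce P ->
  (forall l, (0 < l < d.+2)%N -> rational (P`_l / lead_coef P)) ->
  (forall M, exists B, forall x, B <= x -> M <= F 0%N x) ->
  (forall N : nat, exists2 n, (N <= n)%N & (2 %| Num.floor (F 0%N n%:R))%Z) ->
  monochromatic_floor_sum (F 0%N) col.
Proof.
move=> gF nP rat Finf even.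
have k0 : (0 < k)%N by case: k col => // col; case: (col 0%N).
have A0 := growth_gt0 gF; have [sP lP Ce0 hE] := nP.
have sg := near_poly_sign gF nP.
have [gam [p [gam0 sp lp PE]]] := rational_ratio_poly sP lP rat.
have [N0 hN0] := progression_criterion_eventually (F 0%N) col k0 sp lp gam0.
pose e x := F 0%N x - P.[x].
have de x : A <= x -> is_derive x 1 e (F 1%N x - (P^`(1)).[x]).
  move=> Ax; apply: (@is_deriveB R R R (F 0%N) (fun y => P.[y])).
    by apply: (growth_tower gF).
  by rewrite derivn1; exact: is_derive_poly.
have mv x y : A <= x -> x <= y -> exists2 z, x <= z <= y & e y - e x = (F 1%N z - (P^`(1)).[z]) * (y - x).
  exact: (@mean_value _ _ _ A).
have eL x y : A <= x -> x <= y -> `|e y - e x| <= Ce * ((y - x) / x).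
  move=> Ax xy; have [z /andP[z1 z2] ->] := mv x y Ax xy.
  have x0 : 0 < x by exact: lt_le_trans Ax.
  have -> : Ce * ((y - x) / x) = Ce / x * (y - x) by ring.
  rewrite normrM [`|y - x|]ger0_norm ?subr_ge0// ler_wpM2r ?subr_ge0//.
  have h01 : (0 < 1 <= d.+1)%N by [].
  apply: (le_trans (hE _ _ h01 (le_trans Ax z1))); rewrite expr1 ler_wpM2l//.
  by rewrite lef_pV2 ?posrE// (lt_le_trans x0).
have FE (n : nat) : F 0%N n%:R = P`_0 + gam * (p.[n%:Z])%:~R + e n%:R by rewrite /e PE; ring.
have [B3 hB3] := Finf 3.
(* Over the window the error changes by at most [Ce * eta <= 1/10], and [[1/5, 3/5]] widened by 1/10
   still avoids the integers. *)
pose eta := (10 * (Ce + 1))^-1.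
have eta01 : 0 < eta <= 1.
  by rewrite invr_gt0 invf_le1 ?mulr_gt0 ?ltr_wpDl//; move: Ce0; clear; lra.
have Ceta : Ce * eta <= 10^-1.
  have -> : Ce * eta = 10^-1 * (Ce / (Ce + 1)) by rewrite /eta; field; move: Ce0; clear; lra.
  by rewrite ler_piMr// ler_pdivrMr ?mul1r ?ltr_wpDl// lerDl.
(* If the error barely changes over the window, it can be frozen at its left end [Y]. *)
have frozen n0 K W Y1 : 1 <= gam * K%:R -> progression_criterion (F 0%N) p gam col n0 K W eta Y1 ->
  forall Y xi, Y1 <= Y -> A <= Y -> B3 <= Y -> 2 * xi = P`_0 + gam * (p.[n0%:Z])%:~R + e Y ->
  syndetic_bohr xi (gam * K%:R) ->
  monochromatic_floor_sum (F 0%N) col.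
  move=> gam1 hY Y xi Y1Y AY BY xiE hxi; apply: (hY Y xi) => // n h _ /andP[n1 n2] v.
  have Y0 : 0 < Y by exact: lt_le_trans AY.
  have dlt : `|e n%:R - e Y| <= 10^-1.
    apply: (le_trans (eL _ _ AY n1)); apply: le_trans Ceta; rewrite ler_wpM2l//.
    by rewrite ler_pdivrMr//; move: n2; clear; lra.
  have vE : v = F 0%N n%:R - (e n%:R - e Y) by rewrite /v xiE FE intrB; ring.
  have F3 : 3 <= F 0%N n%:R by apply: hB3; exact: le_trans n1.
  rewrite vE; move: dlt; rewrite ler_norml => dlt; split; first by move: F3 dlt; clear; lra.
  by move=> s hs; apply: floor_def; rewrite intrD; move: hs dlt; clear; lra.
have [[q q0 gq]|irr] := pselect (rational gam); last first.
  have [G [W0 [G0 W00 hG]]] := hN0 N0 (leqnn _).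
  have gG0 : 0 < gam * G%:R by rewrite mulr_gt0// ltr0n.
  have [M1 hM1] := nat_ge (gam * G%:R)^-1.
  have M10' : 0 < M1%:R :> R by apply: lt_le_trans hM1; rewrite invr_gt0.
  have M10 : (0 < M1)%N by rewrite -(ltr0n R).
  (* The rotation number gets within 1/20 of an integer; its smallest multiple exceeding 1/20 is
     then at most 1/10. *)
  have [D [b [/andP[D0 DQ] hDb]]] := dirichlet (gam * (G * M1)%:R) (ltn0Sn 19).
  set del := _ - _ in hDb.
  have del0 : 0 < `|del|.
    rewrite normr_gt0; apply/eqP => del0; apply: irr; exists (D * (G * M1))%N.
      by rewrite !muln_gt0 D0 G0.
    have -> : (D * (G * M1))%:R * gam = b%:~R; last exact: intr_int.
    by apply/eqP; rewrite -subr_eq0 -del0 /del !natrM; apply/eqP; ring.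
  pose i := (Num.truncn (20^-1 / `|del|)).+1.
  have [i1 i2] : 20^-1 <= i%:R * `|del| /\ i%:R * `|del| <= 10^-1.
    have /truncn_itv/andP[t1 t2] : 0 <= 20^-1 / `|del| by rewrite divr_ge0.
    rewrite ler_pdivlMr// in t1; rewrite ltr_pdivrMr// in t2.
    split; first exact: ltW.
    by rewrite /i -natr1 mulrDl mul1r; move: t1 hDb; clear; lra.
  have i0 : (0 < i)%N by [].
  pose M := (M1 * D * i)%N.
  have M0 : (0 < M)%N by rewrite !muln_gt0 M10 D0.
  have gam1 : 1 <= gam * (G * M)%:R.
    have h1 : 1 <= gam * (G * M1)%:R.
      by rewrite natrM mulrA -ler_pdivrMl// mulr1.
    apply: (le_trans h1); rewrite ler_pM2l// ler_nat leq_mul2l /M -mulnA leq_pmulr ?orbT//.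
    by rewrite muln_gt0 D0.
  have [Y1 hY1] := hG M eta M0 eta01.
  pose Y := `|Y1| + `|B3| + A.
  have n1 := normr_ge0 Y1; have n2 := normr_ge0 B3.
  apply: (frozen N0 (G * M)%N (W0 * M)%N Y1 gam1 hY1 Y ((P`_0 + gam * (p.[N0%:Z])%:~R + e Y) / 2)) => //.
  - by have := ler_norm Y1; rewrite /Y; move: n2 A0; clear; lra.
  - by rewrite /Y; move: n1 n2; clear; lra.
  - by have := ler_norm B3; rewrite /Y; move: n1 A0; clear; lra.
  - by field.
  apply: (@syndetic_bohr_rotation _ _ _ (b * i%:Z)).
  have -> : gam * (G * M)%:R - (b * i%:Z)%:~R = i%:R * del.
    by rewrite /del /M intrM -pmulrn !natrM; ring.
  by rewrite normrM ger0_norm// i1.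
have q0' : 0 < q%:R :> R by rewrite ltr0n.
have /intrP[zq zqE] := gq.
have zq0 : 0 < zq by rewrite -(ltr0z R) -zqE mulr_gt0.
have gz (M : nat) (z : int) : (q %| M)%N -> exists2 t : int, gam * M%:R * z%:~R = t%:~R & (M == 2 * q)%N -> (2 %| t)%Z.
  move=> /dvdnP[s ->]; exists (zq * s%:Z * z).
    by rewrite !intrM -zqE natrM -!pmulrn; ring.
  by rewrite eqn_pmul2r// => /eqP ->; rewrite mulrAC dvdz_mull.
(* As [gam * (G * M)] is an integer, the fractional part is 1/5 for every [u], so the left end of
   each block can be taken. *)
have syn (G M : nat) (a : int) : (q %| M)%N -> syndetic_bohr (a%:~R + 5^-1) (gam * (G * M)%:R).
  move=> qM i; exists (21 * i)%N; split; first by clear; lia.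
  have [t ht _] := gz M (G * (21 * i))%N qM.
  exists (a + t); rewrite intrD -ht -pmulrn !natrM; apply/andP; split; by lra.
have ge1 G M : (0 < G)%N -> (0 < M)%N -> (q %| M)%N -> 1 <= gam * (G * M)%:R.
  move=> G0 M0 qM; have [t ht _] := gz M G qM.
  have -> : gam * (G * M)%:R = t%:~R by rewrite -ht natrM -pmulrn; ring.
  have : 0 < t%:~R :> R by rewrite -ht -pmulrn !mulr_gt0// ltr0n.
  by rewrite ltr0z -[1]/(1%:~R) ler_int; clear; lia.
have [bnd|unb] := pselect (exists B, forall x, A <= x -> `|e x| <= B); last first.
  have [G [W0 [G0 W00 hG]]] := hN0 N0 (leqnn _).
  have [Y1 hY1] := hG q eta q0 eta01.
  pose Y2 := `|Y1| + `|B3| + A.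
  have n1 := normr_ge0 Y1; have n2 := normr_ge0 B3.
  have AY2 : A <= Y2 by rewrite /Y2; move: n1 n2; clear; lra.
  (* A variation by more than 2 forces the continuous error to pass through a value for which
     [2 * xi] is an even integer plus 2/5, that is, [xi] is an integer plus 1/5. *)
  have [x Yx hx] : exists2 x, Y2 <= x & 2 < `|e x - e Y2|.
    apply: contrapT => h; apply: unb.
    exists (`|e A| + Ce * ((Y2 - A) / A) + `|e Y2| + 2) => x Ax.
    have w : 0 <= Ce * ((Y2 - A) / A) by rewrite mulr_ge0// divr_ge0 ?subr_ge0// ltW.
    have [m1 m2] := (normr_ge0 (e A), normr_ge0 (e Y2)).
    case: (leP Y2 x) => hxY.
      have : `|e x - e Y2| <= 2 by rewrite leNgt; apply/negP => hx; apply: h; exists x.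
      have := ler_normD (e x - e Y2) (e Y2); rewrite subrK.
      by move: w m1; clear; lra.
    have := eL A x (lexx _) Ax; have := ler_normD (e x - e A) (e A); rewrite subrK.
    have : Ce * ((x - A) / A) <= Ce * ((Y2 - A) / A).
      by rewrite ler_wpM2l// ler_pM2r ?invr_gt0// lerD2r ltW.
    by move: m2; clear; lra.
  pose ka := P`_0 + gam * (p.[N0%:Z])%:~R.
  pose lo := Num.min (e Y2) (e x); pose up := Num.max (e Y2) (e x).
  have lou : lo + 2 < up.
    by move: hx; rewrite /lo /up; case: (ltP (e Y2) (e x)) => h; [rewrite gtr0_norm ?subr_gt0//|rewrite ler0_norm ?subr_le0//]; move: h; clear; lra.
  pose a := Num.floor ((ka + lo - 2 / 5) / 2) + 1.
  have [a1 a2] : ka + lo <= 2 * a%:~R + 2 / 5 /\ 2 * a%:~R + 2 / 5 <= ka + up.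
    have := floor_itv ((ka + lo - 2 / 5) / 2); rewrite /a intrD; move: lou; clear; lra.
  have [||Y] := @IVT _ e Y2 x (2 * a%:~R + 2 / 5 - ka) Yx.
  - apply: derivable_within_continuous => z; rewrite in_itv/= => /andP[z1 _].
    by have [] := de z (le_trans AY2 z1).
  - by rewrite -/lo -/up; move: a1 a2; clear; lra.
  rewrite in_itv/= => /andP[Yl _] eY.
  apply: (frozen N0 (G * q)%N (W0 * q)%N Y1 (ge1 _ _ G0 q0 (dvdnn _)) hY1 Y (a%:~R + 5^-1)) => //.
  - by apply: le_trans Yl; have := ler_norm Y1; rewrite /Y2; move: n2 A0; clear; lra.
  - exact: le_trans Yl.
  - by apply: le_trans Yl; have := ler_norm B3; rewrite /Y2; move: n1 A0; clear; lra.
  - by rewrite eY /ka; ring.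
  - exact: syn.
have [B hB] := bnd.
have q20 : (0 < 2 * q)%N by rewrite muln_gt0.
(* Some residue class modulo [2 * q] contains infinitely many arguments with an even floor; [n0] is
   taken in this class. *)
have [r hr] : exists r : 'I_(2 * q), forall N : nat, exists2 n, (N <= n)%N &
    (n %% (2 * q) = r)%N /\ (2 %| Num.floor (F 0%N n%:R))%Z.
  apply: contrapT => h.
  have /choice[N hN] : forall r : 'I_(2 * q), exists N : nat, forall n, (N <= n)%N ->
      ~ ((n %% (2 * q) = r)%N /\ (2 %| Num.floor (F 0%N n%:R))%Z).
    move=> r; apply: contrapT => hr; apply: h; exists r => N.
    by apply: contrapT => hn; apply: hr; exists N => n Nn hh; apply: hn; exists n.
  have [n nN en] := even (\sum_r N r)%N.
  apply: (hN (Ordinal (ltn_pmod n q20)) n) => //.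
  by apply: leq_trans nN; rewrite (bigD1 (Ordinal (ltn_pmod n q20)))//= leq_addr.
have [n0 n0N [n0r _]] := hr N0.
have [G [W0 [G0 W00 hG]]] := hN0 n0 n0N.
have [Y1 hY1] := hG (2 * q)%N eta q20 eta01.
have q2 : (q %| 2 * q)%N by rewrite dvdn_mull.
pose ka := P`_0 + gam * (p.[n0%:Z])%:~R.
pose g x := Num.floor (ka + e x).
(* Along the class of [n0] modulo [2 * q] the polynomial part changes by even integers, so the
   parity of the floor is that of [g]. *)
have shift (n m : nat) : n = (n0 + 2 * q * m)%N -> exists2 t : int, gam * (p.[n%:Z] - p.[n0%:Z])%:~R = t%:~R &
     (2 %| t)%Z /\ Num.floor (F 0%N n%:R) = g n%:R + t.
  move=> ->; have [u hu] := dvd_horner_sub p n0%:Z (2 * q * m)%N%:Z.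
  have [t ht t2] := gz (2 * q)%N (m%:Z * u) q2.
  have tE : gam * (p.[(n0 + 2 * q * m)%N%:Z] - p.[n0%:Z])%:~R = t%:~R.
    by rewrite PoszD hu -ht PoszM !intrM -!pmulrn; ring.
  exists t => //; split; first exact: t2.
  apply: floor_def; have /andP[g1 g2] := floor_itv (ka + e (n0 + 2 * q * m)%N%:R).
  have FE' : F 0%N (n0 + 2 * q * m)%N%:R = ka + e (n0 + 2 * q * m)%N%:R + t%:~R.
    by rewrite FE -tE /ka intrB; ring.
  by rewrite FE' /g; move: g1 g2; rewrite !intrD; clear; lra.
have [K hK] := nat_ge (2 * B + 1).
have gle x y : e x <= e y -> g x <= g y by move=> h; apply: le_floor; rewrite lerD2l.
have gdiff x y : A <= x -> A <= y -> g y <= g x + K%:Z.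
  move=> Ax Ay; have := hB x Ax; have := hB y Ay; rewrite !ler_norml => b1 b2.
  have /andP[x1 x2] := floor_itv (ka + e x); have /andP[y1 y2] := floor_itv (ka + e y).
  rewrite -ltzD1 -(ltr_int R) /g !intrD -pmulrn; move: x2 y1 b1 b2 hK; rewrite intrD; clear; lra.
have [B1 AB1 hB1] : exists2 B1, A <= B1 & forall x, B1 <= x -> g x = g B1.
  case: sg => sg.
    have [x y Ax xy|x Ax|B1 AB1 hB1] := @eventually_const g A K; last by exists B1.
    - apply: gle; have [z /andP[z1 _] ez] := mv x y Ax xy.
      by rewrite -subr_ge0 ez; apply: mulr_ge0; [apply: sg; exact: le_trans z1|rewrite subr_ge0].
    - exact: gdiff.
  have [x y Ax xy|x Ax|B1 AB1 hB1] := @eventually_const (fun x => - g x) A K.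
  - rewrite lerN2; apply: gle; have [z /andP[z1 _] ez] := mv x y Ax xy.
    by rewrite -subr_le0 ez mulr_le0_ge0 ?subr_ge0// sg// (le_trans Ax).
  - by have := gdiff x A Ax (lexx _); clear; lia.
  - by exists B1 => // x hx; apply: oppr_inj; exact: hB1.
(* [g] is monotone, integer-valued and bounded, hence finally constant, and an even floor far out in
   the class shows that the constant is even. *)
have [a aE] : exists a : int, g B1 = 2 * a.
  have [N1 hN1] := nat_ge B1.
  have [n nN [nr en]] := hr (n0 + N1)%N.
  have n0n : (n0 <= n)%N by apply: leq_trans nN; rewrite leq_addr.
  have nE : n = (n0 + 2 * q * ((n - n0) %/ (2 * q)))%N.
    have dv : (2 * q %| n - n0)%N by rewrite -(eqn_mod_dvd _ n0n) nr n0r.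
    by rewrite [(2 * q * _)%N]mulnC divnK// subnKC.
  have [t _ [t2 fl]] := shift _ _ nE.
  have gn : g n%:R = g B1.
    apply: hB1; apply: (le_trans hN1); rewrite ler_nat; apply: leq_trans nN; exact: leq_addl.
  rewrite fl gn in en; have /dvdzP[u hu] := en; have /dvdzP[v hv] := t2.
  by exists (u - v); move: hu hv; clear; lia.
pose Y := `|Y1| + `|B3| + B1.
have n1 := normr_ge0 Y1; have n2 := normr_ge0 B3.
(* The error need not be frozen: the floor equals [2 * a + t] exactly, and [2 * xi + t] is this
   integer plus 2/5. *)
apply: (hY1 Y (a%:~R + 5^-1)) => //.
- by have := ler_norm Y1; rewrite /Y; move: n2 A0 AB1; clear; lra.
- exact: ge1.
- exact: syn.
move=> n h nE /andP[Yn _]; have [|t -> [_ fl]] := shift n (W0 * h)%N.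
  by rewrite nE; congr (_ + _)%N; ring.
have B1n : B1 <= n%:R by apply: le_trans Yn; rewrite /Y; move: n1 n2; clear; lra.
rewrite hB1// aE in fl.
have F3 : 3 <= F 0%N n%:R.
  by apply: hB3; apply: le_trans Yn; have := ler_norm B3; rewrite /Y; move: n1 A0 AB1; clear; lra.
have /andP[_ f2] := floor_itv (F 0%N n%:R).
rewrite fl !intrD intrM in f2; split; first by move: f2 F3; clear; lra.
move=> s /andP[s1 s2]; rewrite fl; apply/eqP; rewrite eq_le -!ltzD1 -!(ltr_int R) !intrD intrM.
by move: s1 s2; clear; lra.
Qed.

End RationalRatio.

(** * Slow growth forces a polynomial *)

Section SlowGrowth.
Variable R : realType.
Implicit Types (F : nat -> R -> R) (P Q : {poly R}) (A x y X : R).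

Lemma growth_le F d A B : A <= B -> growth F d A -> growth F d B.
Proof.
move=> AB gF; split.
- exact: tower_le (growth_tower gF).
- by apply: lt_le_trans AB; exact: growth_gt0 gF.
- by move=> i x id Bx; apply: (growth_pos gF) => //; exact: le_trans Bx.
- have [c c0 hc] := growth_low gF; exists c => // x Bx; apply: hc; exact: le_trans Bx.
- by case: (growth_sign gF) => sg; [left|right] => x Bx; apply: sg; exact: le_trans Bx.
- by move=> x y Bx xy; apply: (growth_noninc1 gF) => //; exact: le_trans Bx.
- by move=> x y Bx xy; apply: (growth_noninc2 gF) => //; exact: le_trans Bx.
- exact: growth_cvg0 gF.
Qed.

(** Let [g x = x^(d+1) |F d.+1 x|]. Wherever the domination fails at [X], [g X <= g (X / 4)].
    Dividing by 4 repeatedly leads either to a point where domination holds or into a bounded range,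
    without decreasing [g]; comparability of [F d] carries the bound back to [X]. *)
Lemma slow_derivative F d A (C B : R) : growth F d A ->
  (forall X, B <= X -> X ^+ d.+1 * `|F d.+1 X| <= C * F d X \/
     X ^+ d.+1 * `|F d.+1 X| <= (X / 4) ^+ d.+1 * `|F d.+1 (X / 4)|) ->
  exists C' B' : R, [/\ 0 < C', A <= B' & forall x, B' <= x -> x ^+ d.+1 * `|F d.+1 x| <= C' * F d x].
Proof.
move=> gF slow; have A0 := growth_gt0 gF.
have [B0 B01 hB0] := growth_comparable gF; have [c c0 hc] := growth_low gF.
pose g x := x ^+ d.+1 * `|F d.+1 x|.
pose D := `|B| + 8 * A; have nB := normr_ge0 B.
have D0 : 0 < D by rewrite /D; move: nB A0; clear; lra.
have AD : A <= D by rewrite /D; move: nB A0; clear; lra.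
have descent n X : D <= X -> X <= 4 ^+ n * D -> exists x, [/\ D <= x, x <= X, g X <= g x &
    g x <= C * F d x \/ x <= 4 * D].
  elim: n X => [|n IH] X DX Xn.
    exists X; split => //; right; move: Xn; rewrite expr0 mul1r; move: D0; clear; lra.
  case: (leP X (4 * D)) => h4; first by exists X; split => //; right.
  have [|h|h] := slow X; first by have := ler_norm B; move: DX A0; rewrite /D; clear; lra.
    by exists X; split => //; left.
  have [||x [x1 x2 x3 x4]] := IH (X / 4).
  - by move: h4; clear; lra.
  - by move: Xn; rewrite exprS; clear; lra.
  exists x; split => //; first by move: x2 DX D0; clear; lra.
  exact: le_trans x3.
(* Bounds [g] on [[D, 4 D]], where the descent may stop without domination. *)
pose M := (4 * D) ^+ d.+1 * `|F d.+1 D|.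
exists (`|C| * B0 + M / c + 1), D; split => //.
  have : 0 <= `|C| * B0 by rewrite mulr_ge0// (le_trans ler01).
  have : 0 <= M / c by rewrite divr_ge0 ?(ltW c0)// mulr_ge0// exprn_ge0// mulr_ge0// ltW.
  by clear; lra.
move=> X DX; rewrite -/(g X).
have [n hn] := nat_ge (X / D).
have Xn : X <= 4 ^+ n * D.
  rewrite -ler_pdivrMr//; apply: (le_trans hn); rewrite -natrX ler_nat.
  by apply/ltnW/ltn_expl.
have [x [x1 x2 x3 x4]] := descent n X DX Xn.
have FX0 : c <= F d X by apply: hc; exact: le_trans DX.
have FX0' : 0 < F d X by exact: lt_le_trans FX0.
have c1 : 0 <= `|C| * B0 * F d X by rewrite mulr_ge0 ?(ltW FX0')// mulr_ge0// (le_trans ler01).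
have M0 : 0 <= M by rewrite mulr_ge0// exprn_ge0// mulr_ge0// ltW.
have c2 : M <= M / c * F d X.
  by rewrite -[leLHS]mulr1 -mulrA ler_wpM2l// mulrC ler_pdivlMr// mul1r.
apply: (le_trans x3); rewrite !mulrDl mul1r.
case: x4 => h4.
  have X8 : 8 * A <= X by move: DX nB; rewrite /D; clear; lra.
  have [hu _] := hB0 X X8.
  have Fx : F d x <= B0 * F d X by apply: hu; rewrite x2 (le_trans AD).
  have Fx0 : 0 <= F d x by apply/ltW/(growth_pos gF) => //; exact: le_trans x1.
  have : C * F d x <= `|C| * (B0 * F d X).
    by apply: (@le_trans _ _ (`|C| * F d x)); [rewrite ler_wpM2r// ler_norm|rewrite ler_wpM2l].
  by move: h4 c2 M0 FX0'; rewrite mulrA; clear; lra.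
have : g x <= M.
  have x0 : 0 <= x by apply: le_trans x1; exact: ltW.
  rewrite /g /M; apply: ler_pM => //; first exact: exprn_ge0.
    by apply: lerXn2r => //; rewrite nnegrE// mulr_ge0// ltW.
  exact: (growth_noninc1 gF).
by move: c1 c2 FX0'; clear; lra.
Qed.

Lemma is_derive_invX (j : nat) x : x != 0 ->
  is_derive x 1 (fun y => (y ^+ j.+1)^-1) (- (j.+1%:R / x ^+ j.+2)).
Proof.
move=> x0; have h : is_derive x 1 (fun y => y ^+ j.+1) (x ^+ j *+ j.+1).
  have := is_derive_poly 'X^(j.+1) x; rewrite derivXn hornerMn hornerXn.
  rewrite (_ : horner 'X^(j.+1) = (fun y => y ^+ j.+1))//.
  by apply/funext => y; rewrite hornerXn.
have n0 : x ^+ j.+1 != 0 by rewrite expf_neq0.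
apply: (@is_derive_eq _ _ _ _ _ _ _ _ (@is_deriveV _ (fun y => y ^+ j.+1) x _ 1 n0 h)).
rewrite -mulr_natr /GRing.scale/= !exprS; have xj : x ^+ j != 0 by rewrite expf_neq0.
by field; rewrite x0 xj.
Qed.

(* [f x * (1 + 2 * C / x)] is nonincreasing. *)
Lemma bounded_of_small_derivative (f g : R -> R) A (C : R) : 0 < A -> 0 < C ->
  (forall x, A <= x -> is_derive x 1 f (g x)) ->
  (forall x, A <= x -> 0 <= f x) -> (forall x, A <= x -> x ^+ 2 * `|g x| <= C * f x) ->
  exists M B, A <= B /\ forall x, B <= x -> f x <= M.
Proof.
move=> A0 C0 df f0 hg; pose phi x := f x * (1 + 2 * C * (x ^+ 1)^-1).
have C20 : 0 < 2 * C by rewrite mulr_gt0.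
exists (phi (A + 2 * C)), (A + 2 * C); split; first by rewrite lerDl ltW.
move=> y hy.
have dphi x : A <= x -> is_derive x 1 phi (g x * (1 + 2 * C * (x ^+ 1)^-1) - f x * (2 * C / x ^+ 2)).
  move=> Ax; have x0 : x != 0 by rewrite gt_eqF// (lt_le_trans A0).
  have h1 := is_deriveZ (2 * C) (is_derive_invX 0 x0).
  have h2 := is_deriveD (is_derive_cst (1 : R) x (1 : R)) h1.
  apply: (is_derive_eq (is_deriveM (df x Ax) h2)).
  rewrite -[(cst 1 + _) x]/(1 + 2 * C * (x ^+ 1)^-1) /GRing.scale/=; ring.
have AC : A <= A + 2 * C by rewrite lerDl ltW.
have [z /andP[z1 z2] e] := mean_value dphi AC hy.
have Az : A <= z by exact: le_trans z1.
have z0 : 0 < z by exact: lt_le_trans Az.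
have dneg : g z * (1 + 2 * C * (z ^+ 1)^-1) - f z * (2 * C / z ^+ 2) <= 0.
  have zC : 2 * C * (z ^+ 1)^-1 <= 1.
    by rewrite expr1 ler_pdivrMr// mul1r; move: z1 A0; clear; lra.
  have zC0 : 0 <= 2 * C * (z ^+ 1)^-1 by rewrite mulr_ge0 ?invr_ge0 ?expr1// ltW.
  have z20 : 0 < z ^+ 2 by rewrite exprn_gt0.
  have h1 : `|g z| <= C * f z / z ^+ 2 by rewrite ler_pdivlMr// mulrC hg.
  have h2 : g z * (1 + 2 * C * (z ^+ 1)^-1) <= `|g z| * 2.
    apply: (@le_trans _ _ (`|g z| * (1 + 2 * C * (z ^+ 1)^-1))).
      by rewrite ler_wpM2r ?ler_norm//; move: zC0; clear; lra.
    by rewrite ler_wpM2l//; move: zC; clear; lra.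
  have h3 : f z * (2 * C / z ^+ 2) = 2 * (C * f z / z ^+ 2) by ring.
  by rewrite h3; move: h1 h2; clear; lra.
have : phi y - phi (A + 2 * C) <= 0 by rewrite e mulr_le0_ge0// subr_ge0.
have y0 : A <= y by exact: le_trans hy.
have : f y <= phi y.
  rewrite /phi ler_peMr ?f0// lerDl mulr_ge0 ?(ltW C20)// invr_ge0 expr1.
  by rewrite (le_trans (ltW A0)).
by clear; lra.
Qed.

(* [f x - C / x ^+ j.+1] increases, [f x + C / x ^+ j.+1] decreases, and they share their limit. *)
Lemma limit_of_small_derivative (f g : R -> R) A (C : R) j : 0 < A -> 0 <= C ->
  (forall x, A <= x -> is_derive x 1 f (g x)) ->
  (forall x, A <= x -> `|g x| <= C / x ^+ j.+2) ->
  exists c, forall x, A <= x -> `|f x - c| <= C / x ^+ j.+1.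
Proof.
move=> A0 C0 df hg.
have dw (s : R) x : A <= x -> is_derive x 1 (fun y => f y + s * (y ^+ j.+1)^-1)
    (g x - s * (j.+1%:R / x ^+ j.+2)).
  move=> Ax; have x0 : x != 0 by rewrite gt_eqF// (lt_le_trans A0).
  apply: (is_derive_eq (is_deriveD (df x Ax) (is_deriveZ s (is_derive_invX j x0)))).
  by rewrite /GRing.scale/= mulrN.
have dec x y : A <= x -> x <= y -> f y + C * (y ^+ j.+1)^-1 <= f x + C * (x ^+ j.+1)^-1.
  move=> Ax xy; have [z /andP[z1 _] e] := mean_value (dw C) Ax xy.
  have Az : A <= z by exact: le_trans z1.
  have z0 : 0 < z ^+ j.+2 by rewrite exprn_gt0// (lt_le_trans A0).
  rewrite -subr_le0 e mulr_le0_ge0 ?subr_ge0// subr_le0; apply: (le_trans (ler_norm _)); apply: (le_trans (hg z Az)).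
  rewrite ler_wpM2l// -[leLHS]mul1r ler_pM2r ?invr_gt0//.
  by rewrite ler1n.
have inc x y : A <= x -> x <= y -> f x - C * (x ^+ j.+1)^-1 <= f y - C * (y ^+ j.+1)^-1.
  move=> Ax xy; have [z /andP[z1 _] e] := mean_value (dw (- C)) Ax xy.
  have Az : A <= z by exact: le_trans z1.
  have z0 : 0 < z ^+ j.+2 by rewrite exprn_gt0// (lt_le_trans A0).
  rewrite !mulNr in e; rewrite -subr_ge0 e opprK; apply: mulr_ge0; last by rewrite subr_ge0.
  rewrite -[X in _ + X]opprK subr_ge0; have := hg z Az; rewrite ler_norml => /andP[+ _].
  apply: le_trans; rewrite lerN2 ler_wpM2l// -[leLHS]mul1r ler_pM2r ?invr_gt0//.
  by rewrite ler1n.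
have pos x : A <= x -> 0 <= C * (x ^+ j.+1)^-1.
  by move=> Ax; rewrite mulr_ge0// invr_ge0 exprn_ge0// (le_trans (ltW A0)).
pose S := [set u | exists2 x, A <= x & u = f x - C * (x ^+ j.+1)^-1].
have ubS x : A <= x -> ubound S (f x + C * (x ^+ j.+1)^-1).
  move=> Ax _ [y Ay ->]; pose w := Num.max x y.
  have xw : x <= w by rewrite le_max lexx.
  have yw : y <= w by rewrite le_max lexx orbT.
  have := inc y w Ay yw; have := dec x w Ax xw; have := pos w (le_trans Ax xw).
  by clear; lra.
have S0 : S !=set0 by exists (f A - C * (A ^+ j.+1)^-1); exists A.
exists (sup S) => x Ax; have h1 : sup S <= f x + C * (x ^+ j.+1)^-1 by apply: ge_sup => //; exact: ubS.
have h2 : f x - C * (x ^+ j.+1)^-1 <= sup S.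
  by apply: ub_le_sup; [exists (f A + C * (A ^+ j.+1)^-1); exact: ubS|exists x].
by rewrite ler_norml; move: h1 h2; clear; lra.
Qed.

Definition primitive_poly Q n : {poly R} := \poly_(j < n) (if j == 0%N then 0 else Q`_j.-1 / j%:R).

Lemma deriv_primitive Q n : (size Q <= n)%N -> (primitive_poly Q n.+1)^`() = Q.
Proof.
move=> sQ; apply/polyP => i; rewrite coef_deriv coef_poly ltnS.
case: ltnP => h /=; last by rewrite mul0rn nth_default// (leq_trans sQ).
by rewrite -[_ *+ i.+1]mulr_natr divfK// pnatr_eq0.
Qed.

(** Integrate from infinity, one order at a time: the deviation at order [i] converges and its limit
    becomes the new constant term. This stops at order 1, because the bound [C / x] there is not
    integrable; hence the error itself may be unbounded. *)
Lemma near_poly_tail F n A (C : R) : 0 < A -> 0 <= C -> tower F n.+2 A ->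
  (forall x, A <= x -> `|F n.+2 x| <= C / x ^+ n.+2) ->
  forall m, (m <= n.+1)%N -> exists Q, (size Q <= m)%N /\ forall l x, (l <= m)%N -> A <= x ->
    `|F (n.+2 - m + l)%N x - (Q^`(l)).[x]| <= C / x ^+ (n.+2 - m + l).
Proof.
move=> A0 C0 tF top; elim=> [_|m IH mn].
  exists 0; split; first by rewrite size_poly0.
  move=> l x; rewrite leqn0 => /eqP -> Ax.
  by rewrite subn0 addn0 derivn0 horner0 subr0 top.
have [Q [sQ hQ]] := IH (ltnW mn).
set i := (n.+2 - m.+1)%N; have iE : (n.+2 - m = i.+1)%N by rewrite /i; move: mn; clear; lia.
rewrite iE in hQ; have i0 : (0 < i)%N by rewrite /i; move: mn; clear; lia.
have ilt : (i < n.+2)%N by rewrite /i; move: mn; clear; lia.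
pose Q1 := primitive_poly Q m.+1.
have dQ1 : Q1^`() = Q by exact: deriv_primitive.
have [||c hc] := @limit_of_small_derivative (fun x => F i x - Q1.[x]) (fun x => F i.+1 x - Q.[x]) A C i.-1 A0 C0.
- move=> x Ax; apply: (@is_deriveB R R R (F i) (fun y => Q1.[y])); first exact: tF.
  by rewrite -dQ1; exact: is_derive_poly.
- by move=> x Ax; have := hQ 0%N x (leq0n _) Ax; rewrite addn0 derivn0 prednK.
rewrite prednK// in hc.
exists (Q1 + c%:P); split.
  rewrite (leq_trans (size_polyD _ _))// geq_max size_poly (leq_trans (size_polyC_leq1 _))//.
case=> [|l] x lm Ax.
  by rewrite addn0 derivn0 hornerD hornerC opprD addrA hc.
rewrite addnS -addSn derivSn derivD derivC addr0 dQ1; exact: hQ.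
Qed.

(** Domination at all large [X] gives [x^2 |F d.+2 x| <= C1 * F d.+1 x], so [F d.+1] is bounded.
    This turns the domination into [F d.+2 x = O(x^-(d+2))], which is integrated down to order 1. *)
Lemma near_poly_of_slow F d A (C B : R) : growth F d.+1 A ->
  (forall X, B <= X -> ~ (C * F d.+1 X < X ^+ d.+2 * `|F d.+2 X| /\
     `|F d.+2 (X / 4)| <= 4 ^+ d.+2 * `|F d.+2 X|)) ->
  exists A' Ce P, A <= A' /\ near_poly F d A' Ce P.
Proof.
move=> gF slow; have A0 := growth_gt0 gF; have [c c0 hc] := growth_low gF.
have [|C1 [B1 [C10 AB1 hB1]]] := @slow_derivative F d.+1 A C (`|B|) gF.
  move=> X BX; have X0 : 0 <= X by exact: le_trans BX.
  case: (leP (X ^+ d.+2 * `|F d.+2 X|) (C * F d.+1 X)) => h; [by left|right].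
  have -> : X ^+ d.+2 = (X / 4) ^+ d.+2 * 4 ^+ d.+2 by rewrite -exprMn divfK.
  rewrite -mulrA ler_wpM2l ?exprn_ge0 ?divr_ge0// leNgt; apply/negP => h'.
  by apply: (slow X (le_trans (ler_norm B) BX)); rewrite ltW.
pose B2 := B1 + 1.
have AB2 : A <= B2 by rewrite /B2; move: AB1; clear; lra.
have B20 : 0 < B2 by exact: lt_le_trans AB2.
have tF := growth_tower gF.
have B12 x : B2 <= x -> B1 <= x /\ 1 <= x by rewrite /B2; move: A0 AB1; clear; lra.
have F0 x : A <= x -> 0 < F d.+1 x by exact: (growth_pos gF).
have [|||M [B3 [B23 hM]]] := @bounded_of_small_derivative (F d.+1) (F d.+2) B2 C1 B20 C10.
- by move=> x Bx; apply: tF => //; exact: le_trans Bx.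
- by move=> x Bx; apply/ltW/F0; exact: le_trans Bx.
- move=> x Bx; have [Bx1 x1] := B12 x Bx; apply: le_trans (hB1 x Bx1).
  by rewrite ler_wpM2r// ler_weXn2l.
have AB3 : A <= B3 by exact: le_trans B23.
have B30 : 0 < B3 by exact: lt_le_trans AB3.
have M0 : 0 < M by apply: lt_le_trans (hM _ (lexx _)); exact: F0.
have CM0 : 0 <= C1 * M by rewrite ltW// mulr_gt0.
have top x : B3 <= x -> `|F d.+2 x| <= C1 * M / x ^+ d.+2.
  move=> Bx; have [Bx1 x1] := B12 x (le_trans B23 Bx).
  rewrite ler_pdivlMr ?exprn_gt0 ?(lt_le_trans B30)// mulrC.
  by apply: (le_trans (hB1 x Bx1)); rewrite ler_pM2l// hM.
have tF3 : tower F d.+2 B3 by apply: tower_le tF.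
have [Q [sQ hQ]] := near_poly_tail B30 CM0 tF3 top (leqnn d.+1).
have e1 : (d.+2 - d.+1 = 1)%N by clear; lia.
rewrite e1 in hQ; pose P := primitive_poly Q d.+2.
have dP l : P^`(l.+1) = Q^`(l) by rewrite derivSn deriv_primitive.
have hP i x : (0 < i <= d.+1)%N -> B3 <= x -> `|F i x - (P^`(i)).[x]| <= C1 * M / x ^+ i.
  by case: i => // i /andP[_ id] Bx; rewrite dP; apply: hQ => //; exact: leqW.
have sP : (size P <= d.+2)%N by exact: size_poly.
have Pd x : (P^`(d.+1)).[x] = (d.+1)`!%:R * P`_d.+1.
  have -> : P^`(d.+1) = ((d.+1)`!%:R * P`_d.+1)%:P; last by rewrite hornerC.
  apply/polyP => i; rewrite coef_derivn coefC.
  case: eqP => [->|/eqP i0]; first by rewrite addn0 ffactnn mulr_natl.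
  by rewrite nth_default ?mul0rn// (leq_trans sP)//; move: i0; clear; lia.
have f0 : 0 < (d.+1)`!%:R :> R by rewrite ltr0n fact_gt0.
(* Far out the deviation of [F d.+1] from this constant is at most half of the lower bound [c] of
   [F d.+1]. *)
have Pd0 : 0 < P`_d.+1.
  rewrite -(pmulr_rgt0 _ f0).
  pose x := B3 + 2 * (C1 * M) / c + 1.
  have w : 0 <= 2 * (C1 * M) / c by rewrite divr_ge0 ?(ltW c0)// mulr_ge0.
  have Bx : B3 <= x by rewrite /x; move: w; clear; lra.
  have x1 : 1 <= x by rewrite /x; move: w B30; clear; lra.
  have x0 : 0 < x by exact: lt_le_trans x1.
  have h01 : (0 < d.+1 <= d.+1)%N by rewrite leqnn.
  have := hP d.+1 x h01 Bx; rewrite Pd ler_norml => /andP[_].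
  have : C1 * M / x ^+ d.+1 <= c / 2.
    apply: (@le_trans _ _ (C1 * M / x)).
      by rewrite ler_wpM2l// lef_pV2 ?posrE ?exprn_gt0// exprS ler_peMr ?(ltW x0)// exprn_ege1.
    rewrite ler_pdivrMr//; have : 2 * (C1 * M) <= x * c.
      by rewrite -ler_pdivrMr// /x; move: B30; clear; lra.
    by clear; lra.
  by have := hc x (le_trans AB3 Bx); move: c0; clear; lra.
have sPE : size P = d.+2.
  apply/eqP; rewrite eqn_leq sP ltnNge; apply/negP => /leq_sizeP/(_ _ (leqnn _)) e.
  by rewrite e ltxx in Pd0.
exists B3, (C1 * M), P; split => //; split => //.
by rewrite lead_coefE sPE.
Qed.

End SlowGrowth.

(** * Hardy fields *)

Section HardyFields.
Variable R : realType.
Implicit Types (f g : R -> R) (A B c x y : R).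

Lemma near_pinftyP (P : R -> Prop) : (\forall x \near +oo, P x) -> exists2 A : R, 0 < A & forall x, A <= x -> P x.
Proof.
move=> [M [_ h]]; exists (`|M| + 1); first by rewrite ltr_wpDl.
by move=> x hx; apply: h; have := ler_norm M; move: hx; clear; lra.
Qed.

(** The mean value theorem on [[x / 2, x]] gains one power of [x]; half of the gain pays for [f A],
    which may be negative. *)
Lemma growing_primitive f g A c m : 0 < A -> 0 < c -> (forall x, A <= x -> is_derive x 1 f (g x)) ->
  (forall x, A <= x -> c * x ^+ m <= g x) ->
  exists B c', [/\ A <= B, 0 < c' & forall x, B <= x -> c' * x ^+ m.+1 <= f x].
Proof.
move=> A0 c0 df hg; have mv x y : A <= x -> x <= y -> exists2 z, x <= z <= y & f y - f x = g z * (y - x).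
  exact: (@mean_value _ _ _ A).
have g0 x : A <= x -> 0 <= g x.
  move=> Ax; apply: le_trans (hg x Ax); rewrite mulr_ge0 ?(ltW c0)// exprn_ge0//.
  by rewrite (le_trans (ltW A0)).
exists (2 * A + 4 * (`|f A| / c) + 2), (c / 2 ^+ m.+2).
have w : 0 <= `|f A| / c by rewrite divr_ge0// ltW.
split; [by move: w A0; clear; lra|by rewrite divr_gt0// exprn_gt0|].
move=> x hx; have Ax2 : A <= x / 2 by move: hx w; clear; lra.
have x21 : 1 <= x / 2 by move: hx w A0; clear; lra.
have xx : x / 2 <= x by move: x21; clear; lra.
have [z1 /andP[_ _] e1] := mv A (x / 2) (lexx _) Ax2.
have fA : f A <= f (x / 2).
  have [z /andP[za _] e] := mv A (x / 2) (lexx _) Ax2.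
  by rewrite -subr_ge0 e; apply: mulr_ge0; [exact: g0|rewrite subr_ge0].
have [z /andP[za _] e] := mv (x / 2) x Ax2 xx.
have x20 : 0 < x / 2 by exact: lt_le_trans x21.
have step : c * (x / 2) ^+ m.+1 <= f x - f (x / 2).
  rewrite e (_ : x - x / 2 = x / 2); last by field.
  rewrite exprS mulrCA mulrC ler_pM2r//; apply: le_trans (hg z (le_trans Ax2 za)).
  rewrite ler_pM2l//; apply: lerXn2r => //; rewrite nnegrE ?(ltW x20)//.
  by rewrite (le_trans (ltW x20)).
have v1 : `|f A| <= c * (x / 2) ^+ m.+1 / 2.
  have h1 : `|f A| <= c * (x / 2) / 2.
    have : `|f A| / c * c = `|f A| by rewrite divfK// gt_eqF.
    have : 4 * (`|f A| / c) <= x by move: hx A0; clear; lra.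
    move: (`|f A| / c) => v hv <-; rewrite -(ler_pM2r c0) in hv.
    by move: hv; clear; lra.
  apply: (le_trans h1); rewrite ler_pM2r// ler_pM2l// exprS ler_peMr ?(ltW x20)//.
  by rewrite exprn_ege1.
have -> : c / 2 ^+ m.+2 * x ^+ m.+1 = c * (x / 2) ^+ m.+1 / 2.
  by rewrite exprMn exprVn [2 ^+ m.+2]exprS invfM; ring.
by move: step v1 fA; have := ler_norm (- f A); rewrite normrN; clear; lra.
Qed.

Definition vanishing f := forall e : R, 0 < e -> exists B, forall x, B <= x -> `|f x| <= e.

Section OneField.
Variable H : set (R -> R).
Hypothesis hH : hardy_field H.

Lemma hardy_is_derive f : H f -> exists2 A : R, 0 < A & forall x, A <= x -> is_derive x 1 f (derive1 f x).
Proof.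
move=> /(hardy_derivable hH)/near_pinftyP[A A0 hA]; exists A => // x /hA h.
by rewrite derive1E; exact: derivableP.
Qed.

(** A nonzero germ is invertible, so it has no large zeros, and continuity fixes its sign. *)
Lemma hardy_sign f : H f -> exists2 A : R, 0 < A &
  [\/ forall x, A <= x -> 0 < f x, forall x, A <= x -> f x < 0 | forall x, A <= x -> f x = 0].
Proof.
move=> Hf; have [z|nz] := pselect (germ_eq f (fun=> 0)).
  by have [A A0 hA] := near_pinftyP z; exists A => //; apply: Or33.
have [g Hg /near_pinftyP[A A0 hA]] := hardyV hH Hf nz.
have [B B0 hB] := hardy_is_derive Hf.
have nzf x : A <= x -> f x != 0.
  move=> /hA /= h; apply/eqP => f0; move: h; rewrite f0 mul0r => /esym/eqP.
  by rewrite oner_eq0.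
pose C := A + B.
have AC : A <= C by rewrite /C lerDl ltW.
have BC : B <= C by rewrite /C lerDr ltW.
exists C; first by rewrite addr_gt0.
have same x : C <= x -> 0 < f C * f x.
  move=> Cx; rewrite ltNge; apply/negP => neg.
  have [||z] := @IVT _ f C x 0 Cx.
  - apply: derivable_within_continuous => z; rewrite in_itv/= => /andP[z1 _].
    by have [] := hB z (le_trans BC z1).
  - rewrite ge_min le_max; apply/andP; split; apply: contraT; rewrite negb_or -!ltNge => /andP[c0 x0].
      by move: neg; rewrite leNgt mulr_gt0.
    by move: neg; rewrite leNgt nmulr_rgt0 ?x0.
  - rewrite in_itv/= => /andP[z1 _] fz.
    by have := nzf z (le_trans AC z1); rewrite fz eqxx.
have := nzf C AC; case: (ltgtP (f C) 0) => // c0 _; [apply: Or32|apply: Or31] => x /same.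
  by rewrite (nmulr_rgt0 _ c0).
by rewrite (pmulr_rgt0 _ c0).
Qed.

Lemma hardy_monotone f : H f -> exists2 A : R, 0 < A &
  (forall x y, A <= x -> x <= y -> `|f x| <= `|f y|) \/ (forall x y, A <= x -> x <= y -> `|f y| <= `|f x|).
Proof.
move=> Hf; have [A A0 sf] := hardy_sign Hf; have [B B0 sg] := hardy_sign (hardy_derive hH Hf).
have [D D0 df] := hardy_is_derive Hf.
pose C := A + B + D.
have AC : A <= C by rewrite /C; move: B0 D0; clear; lra.
have BC : B <= C by rewrite /C; move: A0 D0; clear; lra.
have DC : D <= C by rewrite /C; move: A0 B0; clear; lra.
exists C; first by rewrite !addr_gt0.
have mv x y : C <= x -> x <= y -> exists2 z, x <= z <= y & f y - f x = derive1 f z * (y - x).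
  by move=> Cx xy; apply: (@mean_value _ _ _ D) => //; exact: le_trans Cx.
have g_mono : (forall x y, C <= x -> x <= y -> f x <= f y) \/ (forall x y, C <= x -> x <= y -> f y <= f x).
  case: sg => sg; [left|right|left] => x y Cx xy; have [z /andP[z1 _] e] := mv x y Cx xy;
    have Bz : B <= z by rewrite (le_trans BC)// (le_trans Cx).
  - by rewrite -subr_ge0 e mulr_ge0 ?subr_ge0// ltW// sg.
  - by rewrite -subr_le0 e mulr_le0_ge0 ?subr_ge0// ltW// sg.
  - by rewrite -subr_ge0 e sg// mul0r.
case: sf => sf.
- have pf x : C <= x -> `|f x| = f x by move=> Cx; rewrite gtr0_norm// sf// (le_trans AC).
  by case: g_mono => h; [left|right] => x y Cx xy; rewrite !pf ?(le_trans Cx)//; exact: h.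
- have pf x : C <= x -> `|f x| = - f x by move=> Cx; rewrite ltr0_norm// sf// (le_trans AC).
  by case: g_mono => h; [right|left] => x y Cx xy; rewrite !pf ?(le_trans Cx)// lerN2; exact: h.
- by left=> x y Cx xy; rewrite !sf// (le_trans AC)// (le_trans Cx).
Qed.

Lemma hardy_vanishing f : H f -> vanishing f \/ exists c B, [/\ 0 < c, 0 < B &
  (forall x, B <= x -> c <= f x) \/ (forall x, B <= x -> f x <= - c)].
Proof.
move=> Hf; have [A A0 sf] := hardy_sign Hf; have [B B0 mf] := hardy_monotone Hf.
have [z|nz] := pselect (forall x, A <= x -> f x = 0).
  by left=> e e0; exists A => x Ax; rewrite z// normr0 ltW.
pose C := A + B.
have AC : A <= C by rewrite /C lerDl ltW.
have BC : B <= C by rewrite /C lerDr ltW.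
have C0 : 0 < C by rewrite addr_gt0.
have fin c : 0 < c -> (forall x, C <= x -> c <= `|f x|) -> exists c B, [/\ 0 < c, 0 < B &
  (forall x, B <= x -> c <= f x) \/ (forall x, B <= x -> f x <= - c)].
  move=> c0 hc; exists c, C; split => //; case: sf => sf; [left|right|by case: nz] => x Cx.
    by have := hc x Cx; rewrite gtr0_norm// sf// (le_trans AC).
  by have := hc x Cx; rewrite ltr0_norm ?sf ?(le_trans AC)//; clear; lra.
case: mf => mf.
  right; apply: (fin `|f C|); last by move=> x Cx; exact: mf.
  by rewrite normr_gt0; case: sf => sf; [rewrite gt_eqF ?sf|rewrite lt_eqF ?sf|case: nz].
have [[c c0 hc]|h] := pselect (exists2 c, 0 < c & forall x, C <= x -> c <= `|f x|).
  by right; exact: (fin c).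
left=> e e0; apply: contrapT => he; apply: h; exists e => // x Cx.
rewrite leNgt; apply/negP => fx; apply: he; exists x => y xy.
by apply: (le_trans _ (ltW fx)); apply: mf => //; exact: le_trans Cx.
Qed.

(** The modulus is monotone; if it were nondecreasing, tending to 0 would force it to vanish. *)
Lemma hardy_vanishing_noninc f : H f -> vanishing f -> exists2 A : R, 0 < A & forall x y, A <= x -> x <= y -> `|f y| <= `|f x|.
Proof.
move=> Hf vf; have [A A0 [mf|mf]] := hardy_monotone Hf; last by exists A.
suff z x : A <= x -> f x = 0 by exists A => // x y Ax xy; rewrite !z// (le_trans Ax).
move=> Ax; apply/eqP; rewrite -normr_le0; apply/ler_addgt0Pl => e e0; rewrite addr0.
have [B hB] := vf e e0; apply: (le_trans (mf x (Num.max x B) Ax _)).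
  by rewrite le_max lexx.
by apply: hB; rewrite le_max lexx orbT.
Qed.

(** Otherwise the derivative keeps a sign and a size [c], and over an interval of length 4 the
    function moves by [4 c], although it is already below [c]. *)
Lemma hardy_derive_vanishing f : H f -> vanishing f -> vanishing (derive1 f).
Proof.
move=> Hf vf; case: (hardy_vanishing (hardy_derive hH Hf)) => // -[c [B [c0 B0 hc]]].
have [D D0 df] := hardy_is_derive Hf; have [E hE] := vf c c0.
exfalso; pose x := B + D + `|E|.
have nE := normr_ge0 E.
have Bx : B <= x by rewrite /x; move: D0 nE; clear; lra.
have Dx : D <= x by rewrite /x; move: B0 nE; clear; lra.
have Ex : E <= x by rewrite /x; have := ler_norm E; move: B0 D0; clear; lra.
have x4 : x <= x + 4 by rewrite lerDl.
have [z /andP[z1 _] e] := mean_value df Dx x4.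
have := hE x Ex; have := hE (x + 4) (le_trans Ex x4); rewrite !ler_norml.
have : f (x + 4) - f x = derive1 f z * 4 by rewrite e addrAC subrr add0r.
by case: hc => hc; have := hc z (le_trans Bx z1); move: c0; clear; lra.
Qed.

(** A derivative of a positive germ bounded below either tends to 0 or is itself bounded below. If
    none tended to 0, integrating [K >= l] times would give [alpha x >= c x^K], against
    sub-polynomial growth; [d] is the last order before this happens. The other properties hold
    because germs of a Hardy field are finally monotone and of constant sign. *)
Lemma hardy_growth (alpha : R -> R) : H alpha -> sub_polynomial alpha ->
  (alpha x @[x --> +oo] --> +oo) -> exists d A, growth (fun j => iter j (fun f : R -> R => derive1 f) alpha) d A.
Proof.
move=> Halpha [_ [l l0 hl]] hinf; pose F j := iter j (fun f : R -> R => derive1 f) alpha; rewrite -/F.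
have HF j : H (F j) by elim: j => //= j; exact: (hardy_derive hH).
pose big f := exists c B, [/\ 0 < c, 0 < B & forall x, B <= x -> c <= f x].
have big0 : big (F 0%N).
  have /near_pinftyP[B B0 hB] : \forall x \near +oo, 1 <= alpha x by move/cvgryPge: hinf; exact.
  by exists 1, B.
have bigS j : big (F j) -> ~ vanishing (F j.+1) -> big (F j.+1).
  move=> bj nv; case: (hardy_vanishing (HF j.+1)) => // -[c [B [c0 B0 [hc|hc]]]]; first by exists c, B.
  exfalso; have [b [D [b0 D0 hD]]] := bj; have [E E0 dF] := hardy_is_derive (HF j).
  pose A := B + E.
  have AB x : A <= x -> B <= x by rewrite /A; move: E0; clear; lra.
  have AE x : A <= x -> E <= x by rewrite /A; move: B0; clear; lra.
  have A0 : 0 < A by rewrite addr_gt0.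
  have [||C [c' [AC c'0 hC]]] := @growing_primitive (fun x => - F j x) (fun x => - F j.+1 x) A c 0 A0 c0.
  - by move=> x Ax; have := dF x (AE x Ax); exact: is_deriveN.
  - by move=> x Ax; rewrite expr0 mulr1; have := hc x (AB x Ax); clear; lra.
  have CD : 0 <= c' * (C + D) ^+ 1 by rewrite mulr_ge0 ?(ltW c'0)// expr1; move: A0 AC D0; clear; lra.
  have h1 : C <= C + D by rewrite lerDl ltW.
  have h2 : D <= C + D by move: A0 AC; clear; lra.
  have := hC (C + D) h1; have := hD (C + D) h2; move: CD b0; clear; lra.
have [d [bd vd]] : exists d, (forall j, (j <= d)%N -> big (F j)) /\ vanishing (F d.+1).
  apply: contrapT => h.
  have allbig k : forall j, (j <= k)%N -> big (F j).
    elim: k => [|k IH] j; first by rewrite leqn0 => /eqP ->.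
    rewrite leq_eqVlt => /orP[/eqP ->|]; last by rewrite ltnS; exact: IH.
    by apply: bigS; [exact: IH|move=> v; apply: h; exists k].
  have [K hK] := nat_ge l.
  have pow m : (m <= K)%N -> exists c B, [/\ 0 < c, 0 < B & forall x, B <= x -> c * x ^+ m <= F (K - m)%N x].
    elim: m => [_|m IH mK].
      rewrite subn0; have [c [B [c0 B0 hB]]] := allbig K K (leqnn _); exists c, B; split => // x /hB.
      by rewrite expr0 mulr1.
    have [c [B [c0 B0 hB]]] := IH (ltnW mK).
    have e : (K - m = (K - m.+1).+1)%N by move: mK; clear; lia.
    rewrite e in hB; have [E E0 dF] := hardy_is_derive (HF (K - m.+1)%N).
    have A0 : 0 < B + E by rewrite addr_gt0.
    have [||C [c' [AC c'0 hC]]] := @growing_primitive (F (K - m.+1)%N) (F (K - m.+1).+1) (B + E) c m A0 c0.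
    - by move=> x Ax; apply: dF; move: Ax B0; clear; lra.
    - by move=> x Ax; apply: hB; move: Ax E0; clear; lra.
    by exists c', C; split => //; exact: lt_le_trans AC.
  have [c [B [c0 B0 hB]]] := pow K (leqnn _).
  rewrite subnn in hB.
  have c20 : 0 < c / 2 by rewrite divr_gt0.
  have /near_pinftyP[E E0 hE] : \forall x \near +oo, `|alpha x / x `^ l| <= c / 2.
    by move/cvgr0Pnorm_le: hl; apply.
  pose x := B + E + 1.
  have x1 : 1 <= x by rewrite /x; move: B0 E0; clear; lra.
  have x0 : 0 < x by exact: lt_le_trans x1.
  have Bx : B <= x by rewrite /x; move: E0; clear; lra.
  have Ex : E <= x by rewrite /x; move: B0; clear; lra.
  have pl0 : 0 < x `^ l by exact: powR_gt0.
  have xl : x `^ l <= x ^+ K by rewrite -powR_mulrn ?(ltW x0)// ler_powR.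
  have ax : alpha x <= c / 2 * x `^ l.
    by rewrite -ler_pdivrMr//; apply: le_trans (hE x Ex); exact: ler_norm.
  have xK : 0 < c / 2 * x ^+ K by rewrite mulr_gt0// exprn_gt0.
  have h1 : c / 2 * x `^ l <= c / 2 * x ^+ K by rewrite ler_pM2l.
  by have := hB x Bx; rewrite /F/=; move: ax xK h1; clear; lra.
have v2 : vanishing (F d.+2) by exact: (hardy_derive_vanishing (HF d.+1)).
have [A1 A10 n1] := hardy_vanishing_noninc (HF d.+1) vd.
have [A2 A20 n2] := hardy_vanishing_noninc (HF d.+2) v2.
have [A3 A30 s3] := hardy_sign (HF d.+1).
have /choice[A4 hA4] : forall i, exists A, 0 < A /\ forall x, A <= x -> is_derive x 1 (F i) (F i.+1 x).
  by move=> i; have [A A0 h] := hardy_is_derive (HF i); exists A.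
have /choice[A5 hA5] : forall i, exists A, 0 < A /\ ((i <= d)%N -> forall x, A <= x -> 0 < F i x).
  move=> i; case: (leqP i d) => id; last by exists 1.
  have [c [B [c0 B0 hB]]] := bd i id; exists B; split => // _ x /hB; exact: lt_le_trans.
have [c [A6 [c0 A60 h6]]] := bd d (leqnn _).
pose S4 := \sum_(i < d.+2) A4 i; pose S5 := \sum_(i < d.+1) A5 i.
have S40 : 0 <= S4 by apply: sumr_ge0 => i _; case: (hA4 i) => /ltW.
have S50 : 0 <= S5 by apply: sumr_ge0 => i _; case: (hA5 i) => /ltW.
have le4 i : (i < d.+2)%N -> A4 i <= S4.
  move=> hi; rewrite /S4 (bigD1 (Ordinal hi))//= lerDl sumr_ge0// => j _.
  by case: (hA4 j) => /ltW.
have le5 i : (i < d.+1)%N -> A5 i <= S5.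
  move=> hi; rewrite /S5 (bigD1 (Ordinal hi))//= lerDl sumr_ge0// => j _.
  by case: (hA5 j) => /ltW.
exists d, (A1 + A2 + A3 + A6 + S4 + S5); set A := _ + S5.
have AA : [/\ A1 <= A, A2 <= A, A3 <= A & A6 <= A] by rewrite /A; split; move: A10 A20 A30 A60 S40 S50; clear; lra.
have [AA1 AA2 AA3 AA6] := AA.
have AS4 : S4 <= A by rewrite /A; move: A10 A20 A30 A60 S50; clear; lra.
have AS5 : S5 <= A by rewrite /A; move: A10 A20 A30 A60 S40; clear; lra.
split => //.
- move=> i x hi Ax; case: (hA4 i) => _; apply; apply: le_trans Ax; exact: le_trans (le4 i hi) AS4.
- exact: lt_le_trans AA1.
- move=> i x id Ax; case: (hA5 i) => _; apply => //; apply: le_trans Ax; exact: le_trans (le5 i id) AS5.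
- by exists c => // x Ax; apply: h6; exact: le_trans Ax.
- case: s3 => s3; [left|right|left] => x Ax; have A3x := le_trans AA3 Ax.
  + by apply/ltW/s3.
  + by apply/ltW/s3.
  + by rewrite s3.
- by move=> x y Ax xy; apply: n1 => //; exact: le_trans Ax.
- by move=> x y Ax xy; apply: n2 => //; exact: le_trans Ax.
Qed.

End OneField.
End HardyFields.

(** * The two implications *)

Section EvenFloors.
Variable R : realType.
Implicit Types alpha : R -> R.

Lemma infinite_set_natP (S : set nat) : infinite_set S <-> forall N : nat, exists2 n, (N <= n)%N & S n.
Proof.
split=> [iS N|h /finite_seqP[s sE]].
  apply: contrapT => h; apply: iS; apply: (@sub_finite_set _ S `I_N); last exact: finite_II.
  by move=> n Sn /=; rewrite ltnNge; apply/negP => Nn; apply: h; exists n.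
have [n nN Sn] := h (\sum_(i <- s) i).+1.
have : n \in s by move: Sn; rewrite sE.
by move=> ns; move: nN; rewrite (big_rem n)//= ltnNge leq_addr.
Qed.

(** The increments are below 1, so no large integer is skipped by the floors, and two of [k + 1]
    consecutive integers have the same colour. *)
Lemma sums_of_slow alpha A k (col : nat -> 'I_k) :
  (forall x, A <= x -> alpha (x + 1) - alpha x <= 2^-1) ->
  (forall M : R, exists B, forall x, B <= x -> M <= alpha x) ->
  monochromatic_floor_sum alpha col.
Proof.
move=> slow inf.
have [n0 hn0] := nat_ge A.
have [N hN] := nat_ge (alpha n0.+1%:R).
have hits M : (N < M)%N -> exists2 n, (0 < n)%N & Num.floor (alpha n%:R) = M.
  move=> NM; pose P n := (n0 < n)%N && (M%:R <= alpha n%:R).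
  have exP : exists n, P n.
    have [B hB] := inf M%:R; have [n hn] := nat_ge B.
    exists (n0.+1 + n)%N; rewrite /P leq_addr hB//; apply: (le_trans hn).
    by rewrite ler_nat leq_addl.
  have := ex_minnP exP => -[n /andP[n1 n2] nmin].
  exists n; first exact: leq_ltn_trans n1.
  have nn : (n0.+1 < n)%N.
    rewrite ltn_neqAle n1 andbT; apply/eqP => e; move: n2; rewrite -e leNgt.
    by rewrite (le_lt_trans hN)// ltr_nat.
  have lt : alpha n.-1%:R < M%:R.
    rewrite ltNge; apply/negP => h; have := nmin n.-1.
    rewrite /P h andbT; move: nn; clear; lia.
  have n10 : A <= n.-1%:R by apply: (le_trans hn0); rewrite ler_nat; move: nn; clear; lia.
  have := slow _ n10; rewrite natr1 prednK ?(leq_ltn_trans _ nn)// => st.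
  by apply: floor_def; rewrite intrD -pmulrn; move: n2 st lt; clear; lra.
pose f (i : 'I_k.+1) := col (N + i).+1.
have /injectivePn[i [j ij e]] : ~~ injectiveb f.
  apply/negP => /injectiveP/leq_card; by rewrite !card_ord ltnn.
have [|n n0' hn] := hits ((N + i).+1 + (N + j).+1)%N; first by clear; lia.
exists (N + i).+1, (N + j).+1, n; split => //.
by move=> [/addnI/val_inj ij']; move: ij; rewrite ij' eqxx.
Qed.

(** If only finitely many floors are even, let [M] bound them; give each integer up to [M] its own
    colour and colour the others by parity. Two distinct integers of one colour then have an even
    sum exceeding [M]. *)
Lemma even_floors_of_sums alpha :
  (forall (k : nat) (c : nat -> 'I_k), monochromatic_floor_sum alpha c) ->
  infinite_set [set n : nat | (0 < n)%N /\ (2 %| Num.floor (alpha n%:R))%Z].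
Proof.
move=> sums /finite_seqP[s sE].
pose M := \sum_(n <- s) `|Num.floor (alpha n%:R)|%N.
have bnd n : (0 < n)%N -> (2 %| Num.floor (alpha n%:R))%Z -> (`|Num.floor (alpha n%:R)| <= M)%N.
  move=> n0 en; have ns : n \in s by have : [set` s] n by rewrite -sE.
  by rewrite /M (big_rem n)//= leq_addr.
pose c x : 'I_(M.+3) := inord (if (x <= M)%N then x else M.+1 + odd x)%N.
have [x [y [n [[x0 y0 n0] xy cxy e]]]] := sums _ c.
have cE z : c z = (if (z <= M)%N then z else M.+1 + odd z)%N :> nat.
  by rewrite inordK//; case: ifP => h; move: h; clear; lia.
have := congr1 (@nat_of_ord _) cxy; rewrite !cE.
case: (leqP x M) => hx; case: (leqP y M) => hy cc.
- exact: xy.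
- by move: hx cc; clear; lia.
- by move: hy cc; clear; lia.
have even : (2 %| Num.floor (alpha n%:R))%Z.
  rewrite -e dvdzE /= dvdn2 oddD; move: cc => /addnI.
  by case: (odd x); case: (odd y).
by have := bnd n n0 even; rewrite -e /=; move: hx; clear; lia.
Qed.

Lemma rational1 : rational (1 : R).
Proof. by exists 1%N => //; rewrite mulr1 natr_int. Qed.

Lemma sums_of_even_floors (alpha : R -> R) : sub_polynomial alpha ->
  (alpha x @[x --> +oo] --> +oo) ->
  infinite_set [set n : nat | (0 < n)%N /\ (2 %| Num.floor (alpha n%:R))%Z] ->
  forall (k : nat) (c : nat -> 'I_k), monochromatic_floor_sum alpha c.
Proof.
move=> sub inf /infinite_set_natP even k c.
have infB (M : R) : exists B, forall x, B <= x -> M <= alpha x.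
  have /near_pinftyP[B B0 hB] : \forall x \near +oo, M <= alpha x by move/cvgryPge: inf; exact.
  by exists B.
have [[H hH Halpha] _] := sub.
have [d [A]] := hardy_growth hH Halpha sub inf.
set F : nat -> R -> R := fun j => _.
have -> : alpha = F 0%N by [].
rewrite -[alpha]/(F 0%N) in infB even *; clearbody F.
case: d => [|d] gF.
  have h12 : (0 : R) < 2^-1 by [].
  have [B hB] := growth_cvg0 gF h12.
  apply: (@sums_of_slow _ (`|A| + `|B|)) => // x hx.
  have Ax : A <= x by have := ler_norm A; have := normr_ge0 B; move: hx; clear; lra.
  have Bx : B <= x by have := ler_norm B; have := normr_ge0 A; move: hx; clear; lra.
  have xx : x <= x + 1 by rewrite lerDl.
  have lt02 : (0 < 2)%N by [].
  have [z /andP[z1 _] ->] := growth_mv gF lt02 Ax xx.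
  rewrite addrAC subrr add0r mulr1; apply: le_trans (hB z (le_trans Bx z1)).
  exact: ler_norm.
have [fast|slow] := pselect (forall C B : R, exists X, [/\ B <= X, C * F d.+1 X < X ^+ d.+2 * `|F d.+2 X| &
     `|F d.+2 (X / 4)| <= 4 ^+ d.+2 * `|F d.+2 X|]).
  have [C1 [C2 [C10 C20 hyp]]] := equidistributed_fast gF fast.
  exact: (monochromatic_sums_of_equidistributed C10 C20 hyp).
have [C [B hCB]] : exists C B, forall X, B <= X -> ~ (C * F d.+1 X < X ^+ d.+2 * `|F d.+2 X| /\
     `|F d.+2 (X / 4)| <= 4 ^+ d.+2 * `|F d.+2 X|).
  apply: contrapT => h; apply: slow => C B; apply: contrapT => h'; apply: h.
  by exists C, B => X BX [h1 h2]; apply: h'; exists X.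
have [A' [Ce [P [AA' nP]]]] := near_poly_of_slow gF hCB.
have {}gF := growth_le AA' gF.
have [rat|irr] := pselect (forall l, (0 < l < d.+2)%N -> rational (P`_l / lead_coef P)).
  apply: (monochromatic_sums_of_rational c gF nP rat infB) => N.
  by have [n Nn [_ en]] := even N; exists n.
(* The largest such degree is used, so that all higher coefficients have rational ratios and can be
   removed by differencing. It is at most [d], as the leading coefficient has ratio 1. *)
pose bad l := (0 < l < d.+2)%N && ~~ `[< rational (P`_l / lead_coef P) >].
have exbad : exists l, bad l.
  apply: contrapT => h; apply: irr => l hl; apply: contrapT => hr; apply: h; exists l.
  by rewrite /bad hl; apply/negP => /asboolP.
have badle l : bad l -> (l <= d.+2)%N by move=> /andP[/andP[_ h] _]; exact: ltnW.
have [j /andP[/andP[j0 jd] /negP hj] jmax] := ex_maxnP exbad badle.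
have irrj : ~ rational (P`_j / lead_coef P) by move=> h; apply: hj; apply/asboolP.
have [sP lP _ _] := nP.
have jd' : (0 < j <= d)%N.
  rewrite j0 -ltnS ltn_neqAle -ltnS jd andbT; apply/eqP => e; apply: irrj.
  by rewrite e lead_coefE sP/= -[P`_d.+1]/(P`_(d.+2.-1)) -sP -lead_coefE divff ?gt_eqF//; exact: rational1.
have ratj l : (j < l < d.+2)%N -> rational (P`_l / lead_coef P).
  move=> /andP[jl ld]; apply: contrapT => hl; have := jmax l.
  rewrite /bad ld (leq_trans _ jl)//=; move=> h; have : (l <= j)%N by apply: h; apply/negP => /asboolP.
  by rewrite leqNgt jl.
have [C1 [C2 [C10 C20 hyp]]] := equidistributed_irrational gF nP jd' ratj irrj.
exact: (monochromatic_sums_of_equidistributed C10 C20 hyp).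
Qed.

End EvenFloors.

Theorem theorem1p3 (R : realType) (alpha : R -> R)
    (alpha_subpoly : sub_polynomial alpha)
    (alpha_infty : alpha x @[x --> +oo] --> +oo) :
  infinite_set [set n : nat | (0 < n)%N /\ (2 %| Num.floor (alpha n%:R))%Z]
  <->
  (forall (k : nat) (c : nat -> 'I_k),
     exists x y n : nat,
       [/\ [/\ (0 < x)%N, (0 < y)%N & (0 < n)%N],
           x <> y,
           c x = c y
         & (x + y)%N%:Z = Num.floor (alpha n%:R)]).
Proof.
by split=> [/(sums_of_even_floors alpha_subpoly alpha_infty)|/even_floors_of_sums].
Qed.
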